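(* Let $C$ be a kernel configuration with $\deg(C)\neq 1$. A model $(\mathcal M,\theta)\models T_\theta^C$ is an existentially closed model of $T_\theta^C$ if and only if $\theta$ is $C$-image-complete and $$(\mathcal M,\theta)\models\exists\underline x\in\mathbb V:\psi_\theta(\underline x)\wedge S(\underline x)$$ holds for every $C$-sequence-system $S(\underline x)$ over $(\mathbb V,\theta)$ and every $L(M)$-formula $\psi(\vec x)$ which is bounded by $S$ and does not imply any finite disjunction of non-trivial linear dependencies in $\vec x$ over $\mathbb V$.
   Context: Setting: $L$ is a first-order language, $T$ a model-complete $L$-theory and $K$ a field. There are $L$-formulas without parameters which define, in every model $\mathcal M\models T$, a nontrivial $K$-vector space $\mathbb V=\mathbb V^{\mathcal M}$; elements of $\mathbb V$ are treated as single elements. $L_\theta=L\cup\{\theta\}$, $\theta$ a new unary function symbol; $T_\theta$ is $T$ plus axioms saying $\theta|_{\mathbb V}$ is a $K$-linear endomorphism of $\mathbb V$ and $\theta(x)=0$ for $x\notin\mathbb V$. For $\rho=\sum_i(\rho)_iX^i\in K[X]$, $\rho[\theta]:=\sum_i(\rho)_i\theta^i$; $\mathrm{Ker}(\rho),\mathrm{Im}(\rho)$ denote kernel and image of $\rho[\theta]$ on $\mathbb V$. $K[X]_{\mathrm{irr}}$ is the set of monic irreducible polynomials in $K[X]$. A kernel configuration is a pair $C=(c,d)$ with $c:K[X]_{\mathrm{irr}}\to\mathbb N\cup\{\infty\}$, $d\in\mathbb N_{>0}\cup\{\infty\}$, such that $d=\infty$ or $d=\sum_f\deg(f)c(f)$;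 write $C(f)=c(f)$, $\deg(C)=d$, and $f^C:=f^{C(f)}$. $C$ is algebraic if $d<\infty$, with minimal polynomial $\mathrm{MiPo}(C)=\prod_f f^{C(f)}$, and transcendental otherwise. An endomorphism $\theta$ is a $C$-endomorphism if $\mathrm{MiPo}(C)[\theta]=0$ (algebraic case), resp. $\mathrm{Ker}(f^{C(f)})=\mathrm{Ker}(f^{C(f)+1})$ for all $f$ with $C(f)<\infty$ (transcendental case). $T_\theta^C$ is $T_\theta$ plus axioms saying $\theta|_{\mathbb V}$ is a $C$-endomorphism. $\theta$ is $C$-image-complete if $\mathrm{Im}(f^{C(f)})=\mathrm{Im}(f^{C(f)+1})$ for all $f\in K[X]_{\mathrm{irr}}$ with $C(f)<\infty$. Existentially closed model of $T'$: for every extension $(\mathcal M',\theta')\supseteq(\mathcal M,\theta)$ with $(\mathcal M',\theta')\models T'$, every existential sentence with parameters in $\mathcal M$ true in the extension is true in $(\mathcal M,\theta)$. Placeholder notation: for $\underline x=(x_1,\dots,x_n)$, $\vec x=(x_k^i:1\le k\le n,i\in\omega)$ are new variables; $\psi_\theta(\underline x)$ is $\psi(\vec x)$ with each $x^i_k$ replaced by $\theta^i(x_k)$. $\psi(\vec x)$ implies no finite disjunction of non-trivial linear dependencies in $\vec x$ over $\mathbb V$ if there are no finitely many equations $\sum_{k,i}a^{(j)}_{k,i}x^i_k=v_j$ ($a^{(j)}_{k,i}\in K$ not all zero, $v_j\in\mathbb V$) whose disjunction is implied by $\psi(\vec x)\wedge\vec x\in\mathbb V$ in $\mathcal M$. A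 $C$-sequence-system over $(\mathbb V,\theta)$ is a formula $S(\underline x)=\bigwedge_{k=1}^n\big(\xi_k[\theta](x_{\mathrm{ld},k})=\sum_{l=1}^mP_{k,l}[\theta](x_{\mathrm{li},l})+u_{\mathrm{ld},k}\big)\wedge\bigwedge_{k=1}^r\big(f_k^{q_k}[\theta](x_{\mathrm{ke},k})=u_{\mathrm{ke},k}\big)$, with $\underline x=(x_{\mathrm{li},1},\dots,x_{\mathrm{li},m},x_{\mathrm{ld},1},\dots,x_{\mathrm{ld},n},x_{\mathrm{ke},1},\dots,x_{\mathrm{ke},r})$, $P_{k,l}\in K[X]$, $u_{\mathrm{ld},k}\in\mathbb V$, such that: (i) if $C$ is algebraic then $m=n=0$; (ii) each $\xi_k$ is monic of positive degree and all its irreducible factors $g$ satisfy $C(g)=\infty$; (iii) each $f_k\in K[X]_{\mathrm{irr}}$ has $0<C(f_k)<\infty$, $0<q_k\le C(f_k)$, and $u_{\mathrm{ke},k}\in\mathrm{Ker}(f_k^{C(f_k)-q_k})$. An $L(M)$-formula $\psi(\vec x)$ is bounded by $S$ if $x^i_{\mathrm{ld},k}$ occurs in $\psi$ only for $i<\deg(\xi_k)$ and $x^i_{\mathrm{ke},k}$ occurs only for $i<\deg(f_k^{q_k})$. *)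

(* Defs.v *)
From HB Require Import structures.
From mathcomp Require Import all_boot all_order all_algebra.
From Stdlib Require Import ClassicalEpsilon.
Set Implicit Arguments. Unset Strict Implicit. Unset Printing Implicit Defensive.
Import GRing.Theory.
Local Open Scope ring_scope.

Record lang := Lang {
  fsym : Type; far : fsym -> nat;
  rsym : Type; rar : rsym -> nat }.

Definition Ltheta (L : lang) : lang :=
  Lang (fun o : option (fsym L) => if o is Some f then far f else 1%N) (@rar L).

Inductive term (L : lang) (A : Type) : Type :=
| TVar : nat -> term L A
| TPar : A -> term L A
| TApp : forall f : fsym L, ('I_(far f) -> term L A) -> term L A.

Inductive formula (L : lang) (A : Type) : Type :=
| FFalse : formula L A
| FEq : term L A -> term L A -> formula L A
| FRel : forall r : rsym L, ('I_(rar r) -> term L A) -> formula L A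
| FNot : formula L A -> formula L A
| FAnd : formula L A -> formula L A -> formula L A
| FOr : formula L A -> formula L A -> formula L A
| FImp : formula L A -> formula L A -> formula L A
| FEx : nat -> formula L A -> formula L A
| FAll : nat -> formula L A -> formula L A.

Arguments FFalse {L A}.

Fixpoint tfv_in (L : lang) (A : Type) (s : seq nat) (t : term L A) : bool :=
  match t with
  | TVar n => n \in s
  | TPar _ => true
  | TApp f args => [forall i, tfv_in s (args i)]
  end.

Fixpoint ffv_in (L : lang) (A : Type) (s : seq nat) (p : formula L A) : bool :=
  match p with
  | FFalse => true
  | FEq t1 t2 => tfv_in s t1 && tfv_in s t2
  | FRel r args => [forall i, tfv_in s (args i)]
  | FNot q => ffv_in s q
  | FAnd q1 q2 | FOr q1 q2 | FImp q1 q2 => ffv_in s q1 && ffv_in s q2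
  | FEx x q | FAll x q => ffv_in (x :: s) q
  end.

Definition closedf (L : lang) (A : Type) (p : formula L A) := ffv_in [::] p.

Fixpoint tpar_occ (L : lang) (A : Type) (a : A) (t : term L A) : Prop :=
  match t with
  | TVar _ => False
  | TPar b => b = a
  | TApp f args => exists i, tpar_occ a (args i)
  end.

Fixpoint fpar_occ (L : lang) (A : Type) (a : A) (p : formula L A) : Prop :=
  match p with
  | FFalse => False
  | FEq t1 t2 => tpar_occ a t1 \/ tpar_occ a t2
  | FRel r args => exists i, tpar_occ a (args i)
  | FNot q => fpar_occ a q
  | FAnd q1 q2 | FOr q1 q2 | FImp q1 q2 => fpar_occ a q1 \/ fpar_occ a q2
  | FEx _ q | FAll _ q => fpar_occ a q
  end.

Fixpoint qf (L : lang) (A : Type) (p : formula L A) : bool :=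
  match p with
  | FEx _ _ | FAll _ _ => false
  | FNot q => qf q
  | FAnd q1 q2 | FOr q1 q2 | FImp q1 q2 => qf q1 && qf q2
  | _ => true
  end.

Fixpoint existential (L : lang) (A : Type) (p : formula L A) : bool :=
  match p with
  | FEx _ q => existential q
  | _ => qf p
  end.

Record structure (L : lang) := Struct {
  carrier :> Type;
  sinh : carrier;
  sfun : forall f : fsym L, ('I_(far f) -> carrier) -> carrier;
  srel : forall r : rsym L, ('I_(rar r) -> carrier) -> Prop }.

Definition expand (L : lang) (M : structure L) (th : M -> M) :
  structure (Ltheta L) :=
  @Struct (Ltheta L) (carrier M) (sinh M)
    (fun o => match o as o0 return ('I_(@far (Ltheta L) o0) -> M) -> M with
              | Some f => @sfun L M f
              | None => fun args => th (args ord0)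
              end)
    (@srel L M).

Definition upd (M : Type) (e : nat -> M) (x : nat) (v : M) : nat -> M :=
  fun n => if n == x then v else e n.

Fixpoint teval (L : lang) (A : Type) (M : structure L) (par : A -> M)
  (e : nat -> M) (t : term L A) : M :=
  match t with
  | TVar n => e n
  | TPar a => par a
  | TApp f args => sfun (fun i => teval par e (args i))
  end.

Fixpoint sat (L : lang) (A : Type) (M : structure L) (par : A -> M)
  (e : nat -> M) (p : formula L A) : Prop :=
  match p with
  | FFalse => False
  | FEq t1 t2 => teval par e t1 = teval par e t2
  | FRel r args => srel (fun i => teval par e (args i))
  | FNot q => ~ sat par e q
  | FAnd q1 q2 => sat par e q1 /\ sat par e q2
  | FOr q1 q2 => sat par e q1 \/ sat par e q2
  | FImp q1 q2 => sat par e q1 -> sat par e q2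
  | FEx x q => exists v : M, sat par (upd e x v) q
  | FAll x q => forall v : M, sat par (upd e x v) q
  end.

Definition noparam (M : Type) (v : void) : M := match v with end.

Definition emb (L : lang) (M M' : structure L) (h : M -> M') : Prop :=
  [/\ injective h,
      (forall f args, h (@sfun L M f args) = @sfun L M' f (fun i => h (args i)))
    & (forall r args, @srel L M r args <-> @srel L M' r (fun i => h (args i)))].

Definition model (L : lang) (T : formula L void -> Prop) (M : structure L) :=
  forall p, T p -> forall e, sat (@noparam M) e p.

Definition model_complete (L : lang) (T : formula L void -> Prop) :=
  forall (M M' : structure L) (h : M -> M'), model T M -> model T M' ->
    emb h -> forall (p : formula L void) (e : nat -> M),
      sat (@noparam M) e p <-> sat (@noparam M') (fun n => h (e n)) p.

(* fV(x0) : x0 in V ; f0(x0) : x0 = 0 ; fadd(x0,x1,x2) : x0 + x1 = x2 ;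
   fsc a (x0,x1) : a . x0 = x1  -- parameter-free L-formulas *)
Record vsdef (L : lang) (K : fieldType) := VSDef {
  fV : formula L void; f0 : formula L void;
  fadd : formula L void; fsc : K -> formula L void }.

Section VS.
Variables (L : lang) (K : fieldType) (D : vsdef L K) (M : structure L).

Definition env2 (x y : M) : nat -> M := fun k => nth y [:: x; y] k.
Definition env3 (x y z : M) : nat -> M := fun k => nth z [:: x; y; z] k.

Definition inV (x : M) : Prop := sat (@noparam M) (fun _ => x) (fV D).
Definition is0 (z : M) : Prop := sat (@noparam M) (fun _ => z) (f0 D).
Definition isadd (x y z : M) : Prop := sat (@noparam M) (env3 x y z) (fadd D).
Definition issc (a : K) (x y : M) : Prop := sat (@noparam M) (env2 x y) (fsc D a).

(* the operations defined by the formulas (well defined on V under the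
   hypothesis [defines_vs] below) *)
Definition vzero : M := epsilon (inhabits (sinh M)) is0.
Definition vadd (x y : M) : M := epsilon (inhabits x) (isadd x y).
Definition vscale (a : K) (x : M) : M := epsilon (inhabits x) (issc a x).
Definition vsum (s : seq M) : M := foldr vadd vzero s.

Definition vs_graphs : Prop :=
  [/\ (forall z, is0 z -> inV z) /\ (exists z, is0 z /\ forall z', is0 z' -> z' = z),
      (forall x y z, isadd x y z -> [/\ inV x, inV y & inV z]) /\
      (forall x y, inV x -> inV y ->
          exists z, isadd x y z /\ forall z', isadd x y z' -> z' = z)
    & (forall a x y, issc a x y -> inV x /\ inV y) /\
      (forall a x, inV x -> exists y, issc a x y /\ forall y', issc a x y' -> y' = y)].

Definition vs_axioms : Prop :=
  (forall x y z, inV x -> inV y -> inV z -> vadd x (vadd y z) = vadd (vadd x y) z) /\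
  (forall x y, inV x -> inV y -> vadd x y = vadd y x) /\
  (forall x, inV x -> vadd vzero x = x) /\
  (forall x, inV x -> exists y, inV y /\ vadd x y = vzero) /\
  (forall x, inV x -> vscale 1 x = x) /\
  (forall a b x, inV x -> vscale (a * b) x = vscale a (vscale b x)) /\
  (forall a x y, inV x -> inV y -> vscale a (vadd x y) = vadd (vscale a x) (vscale a y)) /\
  (forall a b x, inV x -> vscale (a + b) x = vadd (vscale a x) (vscale b x)).

Definition peval (rho : {poly K}) (th : M -> M) (x : M) : M :=
  vsum [seq vscale rho`_i (iter i th x) | i <- iota 0 (size rho)].

Definition inKer (rho : {poly K}) (th : M -> M) (x : M) : Prop :=
  inV x /\ peval rho th x = vzero.
Definition inIm (rho : {poly K}) (th : M -> M) (y : M) : Prop :=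
  exists x, inV x /\ peval rho th x = y.

End VS.

Definition defines_vs (L : lang) (K : fieldType) (T : formula L void -> Prop)
  (D : vsdef L K) : Prop :=
  [/\ ffv_in [:: 0%N] (fV D), ffv_in [:: 0%N] (f0 D), ffv_in [:: 0%N; 1%N; 2%N] (fadd D),
      (forall a, ffv_in [:: 0%N; 1%N] (fsc D a))
    & forall M : structure L, model T M ->
        [/\ vs_graphs D M, vs_axioms D M & exists v, inV D v /\ v <> vzero D M]].

Definition mirr (K : fieldType) (f : {poly K}) : Prop :=
  f \is monic /\ irreducible_poly f.

(* C = (c, d); None stands for infinity.  Only the values of c on K[X]_irr
   are relevant. *)
Record kconf (K : fieldType) := KConf {
  kc : {poly K} -> option nat;
  kd : option nat }.

Definition cnum (K : fieldType) (C : kconf K) (f : {poly K}) : nat :=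
  odflt 0%N (kc C f).

Definition polydeg (K : fieldType) (f : {poly K}) : nat := (size f).-1.

Definition is_kconf (K : fieldType) (C : kconf K) : Prop :=
  kd C <> Some 0%N /\
  forall n, kd C = Some n ->
    (forall f, mirr f -> kc C f <> None) /\
    exists s : seq {poly K},
      [/\ uniq s, (forall f, f \in s -> mirr f),
          (forall f, mirr f -> f \notin s -> kc C f = Some 0%N)
        & n = (\sum_(f <- s) polydeg f * cnum C f)%N].

Definition algebraic (K : fieldType) (C : kconf K) : Prop := kd C <> None.

Section Models.
Variables (L : lang) (K : fieldType) (T : formula L void -> Prop)
  (D : vsdef L K) (C : kconf K).

(* theta is a C-endomorphism of V.  In the algebraic case
   MiPo(C) = prod_{f <- s} f^C(f) for any duplicate-free list s of monic
   irreducibles containing all f with C(f) > 0. *)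
Definition cendo (M : structure L) (th : M -> M) : Prop :=
  match kd C with
  | Some _ =>
      forall s : seq {poly K}, uniq s -> (forall f, f \in s -> mirr f) ->
        (forall f, mirr f -> cnum C f <> 0%N -> f \in s) ->
        forall x, inV D x -> peval D (\prod_(f <- s) f ^+ cnum C f) th x = vzero D M
  | None =>
      forall f q, mirr f -> kc C f = Some q ->
        forall x, inKer D (f ^+ q) th x <-> inKer D (f ^+ q.+1) th x
  end.

Definition modelTC (M : structure L) (th : M -> M) : Prop :=
  [/\ model T M,
      (forall x, inV D x -> inV D (th x)) /\
      (forall x y, inV D x -> inV D y -> th (vadd D x y) = vadd D (th x) (th y)),
      (forall a x, inV D x -> th (vscale D a x) = vscale D a (th x)),
      (forall x, ~ inV D x -> th x = vzero D M)
    & cendo th].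

Definition ec_model (M : structure L) (th : M -> M) : Prop :=
  modelTC th /\
  forall (M' : structure L) (th' : M' -> M') (h : M -> M'),
    emb (M := expand th) (M' := expand th') h -> modelTC th' ->
    forall p : formula (Ltheta L) M, closedf p -> existential p ->
      sat (M := expand th') h (fun _ => sinh M') p ->
      sat (M := expand th) id (fun _ => sinh M) p.

Definition image_complete (M : structure L) (th : M -> M) : Prop :=
  forall f q, mirr f -> kc C f = Some q ->
    forall y, inIm D (f ^+ q) th y <-> inIm D (f ^+ q.+1) th y.

Definition vidx (m n r : nat) := ('I_m + 'I_n + 'I_r)%type.
Definition li (m n r : nat) (l : 'I_m) : vidx m n r := inl (inl l).
Definition ld (m n r : nat) (k : 'I_n) : vidx m n r := inl (inr k).
Definition ke (m n r : nat) (k : 'I_r) : vidx m n r := inr k.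

(* placeholder variables x_k^i *)
Definition phvar (m n r : nat) := (vidx m n r * nat)%type.

Record seqsys (M : Type) (m n r : nat) := SeqSys {
  xi : 'I_n -> {poly K};
  Pc : 'I_n -> 'I_m -> {poly K};
  uld : 'I_n -> M;
  fk : 'I_r -> {poly K};
  qk : 'I_r -> nat;
  uke : 'I_r -> M }.

Definition is_seqsys (M : structure L) (th : M -> M) (m n r : nat)
  (S : seqsys M m n r) : Prop :=
  [/\ algebraic C -> m = 0%N /\ n = 0%N,
      (forall k, [/\ xi S k \is monic, (0 < polydeg (xi S k))%N,
                     (forall g, mirr g -> g %| xi S k -> kc C g = None)
                   & inV D (uld S k)])
    & (forall k, exists e, [/\ mirr (fk S k), kc C (fk S k) = Some e, (0 < e)%N,
                    (0 < qk S k <= e)%N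
                  & inKer D (fk S k ^+ (e - qk S k)) th (uke S k)])].

Definition sat_seqsys (M : structure L) (th : M -> M) (m n r : nat)
  (S : seqsys M m n r) (x : vidx m n r -> M) : Prop :=
  (forall k : 'I_n,
     peval D (xi S k) th (x (ld _ _ k)) =
     vadd D (vsum D [seq peval D (Pc S k l) th (x (li _ _ l)) | l <- enum 'I_m])
            (uld S k)) /\
  (forall k : 'I_r, peval D (fk S k ^+ qk S k) th (x (ke _ _ k)) = uke S k).

Definition phpar (M : structure L) (m n r : nat) (y : phvar m n r -> M)
  (a : (M + phvar m n r)%type) : M :=
  match a with inl c => c | inr z => y z end.

Definition sat_psi_theta (M : structure L) (th : M -> M) (m n r : nat)
  (psi : formula L (M + phvar m n r)) (x : vidx m n r -> M) : Prop :=
  sat (phpar (fun z : phvar m n r => iter z.2 th (x z.1)))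
      (fun _ => sinh M) psi.

Definition bounded (M : structure L) (m n r : nat) (S : seqsys M m n r)
  (psi : formula L (M + phvar m n r)) : Prop :=
  (forall (k : 'I_n) i, fpar_occ (inr (ld _ _ k, i)) psi ->
       (i < polydeg (xi S k))%N) /\
  (forall (k : 'I_r) i, fpar_occ (inr (ke _ _ k, i)) psi ->
       (i < polydeg (fk S k ^+ qk S k))%N).

Definition no_lindep (M : structure L) (m n r : nat)
  (psi : formula L (M + phvar m n r)) : Prop :=
  ~ exists (J : nat) (supp : seq (phvar m n r)) (a : 'I_J -> phvar m n r -> K)
           (v : 'I_J -> M),
      [/\ uniq supp, (forall j, inV D (v j)),
          (forall j, exists z, a j z != 0),
          (forall j z, a j z != 0 -> z \in supp)
        & forall y : phvar m n r -> M, (forall z, inV D (y z)) ->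
            sat (phpar y) (fun _ => sinh M) psi ->
            exists j, vsum D [seq vscale D (a j z) (y z) | z <- supp] = v j].

End Models.

(* Main.v *)
Require Import Defs.
From HB Require Import structures.
From mathcomp Require Import all_boot all_order all_algebra.
From mathcomp Require Import boolp classical_sets filter wochoice.
From Stdlib Require List ClassicalEpsilon.
Set Implicit Arguments. Unset Strict Implicit. Unset Printing Implicit Defensive.
Import GRing.Theory.
Local Open Scope ring_scope.

(** Necessity. A formula [psi] that implies no finite disjunction of linear
dependencies is realized in an elementary extension (an ultrapower) by a tuple
[y] independent over [V], together with an independent sequence to spare. The
values of [theta] on the [y]'s are dictated by the sequence system; on a
complement, [theta] acts as multiplication by X on a free K[X]-module, or on
copies of K[X]/(f) in the algebraic case, and the result is a C-endomorphism.
The existentially closed model satisfies every quantifier-free condition over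
the extension, so the extension embeds over it into an ultrapower of it. By
model completeness this embedding is elementary for L, hence [psi] and the
system have a solution in the model. Image completeness is obtained likewise,
by adjoining a preimage under f.

Sufficiency. The finitely many vectors of an extension involved in an
existential formula generate, modulo [V], a finitely generated K[X]-module,
hence a direct sum of cyclic modules with orders 0 or prime powers. Image
completeness allows to choose generators killed by f^C(f) when C(f) is finite,
so the generators solve a sequence system and are independent over [V] up to
the degrees of the orders. Writing the values of all subterms as linear
combinations of the generators turns the existential formula into a bounded
L-formula, to which the axiom applies. *)
(** * Formulas with parameters *)

(** The ultrapower is a structure for L alone, so theta has to be built on it by hand. Two things
    make this possible. The formula psi only sees the placeholders, hence it can be realized by
    vectors y before theta exists, and theta is then defined so that the orbits of the new
    generators run through these y. The remaining directions must carry a C-endomorphism too, and a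
    complement of finite dimension carries no free K[X]-module; the spare sequence gives the
    complement a basis that can be cut into infinite sequences, or into blocks of length deg f when
    MiPo(C) has to act as zero. In the converse direction the delicate point is to produce a psi
    which is bounded and implies no dependency in any placeholders, including those beyond the
    bounds. Values of terms are therefore kept reduced modulo the orders of the generators. This
    confines psi to placeholders below the bounds, where the generators are independent; the other
    placeholders can be moved freely, because V is infinite as soon as the extension has a new
    vector. *)

Section Syntax.
Variable L : lang.

Lemma teval_eq A (M : structure L) (par par' : A -> M) e e' (t : term L A) s :
  tfv_in s t -> (forall n, n \in s -> e n = e' n) ->
  (forall a, tpar_occ a t -> par a = par' a) ->
  teval par e t = teval par' e' t.
Proof.
elim: t => [n|a|f args IH] //=.
- by move=> ns /(_ _ ns).
- by move=> _ _; apply.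
- move=> /forallP fv he hp; congr (sfun _); apply/funext => i.
  by apply: IH => // a oa; apply: hp; exists i.
Qed.

Lemma sat_eq A (M : structure L) (par par' : A -> M) (p : formula L A) :
  forall s e e', ffv_in s p -> (forall n, n \in s -> e n = e' n) ->
  (forall a, fpar_occ a p -> par a = par' a) ->
  sat par e p <-> sat par' e' p.
Proof.
elim: p => [|t1 t2|r args|q IH|q1 IH1 q2 IH2|q1 IH1 q2 IH2|q1 IH1 q2 IH2|x q IH|x q IH]
  s e e' //=.
- move=> /andP[v1 v2] he hp.
  rewrite (teval_eq v1 he (par' := par')) ?(teval_eq v2 he (par' := par')) //.
  + by move=> a oa; apply: hp; right.
  + by move=> a oa; apply: hp; left.
- move=> /forallP fv he hp.
  suff -> : (fun i => teval par e (args i)) = (fun i => teval par' e' (args i)) by [].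
  apply/funext => i; apply: (teval_eq (fv i)) => // a oa; apply: hp; by exists i.
- by move=> v he hp; rewrite (IH s e e').
- move=> /andP[v1 v2] he hp; rewrite (IH1 s e e') ?(IH2 s e e') //.
  + by move=> a oa; apply: hp; right.
  + by move=> a oa; apply: hp; left.
- move=> /andP[v1 v2] he hp; rewrite (IH1 s e e') ?(IH2 s e e') //.
  + by move=> a oa; apply: hp; right.
  + by move=> a oa; apply: hp; left.
- move=> /andP[v1 v2] he hp; rewrite (IH1 s e e') ?(IH2 s e e') //.
  + by move=> a oa; apply: hp; right.
  + by move=> a oa; apply: hp; left.
- move=> fv he hp.
  have H v : sat par (upd e x v) q <-> sat par' (upd e' x v) q.
    apply: (IH (x :: s)) => // n; rewrite inE /upd.
    by case: eqP => //= _ /he.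
  by split=> -[v] /H; exists v.
- move=> fv he hp.
  have H v : sat par (upd e x v) q <-> sat par' (upd e' x v) q.
    apply: (IH (x :: s)) => // n; rewrite inE /upd.
    by case: eqP => //= _ /he.
  by split=> + v => /(_ v) /H.
Qed.

Lemma sat_closed A (M : structure L) (par : A -> M) (p : formula L A) e e' :
  closedf p -> sat par e p <-> sat par e' p.
Proof. by move=> cp; apply: sat_eq cp _ _. Qed.

(* [frn k fp] shifts all variables by [k], which frees the names below [k] for
   the parameters that [fp] turns into variables. *)
Fixpoint trn A B (k : nat) (fp : A -> B + nat) (t : term L A) : term L B :=
  match t with
  | TVar n => TVar L B (k + n)
  | TPar a => match fp a with inl b => TPar L b | inr j => TVar L B j end
  | TApp f args => TApp (fun i => trn k fp (args i))
  end.

Fixpoint frn A B (k : nat) (fp : A -> B + nat) (p : formula L A) : formula L B :=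
  match p with
  | FFalse => FFalse
  | FEq t1 t2 => FEq (trn k fp t1) (trn k fp t2)
  | FRel r args => FRel (fun i => trn k fp (args i))
  | FNot q => FNot (frn k fp q)
  | FAnd q1 q2 => FAnd (frn k fp q1) (frn k fp q2)
  | FOr q1 q2 => FOr (frn k fp q1) (frn k fp q2)
  | FImp q1 q2 => FImp (frn k fp q1) (frn k fp q2)
  | FEx x q => FEx (k + x) (frn k fp q)
  | FAll x q => FAll (k + x) (frn k fp q)
  end.

Definition rnspec A B (k : nat) (fp : A -> B + nat) (N : structure L)
  (par : B -> N) (par' : A -> N) (e : nat -> N) (a : A) : Prop :=
  match fp a with inl b => par' a = par b | inr j => (j < k)%N /\ par' a = e j end.

Lemma teval_trn A B k (fp : A -> B + nat) (N : structure L) (par : B -> N) par' e t :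
  (forall a, tpar_occ a t -> rnspec k fp par par' e a) ->
  teval par e (trn k fp t) = teval par' (fun n => e (k + n)%N) t.
Proof.
elim: t => [n|a|f args IH] //= h.
- by have := h _ erefl; rewrite /rnspec; case: (fp a) => [b|j [_]] /= ->.
- congr (sfun _); apply/funext => i.
  by apply: IH => a oa; apply: h; exists i.
Qed.

Lemma sat_frn A B k (fp : A -> B + nat) (N : structure L) (par : B -> N) par' p :
  forall e, (forall a, fpar_occ a p -> rnspec k fp par par' e a) ->
  sat par e (frn k fp p) <-> sat par' (fun n => e (k + n)%N) p.
Proof.
have upd_shift e x v :
  (fun n => upd e (k + x) v (k + n)%N) = upd (fun n => e (k + n)%N) x v :> (nat -> N).
  by apply/funext => n; rewrite /upd eqn_add2l.
have upd_spec e x v a : rnspec k fp par par' e a -> rnspec k fp par par' (upd e (k + x) v) a.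
  rewrite /rnspec; case: (fp a) => // j [jk ->]; split=> //.
  by rewrite /upd; case: eqP jk => // ->; rewrite ltnNge leq_addr.
elim: p => [|t1 t2|r args|q IH|q1 IH1 q2 IH2|q1 IH1 q2 IH2|q1 IH1 q2 IH2|x q IH|x q IH]
  e hk //=.
- by rewrite !(@teval_trn _ _ k fp N par par') // => a oa; apply: hk; [right|left].
- suff -> : (fun i => teval par e (trn k fp (args i))) =
            (fun i => teval par' (fun n => e (k + n)%N) (args i)) by [].
  apply/funext => i; apply: teval_trn => a oa; apply: hk; by exists i.
- by rewrite IH.
- by rewrite IH1 ?IH2 // => a oa; apply: hk; [right|left].
- by rewrite IH1 ?IH2 // => a oa; apply: hk; [right|left].
- by rewrite IH1 ?IH2 // => a oa; apply: hk; [right|left].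
- have H v : sat par (upd e (k + x) v) (frn k fp q) <->
             sat par' (upd (fun n => e (k + n)%N) x v) q.
    by rewrite IH ?upd_shift // => a /hk; apply: upd_spec.
  by split=> -[v] /H; exists v.
- have H v : sat par (upd e (k + x) v) (frn k fp q) <->
             sat par' (upd (fun n => e (k + n)%N) x v) q.
    by rewrite IH ?upd_shift // => a /hk; apply: upd_spec.
  by split=> + v => /(_ v) /H.
Qed.

Lemma tfv_trn A B k (fp : A -> B + nat) (t : term L A) s s' :
  (forall a j, tpar_occ a t -> fp a = inr j -> j \in s') ->
  (forall n, n \in s -> (k + n)%N \in s') ->
  tfv_in s t -> tfv_in s' (trn k fp t).
Proof.
elim: t => [n|a|f args IH] //= hp hs.
- by move=> /hs.
- by have := hp a; case: (fp a) => //= j /(_ j erefl erefl).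
- by move=> /forallP h; apply/forallP => i; apply: IH => // a j oa; apply: hp; exists i.
Qed.

Lemma ffv_frn A B k (fp : A -> B + nat) (p : formula L A) : forall s s',
  (forall a j, fpar_occ a p -> fp a = inr j -> j \in s') ->
  (forall n, n \in s -> (k + n)%N \in s') ->
  ffv_in s p -> ffv_in s' (frn k fp p).
Proof.
elim: p => [|t1 t2|r args|q IH|q1 IH1 q2 IH2|q1 IH1 q2 IH2|q1 IH1 q2 IH2|x q IH|x q IH]
  s s' hp hs //=.
- by move=> /andP[h1 h2]; apply/andP; split; [apply: tfv_trn h1|apply: tfv_trn h2];
    move=> // a j oa; apply: hp; [left|right].
- move=> /forallP h; apply/forallP => i; apply: tfv_trn (h i) => // a j oa; apply: hp.
  by exists i.
- exact: IH.
- by move=> /andP[h1 h2]; apply/andP; split; [apply: IH1 h1|apply: IH2 h2];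
    move=> // a j oa; apply: hp; [left|right].
- by move=> /andP[h1 h2]; apply/andP; split; [apply: IH1 h1|apply: IH2 h2];
    move=> // a j oa; apply: hp; [left|right].
- by move=> /andP[h1 h2]; apply/andP; split; [apply: IH1 h1|apply: IH2 h2];
    move=> // a j oa; apply: hp; [left|right].
- apply: IH => [a j oa /(hp a j oa)|n]; rewrite !inE ?eqn_add2l; first by move=> ->; rewrite orbT.
  by case/orP=> [->//|/hs ->]; rewrite orbT.
- apply: IH => [a j oa /(hp a j oa)|n]; rewrite !inE ?eqn_add2l; first by move=> ->; rewrite orbT.
  by case/orP=> [->//|/hs ->]; rewrite orbT.
Qed.

Lemma qf_frn A B k (fp : A -> B + nat) (p : formula L A) : qf (frn k fp p) = qf p.
Proof. by elim: p => //= q1 -> q2 ->. Qed.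

Lemma fpar_occ_frn A B k (fp : A -> B + nat) (p : formula L A) b :
  fpar_occ b (frn k fp p) -> exists2 a, fpar_occ a p & fp a = inl b.
Proof.
have T (t : term L A) : tpar_occ b (trn k fp t) -> exists2 a, tpar_occ a t & fp a = inl b.
  elim: t => [n|a|f args IH] //=.
    by case E: (fp a) => [b'|j] //= bb; exists a => //; rewrite E bb.
  by case=> i /IH[a oa fa]; exists a => //; exists i.
elim: p => [|t1 t2|r args|q IH|q1 IH1 q2 IH2|q1 IH1 q2 IH2|q1 IH1 q2 IH2|x q IH|x q IH] //=.
- by case=> /T[a oa fa]; exists a => //; [left|right].
- by case=> i /T[a oa fa]; exists a => //; exists i.
- by case=> [/IH1|/IH2] [a oa fa]; exists a => //; [left|right].
- by case=> [/IH1|/IH2] [a oa fa]; exists a => //; [left|right].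
- by case=> [/IH1|/IH2] [a oa fa]; exists a => //; [left|right].
Qed.

Lemma fpar_occ_fin A (p : formula L A) :
  exists l : seq {classic A}, forall a : {classic A}, fpar_occ a p -> a \in l.
Proof.
have args_fin n (P : 'I_n -> {classic A} -> Prop) :
    (forall i, exists l : seq {classic A}, forall a, P i a -> a \in l) ->
    exists l : seq {classic A}, forall a, (exists i, P i a) -> a \in l.
  move=> /choice[l hl]; exists (flatten [seq l i | i <- enum 'I_n]) => a [i /hl al].
  by apply/flatten_mapP; exists i; rewrite ?mem_enum.
have cat_fin (P Q : {classic A} -> Prop) :
    (exists l : seq {classic A}, forall a, P a -> a \in l) ->
    (exists l : seq {classic A}, forall a, Q a -> a \in l) ->
    exists l : seq {classic A}, forall a, P a \/ Q a -> a \in l.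
  move=> [l hl] [l' hl']; exists (l ++ l') => a.
  by rewrite mem_cat; case=> [/hl|/hl'] ->; rewrite ?orbT.
have T (t : term L A) : exists l : seq {classic A}, forall a, tpar_occ a t -> a \in l.
  elim: t => [n|a|f args IH] /=; first by exists [::].
    by exists [:: (a : {classic A})] => b ->; apply: (@mem_head {classic A}).
  exact: args_fin.
elim: p => [|t1 t2|r args|q IH|q1 IH1 q2 IH2|q1 IH1 q2 IH2|q1 IH1 q2 IH2|x q IH|x q IH] /=;
  try by [apply: cat_fin|].
- by exists [::].
- by apply: args_fin.
Qed.

Definition sumf A B (N : Type) (f : A -> N) (g : B -> N) (x : A + B) : N :=
  match x with inl a => f a | inr b => g b end.

(** Only the finitely many [B]-parameters that occur need variables, so the environment is
    constrained at these alone; from [k] on it is arbitrary, which is where the shifted variables of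
    [p] live. *)
Lemma abstract_params A B (p : formula L (A + B)) :
  exists (k : nat) (ix : B -> nat) (q : formula L A),
  [/\ (closedf p -> ffv_in (iota 0 k) q), qf q = qf p,
      forall (N : structure L) (f : A -> N) (g : B -> N) e,
        (forall b, fpar_occ (inr b) p -> e (ix b) = g b) ->
        sat f e q <-> sat (sumf f g) (fun n => e (k + n)%N) p,
      forall (N : structure L) (g : B -> N) (e0 : nat -> N), exists2 e,
        (forall b, fpar_occ (inr b) p -> e (ix b) = g b) &
        forall n, (k <= n)%N -> e n = e0 n &
      forall a, fpar_occ a q -> fpar_occ (inl a) p].
Proof.
have [l hl] := fpar_occ_fin p.
pose ix b := index (inr b : {classic (A + B)}) l.
pose fp (x : A + B) : A + nat := match x with inl a => inl a | inr b => inr (ix b) end.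
have ixl b : fpar_occ (inr b) p -> (ix b < size l)%N by move=> /hl; rewrite index_mem.
exists (size l), ix, (frn (size l) fp p); split.
- apply: ffv_frn => // -[a|b] j //= /ixl jl [<-].
  by rewrite mem_iota.
- exact: qf_frn.
- move=> N f g e eg; apply: sat_frn => -[a|b] //= ob.
  by rewrite /rnspec /=; split; [exact: ixl|rewrite eg].
- move=> N g d.
  exists (fun n => if nth None (map Some l) n is Some (inr b) then g b else d n).
    move=> b ob; rewrite (nth_map (inr b : {classic (A + B)})) ?ixl // nth_index //.
    exact: hl.
  by move=> n ln; rewrite nth_default ?size_map.
- move=> a oa; have [x ox] := fpar_occ_frn oa.
  by rewrite /fp; case: x ox => [a'|b] // oa' [<-].
Qed.

Lemma sat_exn A (N : structure L) (f : A -> N) (p : formula L A) s : forall e,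
  sat f e (foldr (@FEx L A) p s) <->
  exists2 e', (forall n, n \notin s -> e' n = e n) & sat f e' p.
Proof.
elim: s => [|x s IH] e /=.
  split=> [h|[e' he]]; first by exists e.
  by rewrite (_ : e' = e) //; apply/funext => n; apply: he.
split=> [[v]|[e' he h]].
  rewrite IH => -[e' he h]; exists e' => // n; rewrite inE negb_or => /andP[nx ns].
  by rewrite he // /upd (negbTE nx).
exists (e' x); apply/IH; exists e' => // n ns; rewrite /upd.
by case: eqP => [->//|/eqP nx]; rewrite he // inE negb_or nx.
Qed.

Lemma ffv_exn A (p : formula L A) s : forall s',
  (forall s1, (forall n, n \in s' \/ n \in s -> n \in s1) -> ffv_in s1 p) ->
  ffv_in s' (foldr (@FEx L A) p s).
Proof.
elim: s => [|x s IH] s' /= h; first by apply: h => n [].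
apply: IH => s1 h1; apply: h => n; rewrite !inE => -[ns|/orP[nx|ns]].
- by apply: h1; left; rewrite inE ns orbT.
- by apply: h1; left; rewrite inE nx.
- by apply: h1; right.
Qed.

Lemma ffv_sub A (p : formula L A) : forall s s',
  (forall n, n \in s -> n \in s') -> ffv_in s p -> ffv_in s' p.
Proof.
have T s s' (t : term L A) : (forall n, n \in s -> n \in s') -> tfv_in s t -> tfv_in s' t.
  move=> h; elim: t => //= f args IH /forallP v; apply/forallP => i; exact: IH.
elim: p => [|t1 t2|r args|q IH|q1 IH1 q2 IH2|q1 IH1 q2 IH2|q1 IH1 q2 IH2|x q IH|x q IH]
  s s' h //=.
- by move=> /andP[v1 v2]; apply/andP; split; [apply: T h v1|apply: T h v2].
- by move=> /forallP v; apply/forallP => i; apply: T h (v i).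
- exact: IH.
- by move=> /andP[v1 v2]; apply/andP; split; [apply: IH1 h v1|apply: IH2 h v2].
- by move=> /andP[v1 v2]; apply/andP; split; [apply: IH1 h v1|apply: IH2 h v2].
- by move=> /andP[v1 v2]; apply/andP; split; [apply: IH1 h v1|apply: IH2 h v2].
- by apply: IH => n; rewrite !inE => /orP[->//|/h ->]; rewrite orbT.
- by apply: IH => n; rewrite !inE => /orP[->//|/h ->]; rewrite orbT.
Qed.

(** Quantifying over a whole valuation of [B] stays first-order because only finitely many
    parameters occur. *)
Lemma exists_params A B (p : formula L (A + B)) : closedf p ->
  exists q : formula L A,
  [/\ closedf q, (qf p -> existential q),
      forall (N : structure L) (f : A -> N) e,
        sat f e q <-> exists g : B -> N, sat (sumf f g) e p &
      forall a, fpar_occ a q -> fpar_occ (inl a) p].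
Proof.
move=> cp; have [k [ix [q [fq qq sq eq oq]]]] := abstract_params p.
exists (foldr (@FEx L A) q (iota 0 k)); split.
- apply: ffv_exn => s1 h; apply: ffv_sub (fq cp) => n nk; by apply: h; right.
- rewrite -qq; elim: (iota 0 k) => //= {sq eq fq qq oq}; by case: q.
- move=> N f e; rewrite sat_exn; split=> [[e' _ h]|[g h]].
    exists (fun b => e' (ix b)).
    have := iffLR (sq N f (fun b => e' (ix b)) e' (fun _ _ => erefl)) h.
    exact: (iffLR (sat_closed _ _ e cp)).
  have [e' he' h'] := eq N g e.
  exists e'; last by apply/(sq N f g) => //; apply: (iffLR (sat_closed _ _ _ cp)) h.
  by move=> n; rewrite mem_iota /= add0n -leqNgt => /h'.
- move=> a oa; apply: oq.
  by elim: (iota 0 k) oa.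
Qed.

End Syntax.

(** * Definable relations, model completeness and ultrapowers *)

Section Definable.
Variables (L : lang) (T : formula L void -> Prop).

(** Parameters play the part of free variables, and a relation is known by its meaning in all models
    of [T] at once. Most formulas needed later arise from the closure properties below, without
    being written out. *)
Definition definable A (P : forall N : structure L, (A -> N) -> Prop) : Prop :=
  exists2 p : formula L A, closedf p &
    forall N : structure L, model T N -> forall par e, sat par e p <-> P N par.

Lemma definable_ext A (P Q : forall N : structure L, (A -> N) -> Prop) :
  (forall N, model T N -> forall par, P N par <-> Q N par) ->
  definable P -> definable Q.
Proof.
by move=> PQ [p cp hp]; exists p => // N mN par e; rewrite -PQ //; apply: hp.
Qed.

Lemma definable_form A (p : formula L A) e : closedf p ->
  definable (fun N par => sat par (e N) p).
Proof. by move=> cp; exists p => // N _ par e'; apply: sat_closed. Qed.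

Lemma definable_and A (P Q : forall N : structure L, (A -> N) -> Prop) :
  definable P -> definable Q -> definable (fun N par => P N par /\ Q N par).
Proof.
move=> [p cp hp] [q cq hq]; exists (FAnd p q); first by apply/andP.
by move=> N mN par e /=; rewrite hp ?hq.
Qed.

Lemma definable_not A (P : forall N : structure L, (A -> N) -> Prop) :
  definable P -> definable (fun N par => ~ P N par).
Proof.
by move=> [p cp hp]; exists (FNot p) => // N mN par e /=; rewrite hp.
Qed.

Lemma definable_true A : definable (fun (N : structure L) (par : A -> N) => True).
Proof. by exists (FNot FFalse) => // N _ par e /=; split=> // _ []. Qed.

Lemma definable_all A (I : eqType) (s : seq I)
    (P : I -> forall N : structure L, (A -> N) -> Prop) :
  (forall i, i \in s -> definable (P i)) ->
  definable (fun N par => forall i, i \in s -> P i N par).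
Proof.
elim: s => [|i s IH] h.
  by apply: definable_ext (definable_true A) => N _ par.
have h1 : definable (P i) by apply: h; rewrite mem_head.
have h2 := IH (fun j js => h j (mem_behead (s := i :: s) js)).
apply: definable_ext (definable_and h1 h2) => N _ par; split=> [[p q] j|p].
  by rewrite inE => /orP[/eqP->|/q].
by split=> [|j js]; apply: p; rewrite inE ?eqxx ?js ?orbT.
Qed.

Lemma definable_reindex A B (f : A -> B) (P : forall N : structure L, (A -> N) -> Prop) :
  definable P -> definable (fun N (par : B -> N) => P N (fun a => par (f a))).
Proof.
move=> [p cp hp]; exists (frn 0 (fun a => inl (f a)) p); first exact: ffv_frn cp.
by move=> N mN par e; rewrite (sat_frn (par' := fun a => par (f a))) // hp.
Qed.

Lemma definable_ex A B (P : forall N : structure L, (A + B -> N) -> Prop) :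
  definable P -> definable (fun N par => exists g : B -> N, P N (sumf par g)).
Proof.
move=> [p cp hp]; have [q [cq _ sq _]] := exists_params cp; exists q => // N mN par e.
by rewrite sq; split=> -[g hg]; exists g; apply/(hp N mN _ e).
Qed.

Lemma definable_eq A (a b : A) : definable (fun N par => par a = par b).
Proof. by exists (FEq (TPar L a) (TPar L b)) => // N mN par e /=. Qed.

Lemma definable_env3 A (p : formula L void) (a b c : A) : ffv_in [:: 0; 1; 2]%N p ->
  definable (fun N par => sat (@noparam N) (env3 (par a) (par b) (par c)) p).
Proof.
move=> fp; pose q := frn 0 (fun v : void => match v return (A + nat) with end) p.
(* The variables 0, 1, 2 prescribed by [p] are reached through quantifiers and equations, since
   parameters are constants of the syntax. *)
exists (FEx 0 (FEx 1 (FEx 2 (FAnd (FEq (TVar L A 0) (TPar L a))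
  (FAnd (FEq (TVar L A 1) (TPar L b)) (FAnd (FEq (TVar L A 2) (TPar L c)) q)))))).
  by rewrite /closedf /=; apply: ffv_frn (fp) => // n; rewrite !inE add0n;
    case/or3P=> ->; rewrite ?orbT.
move=> N mN par e /=.
have H v0 v1 v2 : sat par (upd (upd (upd e 0 v0) 1 v1) 2 v2) q <->
    sat (@noparam N) (env3 v0 v1 v2) p.
  rewrite (sat_frn (par' := @noparam N)) //; apply: (sat_eq fp) => // n.
  by rewrite !inE; case/or3P=> /eqP ->.
split; first by move=> [v0 [v1 [v2]]] [+ [+ [+ +]]]; rewrite /upd /= => <- <- <- /H.
by move=> h; exists (par a), (par b), (par c); rewrite H /upd.
Qed.

End Definable.

Section ModelComplete.
Variables (L : lang) (T : formula L void -> Prop).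
Hypothesis mcT : model_complete T.

Lemma definable_emb A (P : forall N : structure L, (A -> N) -> Prop) (M N : structure L)
    (h : M -> N) par :
  definable T P -> model T M -> model T N -> emb h ->
  P M par <-> P N (fun a => h (par a)).
Proof.
move=> [p cp hp] mM mN eh.
(* Model completeness speaks of parameter-free formulas, so all parameters go to the side that
   [abstract_params] turns into variables. *)
pose p' := frn 0 (fun a => inl (inr a : void + A)) p.
have cp' : closedf p' by apply: ffv_frn cp.
have [k [ix [q [fq _ sq eq _]]]] := abstract_params p'.
have H (N' : structure L) (par' : A -> N') e : model T N' ->
    (forall b, fpar_occ (inr b) p' -> e (ix b) = par' b) ->
    P N' par' <-> sat (@noparam N') e q.
  move=> mN' he; rewrite (sq N' (@noparam N') par') // /p'.
  by rewrite (sat_frn (par' := par')) // hp.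
have [e he _] := eq M par (fun _ => sinh M).
rewrite (H M par e) // (H N (fun a => h (par a)) (fun n => h (e n))) //.
  exact: mcT.
by move=> b ob; rewrite he.
Qed.

End ModelComplete.

Section Ultrapower.
Variables (L : lang) (M : structure L) (X : Type) (U : set_system X).
Hypothesis UU : UltraFilter U.
Local Open Scope classical_set_scope.

Let aeq (f g : X -> M) : Prop := U [set x | f x = g x].

Let aeq_sym f g : aeq f g -> aeq g f.
Proof. by apply: filterS => x /= ->. Qed.

Let aeq_trans f g h : aeq f g -> aeq g h -> aeq f h.
Proof. by apply: filterS2 => x /= -> ->. Qed.

(** The quotient by almost-everywhere equality is replaced by a choice of representatives; [rep f]
    depends only on the class of [f] because the predicate [aeq f] does. *)
Let rep (f : X -> M) : X -> M := ClassicalEpsilon.epsilon (inhabits f) (aeq f).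

Let aeq_rep f : aeq f (rep f).
Proof.
apply: (ClassicalEpsilon.epsilon_spec (inhabits f) (aeq f)); exists f.
by apply: filterS (@filterT _ U _) => x.
Qed.

Let rep_eq f g : aeq f g -> rep f = rep g.
Proof.
move=> fg; rewrite /rep (Prop_irrelevance (inhabits f) (inhabits g)).
congr (ClassicalEpsilon.epsilon _ _); apply/funext => h; apply/propext.
by split; apply: aeq_trans => //; apply: aeq_sym.
Qed.

Definition ucarrier := {f : X -> M | rep f = f}.

Definition ucl (f : X -> M) : ucarrier :=
  exist _ (rep f) (esym (rep_eq (aeq_rep f))).

Let ucl_eq f g : ucl f = ucl g <-> aeq f g.
Proof.
split=> [[e]|/rep_eq e].
  by apply: aeq_trans (aeq_rep f) _; rewrite e; apply/aeq_sym/aeq_rep.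
by rewrite /ucl; apply: eq_exist.
Qed.

Let ucl_sval c : ucl (sval c) = c.
Proof. by case: c => f e; apply: eq_exist. Qed.

Definition upower : structure L :=
  @Struct L ucarrier (ucl (fun _ => sinh M))
    (fun f args => ucl (fun x => sfun (fun i => sval (args i) x)))
    (fun r args => U [set x | srel (fun i => sval (args i) x)]).

Lemma teval_upower A (par : A -> X -> M) (e : nat -> X -> M) t :
  teval (M := upower) (fun a => ucl (par a)) (fun n => ucl (e n)) t =
  ucl (fun x => teval (fun a => par a x) (fun n => e n x) t).
Proof.
elim: t => [n|a|f args IH] //=; apply/ucl_eq.
have H : U [set x | forall i : 'I_(far f),
    sval (teval (M := upower) (fun a => ucl (par a)) (fun n => ucl (e n)) (args i)) x =
    teval (fun a => par a x) (fun n => e n x) (args i)].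
  by apply: filter_forall => i; rewrite IH; apply/aeq_sym/aeq_rep.
by apply: filterS H => x /= h; congr sfun; apply/funext.
Qed.

(** Los's theorem. Maximality of [U] gives negation, and with it disjunction, implication and the
    universal quantifier; for the existential one a witness is chosen in each factor. *)
Lemma upowerP A (par : A -> X -> M) (p : formula L A) : forall (e : nat -> X -> M),
  sat (M := upower) (fun a => ucl (par a)) (fun n => ucl (e n)) p <->
  U [set x | sat (fun a => par a x) (fun n => e n x) p].
Proof.
have Unot (P : X -> Prop) : ~ U [set x | P x] <-> U [set x | ~ P x].
  split=> [nP|UnP UP]; first by case: (in_ultra_setVsetC [set x | P x] UU).
  by apply: (@filter_not_empty _ U _); apply: filterS2 UnP UP => x /=.
have Uand (P Q : X -> Prop) : U [set x | P x /\ Q x] <-> U [set x | P x] /\ U [set x | Q x].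
  split=> [h|[]]; first by split; apply: filterS h => x [].
  by apply: filterS2.
have updE (e : nat -> X -> M) x v :
    upd (M := upower) (fun n => ucl (e n)) x (ucl v) = (fun n => ucl (upd e x v n)).
  by apply/funext => n; rewrite /upd; case: eqP.
have updE' (e : nat -> X -> M) x v i :
    (fun n => upd e x v n i) = upd (fun n => e n i) x (v i).
  by apply/funext => n; rewrite /upd; case: eqP.
have Hex (Q : X -> M -> Prop) :
    (exists v : X -> M, U [set i | Q i (v i)]) <-> U [set i | exists v, Q i v].
  split=> [[v]|h]; first by apply: filterS => i; exists (v i).
  exists (fun i => ClassicalEpsilon.epsilon (inhabits (sinh M)) (Q i)).
  by apply: filterS h => i; apply: ClassicalEpsilon.epsilon_spec.
elim: p => [|t1 t2|r args|q IH|q1 IH1 q2 IH2|q1 IH1 q2 IH2|q1 IH1 q2 IH2|x q IH|x q IH] e /=.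
- by split=> // h; apply: (@filter_not_empty _ U _); apply: filterS h.
- by rewrite !teval_upower; apply: ucl_eq.
- have H : U [set x | forall i : 'I_(rar r),
     sval (teval (M := upower) (fun a => ucl (par a)) (fun n => ucl (e n)) (args i)) x =
     teval (fun a => par a x) (fun n => e n x) (args i)].
    by apply: filter_forall => i; rewrite teval_upower; apply/aeq_sym/aeq_rep.
  by split; apply: filterS2 H => x /= H; rewrite (_ : (fun i => _) = 
    (fun i => teval (fun a => par a x) (fun n => e n x) (args i))) //;
    apply/funext.
- by rewrite IH Unot.
- by rewrite IH1 IH2 Uand.
- rewrite IH1 IH2; split=> [[]|h].
  + by apply: filterS => x /=; left.
  + by apply: filterS => x /=; right.
  case: (pselect (U [set x | sat (fun a => par a x) (fun n => e n x) q1])) => [|/Unot].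
    by move=> ?; left.
  by move=> nh; right; apply: filterS2 nh h => x /= nh [].
- rewrite IH1 IH2; split=> [h|h h1]; last by apply: filterS2 h h1 => x /=.
  case: (pselect (U [set x | sat (fun a => par a x) (fun n => e n x) q1])) => [/h|/Unot];
    by apply: filterS => x //=.
- rewrite -(Hex (fun i v => sat (fun a => par a i) (upd (fun n => e n i) x v) q)).
  split=> [[v]|[v h]].
    rewrite -(ucl_sval v) updE IH => h; exists (sval v).
    by apply: filterS h => i /=; rewrite updE'.
  exists (ucl v); rewrite updE IH; by apply: filterS h => i /=; rewrite updE'.
- split=> [h|h v]; last first.
    rewrite -(ucl_sval v) updE IH; apply: filterS h => i /= h.
    by rewrite updE'.
  apply: contrapT => /Unot /= h'.
  have : U [set i | exists v, ~ sat (fun a => par a i) (upd (fun n => e n i) x v) q].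
    by apply: filterS h' => i /= /existsNP.
  move=> /Hex [v hv]; have := h (ucl v); rewrite updE IH; apply/Unot.
  by apply: filterS hv => i /=; rewrite updE'.
Qed.

End Ultrapower.

(** The index set of the ultraproduct proof of compactness: if the object at [s] meets every
    condition in the finite list [s], then any single condition is met almost everywhere. *)
Lemma ultrafilter_cones (Cond : Type) : exists2 U : set_system (seq Cond),
  UltraFilter U & forall c, U [set s | List.In c s]%classic.
Proof.
pose F : set_system (seq Cond) :=
  filter_from setT (fun s => [set s' | forall c, List.In c s -> List.In c s']%classic).
have PF : ProperFilter F.
  apply: filter_from_proper; last by move=> s _; exists s => /=.
  apply: filter_from_filter; first by exists [::].
  move=> s s' _ _; exists (s ++ s') => // t /= h.
  by split=> c sc; apply: h; apply/List.in_app_iff; [left|right].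
have [U [UU FU]] := ultraFilterLemma PF.
exists U => // c; apply: FU; exists [:: c] => // s /=; apply; by left.
Qed.

(** The [val s] are approximations of a tuple, each taking care of finitely many conditions, and [g]
    is their limit in an ultrapower of [M]. *)
Lemma realization (L : lang) (M : structure L) (A Cond : Type) (val : seq Cond -> A -> M) :
  exists (N : structure L) (h : M -> N) (g : A -> N) (U : set_system (seq Cond)),
  [/\ ProperFilter U, forall c, U [set s | List.In c s]%classic &
      forall (p : formula L (M + A)) e, closedf p ->
        sat (sumf h g) e p <-> U [set s | forall e', sat (sumf id (val s)) e' p]%classic].
Proof.
have [U UU hU] := ultrafilter_cones Cond.
exists (upower M UU), (fun m => ucl UU (fun _ => m)), (fun a => ucl UU (fun s => val s a)), U.
split=> [|//|p e cp]; first exact: ultra_proper.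
rewrite (sat_closed _ e (fun=> ucl UU (fun=> sinh M)) cp).
have -> : sumf (fun m => ucl UU (fun _ => m)) (fun a => ucl UU (fun s => val s a)) =
  (fun x => ucl UU (sumf (fun m _ => m) (fun a s => val s a) x)) :> (_ -> upower M UU).
  by apply/funext => -[].
rewrite upowerP.
have sumfE s : (fun x => sumf (fun m (_ : seq Cond) => m) (fun a s => val s a) x s) =
  sumf id (val s) by apply/funext => -[].
split; apply: filterS => s /=; rewrite sumfE => h; last exact: h.
by move=> e'; apply: (iffLR (sat_closed _ _ _ cp)) h.
Qed.

(** * The definable vector space *)

Definition is_vspace (L : lang) (K : fieldType) (D : vsdef L K) (N : structure L) : Prop :=
  vs_graphs D N /\ vs_axioms D N.

Section VspaceOps.
Variables (L : lang) (K : fieldType) (D : vsdef L K) (N : structure L).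
Hypothesis HN : is_vspace D N.

Lemma vzeroP : is0 D (vzero D N).
Proof.
have [[[_ [z [z0 _]]] _ _] _] := HN.
by apply: (ClassicalEpsilon.epsilon_spec (inhabits (sinh N)) (@is0 L K D N)); exists z.
Qed.

Lemma is0E (z : N) : is0 D z <-> z = vzero D N.
Proof.
have [[[_ [y [_ y0]]] _ _] _] := HN.
split=> [/y0->|->]; last exact: vzeroP.
by rewrite (y0 _ vzeroP).
Qed.

Lemma vaddP (x y : N) : inV D x -> inV D y -> isadd D x y (vadd D x y).
Proof.
move=> Vx Vy; have [[_ [_ /(_ x y Vx Vy)[z [xyz _]]] _] _] := HN.
by apply: (ClassicalEpsilon.epsilon_spec (inhabits x) (isadd D x y)); exists z.
Qed.

Lemma isaddE (x y z : N) : inV D x -> inV D y -> isadd D x y z <-> z = vadd D x y.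
Proof.
move=> Vx Vy; have [[_ [_ /(_ x y Vx Vy)[w [_ wE]]] _] _] := HN.
split=> [/wE->|->]; last exact: vaddP.
by rewrite (wE _ (vaddP Vx Vy)).
Qed.

Lemma vscaleP a (x : N) : inV D x -> issc D a x (vscale D a x).
Proof.
move=> Vx; have [[_ _ [_ /(_ a x Vx)[z [xz _]]]] _] := HN.
by apply: (ClassicalEpsilon.epsilon_spec (inhabits x) (issc D a x)); exists z.
Qed.

Lemma isscE a (x z : N) : inV D x -> issc D a x z <-> z = vscale D a x.
Proof.
move=> Vx; have [[_ _ [_ /(_ a x Vx)[w [_ wE]]]] _] := HN.
split=> [/wE->|->]; last exact: vscaleP.
by rewrite (wE _ (vscaleP a Vx)).
Qed.

Lemma vzeroV : inV D (vzero D N).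
Proof. have [[[h _] _ _] _] := HN; exact/h/vzeroP. Qed.

Lemma isaddV (x y z : N) : isadd D x y z -> [/\ inV D x, inV D y & inV D z].
Proof. have [[_ [h _] _] _] := HN; exact: h. Qed.

Lemma isscV a (x y : N) : issc D a x y -> inV D x /\ inV D y.
Proof. have [[_ _ [h _]] _] := HN; exact: h. Qed.

Lemma vaddV (x y : N) : inV D x -> inV D y -> inV D (vadd D x y).
Proof. by move=> Vx Vy; have [] := isaddV (vaddP Vx Vy). Qed.

Lemma vscaleV a (x : N) : inV D x -> inV D (vscale D a x).
Proof. by move=> Vx; have [] := isscV (vscaleP a Vx). Qed.

End VspaceOps.

(** [HN] is an index of the type so that the vector space structure, which is built from it, can be
    inferred. *)
Definition vtype (L : lang) (K : fieldType) (D : vsdef L K) (N : structure L)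
  (HN : is_vspace D N) : Type := {x : N | inV D x}.

Section Vtype.
Variables (L : lang) (K : fieldType) (D : vsdef L K) (N : structure L).
Variable HN : is_vspace D N.
Local Notation V := (vtype HN).

Definition vval (v : V) : N := sval v.
Definition vlift (x : N) (Vx : inV D x) : V := exist _ x Vx.

Lemma vvalV v : inV D (vval v). Proof. exact: svalP. Qed.

Lemma vval_inj : injective vval.
Proof. by move=> [x Vx] [y Vy] xy; apply: eq_exist. Qed.

HB.instance Definition _ := gen_eqMixin V.
HB.instance Definition _ := gen_choiceMixin V.

Let add (x y : V) : V := vlift (vaddV HN (vvalV x) (vvalV y)).
Let scale (a : K) (x : V) : V := vlift (vscaleV HN a (vvalV x)).
Let zero : V := vlift (vzeroV HN).

Let opp_ex (x : V) : exists y, add y x = zero.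
Proof.
have [_ [_ [addC [_ [/(_ _ (vvalV x))[y [Vy xy]] _]]]]] := HN.
by exists (vlift Vy); apply: vval_inj; rewrite /= addC //; exact: vvalV.
Qed.

Let opp (x : V) : V := projT1 (cid (opp_ex x)).

Let addA : associative add.
Proof.
by move=> x y z; apply: vval_inj; have [_ [h _]] := HN; apply: h; apply: vvalV.
Qed.
Let addC : commutative add.
Proof.
by move=> x y; apply: vval_inj; have [_ [_ [h _]]] := HN; apply: h; apply: vvalV.
Qed.
Let add0 : left_id zero add.
Proof.
by move=> x; apply: vval_inj; have [_ [_ [_ [h _]]]] := HN; apply: h; apply: vvalV.
Qed.
Let addN : left_inverse zero opp add.
Proof. by move=> x; rewrite /opp; case: cid. Qed.

HB.instance Definition _ := GRing.isZmodule.Build V addA addC add0 addN.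

Let scaleA a b v : scale a (scale b v) = scale (a * b) v.
Proof.
apply: vval_inj; have [_ [_ [_ [_ [_ [_ [h _]]]]]]] := HN.
by rewrite /= h //; exact: vvalV.
Qed.
Let scale1 : left_id 1 scale.
Proof.
move=> v; apply: vval_inj; have [_ [_ [_ [_ [_ [h _]]]]]] := HN.
by rewrite /= h //; exact: vvalV.
Qed.
Let scaleDr : right_distributive scale +%R.
Proof.
move=> a u v; apply: vval_inj; have [_ [_ [_ [_ [_ [_ [_ [h _]]]]]]]] := HN.
by apply: h; exact: vvalV.
Qed.
Let scaleDl v : {morph scale^~ v : a b / a + b}.
Proof.
move=> a b; apply: vval_inj; have [_ [_ [_ [_ [_ [_ [_ [_ h]]]]]]]] := HN.
by apply: h; exact: vvalV.
Qed.

HB.instance Definition _ :=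
  GRing.Zmodule_isLmodule.Build K V scaleA scale1 scaleDr scaleDl.

Lemma vval0 : vval 0 = vzero D N. Proof. by []. Qed.
Lemma vvalD u v : vval (u + v) = vadd D (vval u) (vval v). Proof. by []. Qed.
Lemma vvalZ a v : vval (a *: v) = vscale D a (vval v). Proof. by []. Qed.

Lemma vval_sum I (s : seq I) (F : I -> V) :
  vval (\sum_(i <- s) F i) = vsum D [seq vval (F i) | i <- s].
Proof. by elim: s => [|i s IH]; [rewrite big_nil|rewrite big_cons vvalD IH]. Qed.

End Vtype.

(* Unfolded down to the defining formulas of the operations, so as to be
   definable and preserved by embeddings. *)
Fixpoint lingraph (L : lang) (K : fieldType) (D : vsdef L K) (N : structure L)
    (l : seq (K * N)) (t : N) : Prop :=
  match l with
  | [::] => is0 D t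
  | cx :: l' => exists u v, [/\ issc D cx.1 cx.2 u, lingraph D l' v & isadd D u v t]
  end.

Lemma lingraphE (L : lang) (K : fieldType) (D : vsdef L K) (N : structure L)
    (HN : is_vspace D N) I (s : seq I) (c : I -> K) (F : I -> vtype HN) (t : vtype HN) :
  lingraph D [seq (c i, vval (F i)) | i <- s] (vval t) <->
  \sum_(i <- s) c i *: F i = t.
Proof.
elim: s t => [|i s IH] t /=.
  rewrite big_nil (is0E HN) -(vval0 HN); split=> [/vval_inj|] -> //.
rewrite big_cons; split=> [[u [v []]]|<-].
  move=> /(isscE HN _ _ (vvalV (F i))) -> hl hv.
  have [_ Vv _] := isaddV HN hv.
  move/(IH (vlift HN Vv)): hl => hl.
  move/(isaddE HN _ (vscaleV HN (c i) (vvalV (F i))) Vv): hv => hv.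
  by apply: vval_inj; rewrite hl hv.
exists (vval (c i *: F i)), (vval (\sum_(j <- s) c j *: F j)); split.
- exact/(isscE HN)/vvalZ/vvalV.
- exact/IH.
- by apply/(isaddE HN); [exact: vvalV|exact: vvalV|].
Qed.

Section DefinableVspace.
Variables (L : lang) (K : fieldType) (T : formula L void -> Prop) (D : vsdef L K).
Hypothesis dT : defines_vs T D.

Lemma model_vspace (N : structure L) : model T N -> is_vspace D N.
Proof. by move=> mN; have [_ _ _ _ /(_ N mN)[]] := dT. Qed.

Lemma definable_inV A (a : A) : definable T (fun N par => inV D (par a)).
Proof.
have [fv _ _ _ _] := dT.
apply: definable_ext (definable_env3 T a a a (ffv_sub _ fv)); last first.
  by move=> n; rewrite !inE => ->.
move=> N mN par; apply: (sat_eq fv) => // n; by rewrite inE => /eqP->.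
Qed.

Lemma definable_is0 A (a : A) : definable T (fun N par => is0 D (par a)).
Proof.
have [_ fv _ _ _] := dT.
apply: definable_ext (definable_env3 T a a a (ffv_sub _ fv)); last first.
  by move=> n; rewrite !inE => ->.
move=> N mN par; apply: (sat_eq fv) => // n; by rewrite inE => /eqP->.
Qed.

Lemma definable_isadd A (a b c : A) :
  definable T (fun N par => isadd D (par a) (par b) (par c)).
Proof. have [_ _ fv _ _] := dT; exact: definable_env3. Qed.

Lemma definable_issc A k (a b : A) : definable T (fun N par => issc D k (par a) (par b)).
Proof.
have [_ _ _ /(_ k) fv _] := dT.
apply: definable_ext (definable_env3 T a b b (ffv_sub _ fv)); last first.
  by move=> n; rewrite !inE => /orP[] ->; rewrite ?orbT.
move=> N mN par; apply: (sat_eq fv) => // n.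
by rewrite !inE => /orP[] /eqP->.
Qed.

Lemma definable_lingraph A (l : seq (K * A)) B (f : A -> B) (t : B) :
  definable T (fun N par => lingraph D [seq (cx.1, par (f cx.2)) | cx <- l] (par t)).
Proof.
elim: l B f t => [|[c x] l IH] B f t; first exact: definable_is0.
(* The extra parameters [inr true] and [inr false] hold the intermediate vectors [u] and [v] of
   [lingraph]. *)
have h := definable_and (definable_issc c (inl (f x) : B + bool) (inr true))
  (definable_and (IH (B + bool)%type (fun a => inl (f a)) (inr false))
    (definable_isadd (inr true) (inr false) (inl t))).
apply: definable_ext (definable_ex h) => N mN par /=.
split=> [[g [h1 [h2 h3]]]|[u [v [h1 h2 h3]]]]; first by exists (g true), (g false).
by exists (fun b : bool => if b then u else v).
Qed.

End DefinableVspace.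

(** * The action of polynomials *)

Section Action.
Variables (K : fieldType) (V : lmodType K) (th : {linear V -> V}).
Implicit Types (p q : {poly K}) (v : V).

Definition act p v : V := \sum_(i < size p) p`_i *: iter i th v.

Lemma act_widen n p v : (size p <= n)%N -> act p v = \sum_(i < n) p`_i *: iter i th v.
Proof.
move=> pn; rewrite /act (big_ord_widen n (fun i => p`_i *: iter i th v) pn).
rewrite big_mkcond; apply: eq_bigr => i _; case: ltnP => // pi.
by rewrite nth_default ?scale0r.
Qed.

Lemma act_iota p v : act p v = \sum_(i <- iota 0 (size p)) p`_i *: iter i th v.
Proof.
rewrite /act -(big_mkord xpredT (fun i => p`_i *: iter i th v)).
by rewrite /index_iota subn0.
Qed.

Lemma actD p q v : act (p + q) v = act p v + act q v.
Proof.
pose n := maxn (size p) (size q).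
rewrite !(@act_widen n) ?leq_maxl ?leq_maxr ?(leq_trans (size_polyD _ _)) //.
by rewrite -big_split; apply: eq_bigr => i _; rewrite coefD scalerDl.
Qed.

Lemma actZ a p v : act (a *: p) v = a *: act p v.
Proof.
rewrite (@act_widen (size p)) ?size_scale_leq // scaler_sumr.
by apply: eq_bigr => i _; rewrite coefZ scalerA.
Qed.

Lemma act0 v : act 0 v = 0.
Proof. by rewrite /act size_poly0 big_ord0. Qed.

Lemma actN p v : act (- p) v = - act p v.
Proof. by apply/eqP; rewrite -addr_eq0 -actD addNr act0. Qed.

Lemma actB p q v : act (p - q) v = act p v - act q v.
Proof. by rewrite actD actN. Qed.

Lemma act_sum I (s : seq I) (P : pred I) (F : I -> {poly K}) v :
  act (\sum_(i <- s | P i) F i) v = \sum_(i <- s | P i) act (F i) v.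
Proof. exact: (big_morph (fun p => act p v) (fun p q => actD p q v) (act0 v)). Qed.

Lemma iter_linearP i a u v : iter i th (a *: u + v) = a *: iter i th u + iter i th v.
Proof. by elim: i => //= i ->; rewrite linearP. Qed.

Fact act_is_linear p : linear (act p).
Proof.
move=> a u v; rewrite /act scaler_sumr -big_split; apply: eq_bigr => i _ /=.
by rewrite iter_linearP scalerDr !scalerA mulrC.
Qed.

HB.instance Definition _ p := GRing.isLinear.Build K V V *:%R (act p) (act_is_linear p).

Lemma actXn n v : act 'X^n v = iter n th v.
Proof.
rewrite (@act_widen n.+1) ?size_polyXn // (bigD1 ord_max) //= coefXn eqxx scale1r.
rewrite big1 ?addr0 // => i; rewrite -val_eqE /= => ni.
by rewrite coefXn (negbTE ni) scale0r.
Qed.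

Lemma actC a v : act a%:P v = a *: v.
Proof. by rewrite (@act_widen 1) ?size_polyC ?leq_b1 // big_ord1 coefC. Qed.

Lemma act1 v : act 1 v = v.
Proof. by rewrite actC scale1r. Qed.

Lemma act_th p v : act p (th v) = th (act p v).
Proof.
rewrite /act linear_sum; apply: eq_bigr => i _.
by rewrite linearZ -iterSr.
Qed.

Lemma actMX p v : act (p * 'X) v = act p (th v).
Proof.
have sz : (size (p * 'X)%R <= (size p).+1)%N.
  by rewrite (leq_trans (size_polyMleq _ _)) // size_polyX addn2.
rewrite (@act_widen (size p).+1) // big_ord_recl coefMX scale0r add0r.
by apply: eq_bigr => i _; rewrite coefMX /= -iterSr.
Qed.

Lemma actM p q v : act (p * q) v = act p (act q v).
Proof.
elim/poly_ind: p v => [|p c IH] v; first by rewrite mul0r !act0.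
rewrite mulrDl !actD mul_polyC actZ actC; congr (_ + _).
by rewrite mulrAC actMX actMX IH act_th.
Qed.

Lemma act_mulC p q v : act p (act q v) = act q (act p v).
Proof. by rewrite -!actM mulrC. Qed.

Record submod (U : V -> Prop) : Prop := Submod {
  submod0 : U 0;
  submodD : forall u v, U u -> U v -> U (u + v);
  submodZ : forall a v, U v -> U (a *: v);
  submod_th : forall v, U v -> U (th v) }.

Section Submod.
Variable U : V -> Prop.
Hypothesis HU : submod U.

Lemma submodN v : U v -> U (- v).
Proof. by move=> Uv; rewrite -scaleN1r; apply: submodZ. Qed.

Lemma submodB u v : U u -> U v -> U (u - v).
Proof. by move=> Uu Uv; apply: submodD => //; apply: submodN. Qed.

Lemma submod_sum I (s : seq I) (P : pred I) (F : I -> V) :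
  (forall i, P i -> U (F i)) -> U (\sum_(i <- s | P i) F i).
Proof. by move=> h; apply: big_ind => //; [apply: submod0|apply: submodD]. Qed.

Lemma submod_act p v : U v -> U (act p v).
Proof.
move=> Uv; apply: submod_sum => i _; apply: submodZ => //.
by elim: (nat_of_ord i) => //= n; apply: submod_th.
Qed.

Lemma submod_subr u v : U v -> U (u - v) -> U u.
Proof. by move=> Uv Uuv; rewrite -(subrK v u); apply: submodD. Qed.

End Submod.

Lemma act_eq0_dvd p q v : p %| q -> act p v = 0 -> act q v = 0.
Proof. by move=> /dvdpP[r ->] h; rewrite actM h linear0. Qed.

Lemma act_dvd (U : V -> Prop) p q v : submod U -> p %| q -> U (act p v) -> U (act q v).
Proof. by move=> HU /dvdpP[r ->] h; rewrite actM; apply: submod_act. Qed.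

Lemma act_coprime (U : V -> Prop) p q v : submod U -> coprimep p q ->
  U (act p v) -> U (act q v) -> U v.
Proof.
move=> HU /Bezout_eq1_coprimepP [[a b] /= ab] Up Uq.
by rewrite -(act1 v) -ab actD !actM; apply: submodD => //; apply: submod_act.
Qed.

End Action.

Section IrreduciblePoly.
Variable K : fieldType.
Implicit Types (f g p q : {poly K}).

Lemma mirr_neq0 f : mirr f -> f != 0.
Proof. by case=> /monic_neq0. Qed.

Lemma mirr_size f : mirr f -> (1 < size f)%N.
Proof. by case=> _ []. Qed.

Lemma mirr_dvd_or_coprime f p : mirr f -> f %| p \/ coprimep f p.
Proof.
move=> [_ [_ irr]]; have [|n1] := boolP (size (gcdp f p) == 1%N).
  by rewrite -coprimep_def; right.
left; have /eqp_dvdl <- := irr _ n1 (dvdp_gcdl f p); exact: dvdp_gcdr.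
Qed.

Lemma mirr_dvd_eq f g : mirr f -> mirr g -> f %| g -> f = g.
Proof.
move=> mf [mg [_ irr]] fg; apply/eqP; rewrite -eqp_monic //; last by case: mf.
by apply: irr => //; rewrite gtn_eqF // mirr_size.
Qed.

Lemma mirr_coprime f g : mirr f -> mirr g -> f <> g -> coprimep f g.
Proof.
by move=> mf mg fg; case: (mirr_dvd_or_coprime g mf) => // /(mirr_dvd_eq mf mg).
Qed.

Lemma mirr_factor p : (1 < size p)%N -> exists2 f, mirr f & f %| p.
Proof.
move: {2}(size p) (leqnn (size p)) => n; elim: n p => [|n IH] p.
  by rewrite leqn0 => /eqP ->.
move=> pn p1; have p0 : p != 0 by rewrite -size_poly_gt0 ltnW.
have [h|] := pselect (exists2 q : {poly K}, (1 < size q < size p)%N & q %| p).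
  have [q /andP[q1 qp] qdp] := h.
  have [|f mf fq] := IH q _ q1; first by rewrite -ltnS (leq_trans qp).
  by exists f => //; apply: dvdp_trans qdp.
move=> np; exists ((lead_coef p)^-1 *: p); last by rewrite dvdpZl ?invr_eq0 ?lead_coef_eq0.
have lc0 : (lead_coef p)^-1 != 0 by rewrite invr_eq0 lead_coef_eq0.
split; first by rewrite monicE lead_coefZ mulVf // lead_coef_eq0.
split=> [|q q1]; first by rewrite size_scale.
rewrite dvdpZr // => qp; have q0 : q != 0 by apply: contraTneq qp => ->; rewrite dvd0p.
have /eqp_trans -> // : q %= p; last by rewrite eqp_sym eqp_scale.
rewrite -dvdp_size_eqp //; apply: contra_notT np => qs; exists q => //.
by rewrite [(size q < _)%N]ltn_neqAle qs dvdp_leq // ltn_neqAle eq_sym q1 size_poly_gt0 q0.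
Qed.

Lemma mirr_power_split f p : mirr f -> p != 0 -> f %| p ->
  exists (q : nat) (b : {poly K}), [/\ (0 < q)%N, p = f ^+ q * b & coprimep f b].
Proof.
move=> mf p0 fp.
suff [q [b [pE fb]]] : exists (q : nat) (b : {poly K}), p = f ^+ q * b /\ coprimep f b.
  exists q, b; split=> //; case: q pE => // pE; move: fb.
  rewrite pE mul1r in fp => cfb; have := coprimep_dvdl fp cfb; rewrite coprimepp => /eqP sf.
  by have := mirr_size mf; rewrite sf.
move: {2}(size p) (leqnn (size p)) => n; elim: n p p0 {fp} => [|n IH] p p0 pn.
  by rewrite leqn0 size_poly_eq0 (negbTE p0) in pn.
case: (mirr_dvd_or_coprime p mf) => [/dvdpP[b pE]|cp]; last by exists 0%N, p; rewrite mul1r.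
have b0 : b != 0 by apply: contraNneq p0 => b0; rewrite pE b0 mul0r.
have sb : (size b <= n)%N.
  rewrite -ltnS; apply: leq_trans pn; rewrite pE size_mul ?(mirr_neq0 mf) //.
  by have := mirr_size mf; case: (size f) => [|[|k]] // _; rewrite !addnS /= ltnS leq_addr.
have [q [c [bE fc]]] := IH b b0 sb.
by exists q.+1, c; split=> //; rewrite pE bE mulrC exprS mulrA.
Qed.

End IrreduciblePoly.

(** * Finitely generated modules over a submodule *)

Section Decomposition.
Variables (K : fieldType) (V : lmodType K) (th : {linear V -> V}).
Variable U : V -> Prop.
Hypothesis HU : submod th U.
Local Notation act := (act th).

Fixpoint span_over (s : seq V) (v : V) : Prop :=
  if s is w :: s' then exists r, span_over s' (v - act r w) else U v.

Lemma span_over_submod s : submod th (span_over s).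
Proof.
elim: s => [//|w s [h0 hD hZ hth]]; split=> /=.
- by exists 0; rewrite act0 subr0.
- move=> u v [r hu] [r' hv]; exists (r + r').
  by rewrite actD opprD addrACA; apply: hD.
- by move=> a v [r hv]; exists (a *: r); rewrite actZ -scalerBr; apply: hZ.
- move=> v [r hv]; exists (r * 'X); rewrite actMX act_th -linearB; exact: hth.
Qed.

(* [direct_over] lists generators with their orders: each order generates the
   annihilator of its generator modulo [U] and the generators after it. *)
Fixpoint direct_over (s : seq (V * {poly K})) : Prop :=
  if s is (w, o) :: s' then
    [/\ U (act o w), (forall r, span_over [seq x.1 | x <- s'] (act r w) -> o %| r)
      & direct_over s']
  else True.

Definition prime_power (p : {poly K}) : Prop :=
  exists f (q : nat), [/\ mirr f, (0 < q)%N & p = f ^+ q].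

Definition gspan n (w : 'I_n -> V) v := exists r : 'I_n -> {poly K},
  U (v - \sum_i act (r i) (w i)).

Lemma gspanS n (w : 'I_n.+1 -> V) i v :
  gspan w v <-> exists r, gspan (fun j => w (lift i j)) (v - act r (w i)).
Proof.
split=> [[r]|[p [r]]].
  by rewrite (bigD1_ord i) //= opprD addrA => h; exists (r i), (fun j => r (lift i j)).
move=> h; exists (fun j => if unlift i j is Some k then r k else p).
rewrite (bigD1_ord i) //= unlift_none opprD addrA.
by under eq_bigr => j _ do rewrite liftK.
Qed.

(** An elementary change of generators. If [q j] is the quotient of [r j] by [r i], a relation with
    coefficients [r j] turns into one that keeps [r i] and has the remainders elsewhere. *)
Definition shear n (w : 'I_n -> V) (i : 'I_n) (q : 'I_n -> {poly K}) (j : 'I_n) : V :=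
  if j == i then w i + \sum_(l | l != i) act (q l) (w l) else w j.

Lemma shear_sum n (w : 'I_n -> V) i q r :
  \sum_j act (r j) (shear w i q j) =
  \sum_j act (if j == i then r i else r j + r i * q j) (w j).
Proof.
rewrite (bigD1 i) //= [RHS](bigD1 i) //= /shear eqxx linearD -addrA; congr (_ + _).
rewrite linear_sum -big_split; apply: eq_bigr => j /= /negbTE ji.
by rewrite ji actD actM addrC.
Qed.

Lemma shear_gspan n (w : 'I_n -> V) i q v : gspan (shear w i q) v <-> gspan w v.
Proof.
split=> -[r]; first by rewrite shear_sum => h; eexists; exact: h.
move=> h; exists (fun j => if j == i then r i else r j - r i * q j).
rewrite shear_sum; move: h; congr (U (_ - _)); apply: eq_bigr => j _.
by case: (eqVneq j i) => [->|ji]; rewrite ?eqxx // subrK.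
Qed.

(** Modulo [U], the generator [w' i] spans a direct summand whose annihilator is generated by [p];
    the summand is free when [p = 0]. *)
Definition good_generator n (w : 'I_n -> V) : Prop := exists (w' : 'I_n -> V) i p,
  [/\ forall v, gspan w' v <-> gspan w v, U (act p (w' i)) &
      forall r, U (\sum_j act (r j) (w' j)) -> p %| r i].

(* Euclidean descent on the size of a nonzero coefficient of a relation. *)
Lemma good_generator_rel n k : forall (w : 'I_n -> V) (r : 'I_n -> {poly K}) i, (size (r i) <= k)%N ->
  r i != 0 -> U (\sum_j act (r j) (w j)) -> good_generator w.
Proof.
elim: k => [|k IH] w r i rk r0 rel; first by rewrite leqn0 size_poly_eq0 (negbTE r0) in rk.
pose w' := shear w i (fun j => r j %/ r i).
pose r' j := if j == i then r i else r j %% r i.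
have ltk (p : {poly K}) : (size (p %% r i)%R <= k)%N.
  by rewrite -ltnS (leq_trans _ rk) // ltn_modp.
have rel' : U (\sum_j act (r' j) (w' j)).
  rewrite shear_sum; move: rel; congr U; apply: eq_bigr => j _.
  rewrite /r' eqxx; case: (eqVneq j i) => [->//|ji].
  by rewrite {1}(divp_eq (r j) (r i)) addrC mulrC.
have trans (w1 : 'I_n -> V) : (forall v, gspan w1 v <-> gspan w v) -> good_generator w1 -> good_generator w.
  by move=> e [w2 [l [p [e2 h1 h2]]]]; exists w2, l, p; split=> // v; rewrite e2.
have w'w : forall v, gspan w' v <-> gspan w v by move=> v; apply: shear_gspan.
(* A nonzero remainder is a smaller nonzero coefficient of a relation between the [w' j]. *)
have [[j jr]|nj] := pselect (exists j, (j != i) && (r' j != 0)).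
  have /andP[ji r'0] := jr.
  apply: (trans w') => //; apply: (IH _ r' j) => //.
  by rewrite /r' (negbTE ji).
have Uwi : U (act (r i) (w' i)).
  move: rel'; rewrite (bigD1 i) //= big1 ?addr0 /r' ?eqxx // => j ji.
  suff /eqP : r' j == 0 by rewrite /r' => ->; rewrite act0.
  by apply: contraT => r'0; case: nj; exists j; rewrite ji.
(* Since [act (r i) (w' i)] lies in [U], a relation whose coefficient at [i] is no multiple of [r i]
   can be reduced there modulo [r i], which again yields a smaller nonzero coefficient. *)
have [[r2 [rel2 nd]]|h] := pselect (exists r2 : 'I_n -> {poly K}, U (\sum_j act (r2 j) (w' j)) /\ ~~ (r i %| r2 i)).
  apply: (trans w') => //.
  apply: (IH _ (fun j => if j == i then r2 i %% r i else r2 j) i); rewrite ?eqxx //.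
  rewrite (bigD1 i) //= eqxx.
  under eq_bigr => j ji do rewrite (negbTE ji).
  have -> : act (r2 i %% r i) (w' i) =
      act (r2 i) (w' i) - act (r2 i %/ r i * r i) (w' i).
    by rewrite {2}(divp_eq (r2 i) (r i)) actD addrC addKr.
  rewrite addrAC; apply: (submodB HU); last by rewrite actM; apply: (submod_act HU).
  by move: rel2; rewrite (bigD1 i).
exists w', i, (r i); split=> // r2 rel2.
by apply: contrapT => /negP nd; case: h; exists r2.
Qed.

Lemma good_generator_exists n (w : 'I_n.+1 -> V) : good_generator w.
Proof.
have [[r [i [r0 rel]]]|h] := pselect (exists (r : 'I_n.+1 -> {poly K}) i, r i != 0 /\ U (\sum_j act (r j) (w j))).
  exact: good_generator_rel (leqnn _) r0 rel.
exists w, ord0, 0; split=> // [|r rel]; first by rewrite act0; apply: (submod0 HU).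
by rewrite dvd0p; apply: contraT => r0; case: h; exists r, ord0.
Qed.

Definition good_order (o : {poly K}) : Prop := o = 0 \/ prime_power o.

(* The Chinese remainder splitting of one cyclic summand. *)
Lemma direct_split n : forall w (o : {poly K}) s, (size o <= n)%N -> o != 0 -> direct_over ((w, o) :: s) ->
  exists t : seq (V * {poly K}), [/\ direct_over (t ++ s), forall x, x \in t -> prime_power x.2 &
    forall v, span_over [seq x.1 | x <- t ++ s] v <-> span_over (w :: [seq x.1 | x <- s]) v].
Proof.
elim: n => [|n IH] w o s on o0 [Uow dw ds].
  by rewrite leqn0 size_poly_eq0 (negbTE o0) in on.
have HS s' := span_over_submod s'.
have Usub s' u : U u -> span_over s' u.
  by elim: s' u => //= x s' IHs u Uu; exists 0; rewrite act0 subr0; apply: IHs.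
have [o1|o1] := leqP (size o) 1.
  exists [::]; split=> // v /=; split=> [h|[r h]]; first by exists 0; rewrite act0 subr0.
  apply: (submod_subr (HS _)) h; apply: submod_act (HS _) _ _ _; apply: Usub.
  have := size1_polyC o1; set c := o`_0 => oE.
  have c0 : c != 0 by apply: contraNneq o0 => c0; rewrite oE c0.
  by rewrite -[w]scale1r -(mulVf c0) -scalerA; apply: (submodZ HU); rewrite -(actC th) -oE.
have [f mf fo] := mirr_factor o1.
have [q [b [q0 oE fb]]] := mirr_power_split mf o0 fo.
pose a := f ^+ q; have a0 : a != 0 by rewrite expf_neq0 // mirr_neq0.
have b0 : b != 0 by apply: contraNneq o0 => b0; rewrite oE b0 mulr0.
have cab : coprimep a b by rewrite coprimep_expl.
have sb : (size b <= n)%N.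
  rewrite -ltnS; apply: leq_trans on; rewrite oE size_mul //.
  have : (1 < size a)%N.
    rewrite ltnNge; apply: contraL (mirr_size mf); rewrite -leqNgt => sa.
    by apply: leq_trans sa; rewrite dvdp_leq // -[X in X %| _]expr1 dvdp_exp2l.
  by case: (size a) => [|[|k]] // _; rewrite addSn /= addSn ltnS leq_addl.
(* [act b w] has the prime power order [a] and joins the tail; [act a w] has the smaller order [b]
   and is split further. *)
have [|t [dt pt st]] := IH (act a w) b ((act b w, a) :: s) sb b0.
  split.
  - by rewrite -actM mulrC -oE.
  - move=> r [r' /=]; rewrite -!actM -actB => /dw; rewrite oE -/a => h.
    have : b %| r * a - r' * b by apply: dvdp_trans h; apply: dvdp_mull.
    by rewrite (dvdp_subl _ (dvdp_mull _ (dvdpp b))) Gauss_dvdpl // coprimep_sym.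
  - split=> //; first by rewrite -actM -oE.
    by move=> r; rewrite -actM => /dw; rewrite oE -/a dvdp_mul2r.
exists (rcons t (act b w, a)); rewrite cat_rcons; split=> //.
  move=> x; rewrite mem_rcons inE => /orP[/eqP ->|/pt //].
  by exists f, q.
move=> v; rewrite st /=; split=> [[r [r']]|[r]].
  by rewrite -addrA -opprD -!actM -actD => h; exists (r * a + r' * b).
have /Bezout_eq1_coprimepP [[c d] /= cd] := cab.
move=> h; exists (r * c), (r * d); rewrite -addrA -opprD -!actM -actD.
by rewrite -!mulrA -mulrDr cd mulr1.
Qed.

Lemma direct_decomposition n (w : 'I_n -> V) :
  exists s, [/\ direct_over s, forall x, x \in s -> good_order x.2 &
    forall v, span_over [seq x.1 | x <- s] v <-> gspan w v].
Proof.
elim: n w => [|n IH] w.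
  exists [::]; split=> // v; split=> [Uv|[r]]; last by rewrite big_ord0 subr0.
  by exists (fun=> 0); rewrite big_ord0 subr0.
have [w' [i [p [e Up dp]]]] := good_generator_exists w.
have [s [ds gs es]] := IH (fun j => w' (lift i j)).
have d1 : direct_over ((w' i, p) :: s).
  split=> // r /es [r' h].
  rewrite -dvdpNr.
  have := dp (fun j => if unlift i j is Some k then r' k else - r).
  rewrite unlift_none; apply; rewrite (bigD1_ord i) //= unlift_none.
  under eq_bigr => j _ do rewrite liftK.
  by rewrite actN addrC -opprB; apply: (submodN HU).
have e1 v : span_over (w' i :: [seq x.1 | x <- s]) v <-> gspan w v.
  by rewrite -e (gspanS w' i) /=; split=> -[r /es h]; exists r.
have [p0|p0] := eqVneq p 0.
  exists ((w' i, p) :: s); split=> // x; rewrite inE => /orP[/eqP->|/gs//].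
  by left.
have [t [dt pt st]] := direct_split (leqnn _) p0 d1.
exists (t ++ s); split=> // [x|v]; last by rewrite st e1.
by rewrite mem_cat => /orP[/pt|/gs]; [right|].
Qed.

(** Triangular independence yields independence of the family: the order of the head divides its
    coefficient, so the head term lies in [U] and drops out of the relation. *)
Lemma direct_over_family s : direct_over s -> (forall x, x \in s -> good_order x.2) ->
  exists (x : 'I_(size s) -> V) (o : 'I_(size s) -> {poly K}),
  [/\ forall i, U (act (o i) (x i)),
      forall r, U (\sum_i act (r i) (x i)) -> forall i, o i %| r i,
      forall i, good_order (o i) &
      forall v, gspan x v <-> span_over [seq x.1 | x <- s] v].
Proof.
elim: s => [|[w p] s IH] /=.
  move=> _ _; exists (fun=> 0), (fun=> 0); split=> [[]|r _ []|[]|v] //.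
  split=> [[r]|Uv]; first by rewrite big_ord0 subr0.
  by exists (fun=> 0); rewrite big_ord0 subr0.
move=> [Up dp ds] gs.
have [|x [o [Uo ind go sp]]] := IH ds; first by move=> x xs; apply: gs; rewrite inE xs orbT.
have gp : good_order p by apply: (gs (w, p)); rewrite mem_head.
exists (fun i => if unlift ord0 i is Some k then x k else w).
exists (fun i => if unlift ord0 i is Some k then o k else p).
have gE v : (exists r, gspan x (v - act r w)) <->
    gspan (fun i => if unlift ord0 i is Some k then x k else w) v.
  rewrite (gspanS _ ord0) unlift_none.
  suff -> : (fun j => if unlift ord0 (lift ord0 j) is Some k then x k else w) = x by [].
  by apply/funext => j; rewrite liftK.
split=> [i|r|i|v].
- by case: unliftP.
- rewrite (bigD1_ord ord0) //= unlift_none.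
  under eq_bigr => j _ do rewrite liftK.
  move=> h; have pr : p %| r ord0.
    apply: dp; apply/sp; exists (fun j => - r (lift ord0 j)).
    rewrite -sumrN; under eq_bigr => j _ do rewrite actN opprK.
    exact: h.
  move=> i; case: unliftP => [k ->|->] //; apply: (ind (fun j => r (lift ord0 j))).
  apply: (submod_subr HU (v := - act (r ord0) w)).
    by apply: (submodN HU); apply: act_dvd HU pr Up.
  by rewrite opprK addrC.
- by case: unliftP.
- by rewrite -gE; split=> -[r] /sp h; exists r.
Qed.

Lemma module_decomposition n (w : 'I_n -> V) :
  exists (m : nat) (x : 'I_m -> V) (o : 'I_m -> {poly K}),
  [/\ forall i, U (act (o i) (x i)),
      forall r, U (\sum_i act (r i) (x i)) -> forall i, o i %| r i,
      forall i, good_order (o i) &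
      forall v, gspan w v -> gspan x v].
Proof.
have [s [ds gs es]] := direct_decomposition w.
have [x [o [h1 h2 h3 h4]]] := direct_over_family ds gs.
by exists (size s), x, o; split=> // v /es/h4.
Qed.

End Decomposition.

(** * Linear combinations and bases *)

Section Combinations.
Variables (K : fieldType) (V : lmodType K).

(** A formal sum is a list in which indices may repeat, so that addition is concatenation; the true
    coefficients are read off by [coef]. *)
Definition comb (J : eqType) (g : J -> V) (l : seq (K * J)) : V :=
  \sum_(x <- l) x.1 *: g x.2.

Definition coef (J : eqType) (l : seq (K * J)) (j : J) : K := \sum_(x <- l | x.2 == j) x.1.

Definition lscale (J : eqType) a (l : seq (K * J)) := [seq (a * x.1, x.2) | x <- l].

Definition supported (J : eqType) (B : pred J) (l : seq (K * J)) := all (fun x => B x.2) l.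

Lemma combE (J : eqType) (g : J -> V) l js : uniq js ->
  (forall x, x \in l -> x.2 \in js) -> comb g l = \sum_(j <- js) coef l j *: g j.
Proof.
move=> ujs; elim: l => [|x l IH] h.
  rewrite /comb big_nil big1_seq // => j _; by rewrite /coef big_nil scale0r.
rewrite /comb big_cons -/(comb g l) IH; last by move=> y yl; apply: h; rewrite inE yl orbT.
have xjs : x.2 \in js by apply: h; rewrite mem_head.
rewrite (bigD1_seq x.2) //= [RHS](bigD1_seq x.2) //= addrA; congr (_ + _).
  by rewrite /coef big_cons eqxx scalerDl.
by apply: eq_bigr => j; rewrite /coef big_cons eq_sym => /negbTE ->.
Qed.

Lemma comb_cat (J : eqType) (g : J -> V) l l' : comb g (l ++ l') = comb g l + comb g l'.
Proof. exact: big_cat. Qed.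

Lemma comb_scale (J : eqType) (g : J -> V) a l : comb g (lscale a l) = a *: comb g l.
Proof.
by rewrite /comb big_map scaler_sumr; apply: eq_bigr => x _; rewrite scalerA.
Qed.

Lemma coef_cat (J : eqType) (l l' : seq (K * J)) j : coef (l ++ l') j = coef l j + coef l' j.
Proof. exact: big_cat. Qed.

Lemma coef_cons_comb (J : eqType) x (l : seq (K * J)) j :
  coef (x :: l) j = (if x.2 == j then x.1 else 0) + coef l j.
Proof. by rewrite /coef big_cons; case: eqP => // _; rewrite add0r. Qed.

Lemma coef_scale (J : eqType) a (l : seq (K * J)) j : coef (lscale a l) j = a * coef l j.
Proof. by rewrite /coef big_map mulr_sumr. Qed.

Lemma supported_cat (J : eqType) (B : pred J) l l' : supported B (l ++ l') = supported B l && supported B l'.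
Proof. exact: all_cat. Qed.

Lemma supported_scale (J : eqType) (B : pred J) a l : supported B (lscale a l) = supported B l.
Proof. by rewrite /supported all_map. Qed.

Lemma comb_coef0 (J : eqType) (g : J -> V) l : (forall j, coef l j = 0) -> comb g l = 0.
Proof.
move=> h; rewrite (@combE _ g l (undup [seq x.2 | x <- l])) ?undup_uniq //.
  by rewrite big1 // => j _; rewrite h scale0r.
by move=> x xl; rewrite mem_undup map_f.
Qed.

Lemma coef_mem (J : eqType) (l : seq (K * J)) j : coef l j != 0 ->
  exists2 x, x \in l & x.2 = j.
Proof.
move=> h; apply: contrapT => nx; move: h; rewrite /coef big1_seq ?eqxx // => x /andP[/eqP xj xl].
by case: nx; exists x.
Qed.

Record subspace (U : V -> Prop) : Prop := Subspace {
  subspace0 : U 0;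
  subspaceD : forall u v, U u -> U v -> U (u + v);
  subspaceZ : forall a v, U v -> U (a *: v) }.

Lemma subspaceN U v : subspace U -> U v -> U (- v).
Proof. by move=> HU Uv; rewrite -scaleN1r; apply: subspaceZ. Qed.

Lemma subspaceB U u v : subspace U -> U u -> U v -> U (u - v).
Proof. by move=> HU Uu Uv; apply: subspaceD => //; apply: subspaceN. Qed.

Definition span_of (U : V -> Prop) (J : eqType) (B : pred J) (b : J -> V) (v : V) : Prop :=
  exists2 l, supported B l & U (v - comb b l).

Definition indep (U : V -> Prop) (J : eqType) (B : pred J) (b : J -> V) : Prop :=
  forall l, supported B l -> U (comb b l) -> forall j, coef l j = 0.

Lemma span_of_subspace U (J : eqType) (B : pred J) (b : J -> V) :
  subspace U -> subspace (span_of U B b).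
Proof.
move=> HU; split.
- by exists [::] => //; rewrite /comb big_nil subr0; apply: subspace0.
- move=> u v [l Bl hl] [l' Bl' hl']; exists (l ++ l'); first by rewrite supported_cat Bl.
  by rewrite comb_cat opprD addrACA; apply: subspaceD.
- move=> a v [l Bl hl]; exists (lscale a l); first by rewrite supported_scale.
  by rewrite comb_scale -scalerBr; apply: subspaceZ.
Qed.

Lemma span_of_sub (U : V -> Prop) (J : eqType) (B : pred J) (b : J -> V) v :
  U v -> span_of U B b v.
Proof. by move=> Uv; exists [::]; rewrite // /comb big_nil subr0. Qed.

Lemma span_of_gen (U : V -> Prop) (J : eqType) (B : pred J) (b : J -> V) j :
  subspace U -> B j -> span_of U B b (b j).
Proof.
move=> HU Bj; exists [:: (1, j)]; first by rewrite /supported /= Bj.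
by rewrite /comb big_seq1 scale1r subrr; apply: subspace0.
Qed.

Lemma span_of_le (U W : V -> Prop) (J : eqType) (B : pred J) (b : J -> V) v :
  subspace W -> (forall u, U u -> W u) -> (forall j, B j -> W (b j)) -> span_of U B b v -> W v.
Proof.
move=> HW UW bW [l Bl /UW h]; rewrite -(subrK (comb b l) v); apply: (subspaceD HW) h _.
elim: l Bl => [|x l IH] /=; first by rewrite /comb big_nil => _; apply: (subspace0 HW).
move=> /andP[Bx /IH h]; rewrite /comb big_cons; apply: (subspaceD HW) => //.
exact/(subspaceZ HW)/bW.
Qed.

Lemma indep_map (U : V -> Prop) (J J' : eqType) (B : pred J) (B' : pred J') (b : J -> V)
    (b' : J' -> V) (phi : J' -> J) :
  {in B' &, injective phi} -> (forall j, B' j -> B (phi j)) ->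
  (forall j, B' j -> b' j = b (phi j)) -> indep U B b -> indep U B' b'.
Proof.
move=> inj BB bb ind l Bl Ul j.
have [//|/coef_mem[x xl xj]] := eqVneq (coef l j) 0.
have Bj : B' j by rewrite -xj; apply: (allP Bl).
pose l' := [seq (x.1, phi x.2) | x <- l].
have l'E : comb b l' = comb b' l.
  by rewrite /comb big_map; apply: eq_big_seq => y /(allP Bl) By; rewrite bb.
have : coef l' (phi j) = 0.
  apply: ind; last by rewrite l'E.
  by rewrite /supported all_map; apply: sub_all Bl => y /= /BB.
suff -> : coef l j = coef l' (phi j) by [].
rewrite /coef big_map /= [LHS]big_seq_cond [RHS]big_seq_cond.
apply: eq_bigl => y /=; case yl: (y \in l) => //=.
apply/idP/idP => [/eqP->//|/eqP]; move/(inj _ _ (allP Bl _ yl) Bj) => ->; exact: eqxx.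
Qed.

Definition sumB (J1 J2 : eqType) (B1 : pred J1) (B2 : pred J2) (x : J1 + J2) : bool :=
  match x with inl a => B1 a | inr b => B2 b end.

Definition sumv (J1 J2 : eqType) (b1 : J1 -> V) (b2 : J2 -> V) (x : J1 + J2) : V :=
  match x with inl a => b1 a | inr b => b2 b end.

Lemma comb_sumv (J1 J2 : eqType) (B1 : pred J1) (B2 : pred J2) (b1 : J1 -> V) (b2 : J2 -> V)
    (l : seq (K * (J1 + J2)%type)) : supported (sumB B1 B2) l ->
  exists l1 l2, [/\ supported B1 l1, supported B2 l2, comb (sumv b1 b2) l = comb b1 l1 + comb b2 l2,
    forall j, coef l (inl j) = coef l1 j & forall j, coef l (inr j) = coef l2 j].
Proof.
elim: l => [|[a x] l IH].
  move=> _; exists [::], [::]; split=> //; first by rewrite /comb !big_nil addr0.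
    by move=> j; rewrite /coef !big_nil.
  by move=> j; rewrite /coef !big_nil.
move=> /andP[/= Bx /IH[l1 [l2 [h1 h2 h3 h4 h5]]]].
rewrite /comb big_cons /= -/(comb _ l) h3.
case: x Bx => [x|x] /= Bx.
  exists ((a, x) :: l1), l2; split=> //; first by rewrite /supported /= Bx.
  - by rewrite /comb big_cons addrA.
  - by move=> j; rewrite !coef_cons_comb h4.
  - by move=> j; rewrite coef_cons_comb add0r h5.
exists l1, ((a, x) :: l2); split=> //; first by rewrite /supported /= Bx.
- by rewrite /comb big_cons addrCA.
- by move=> j; rewrite coef_cons_comb add0r h4.
- by move=> j; rewrite !coef_cons_comb h5.
Qed.

Lemma indep_join (U : V -> Prop) (J1 J2 : eqType) (B1 : pred J1) (B2 : pred J2)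
    (b1 : J1 -> V) (b2 : J2 -> V) : subspace U ->
  indep U B1 b1 -> indep (span_of U B1 b1) B2 b2 -> indep U (sumB B1 B2) (sumv b1 b2).
Proof.
move=> HU i1 i2 l Bl; have [l1 [l2 [B1l B2l -> c1 c2]]] := comb_sumv b1 b2 Bl => Ul.
have l20 j : coef l2 j = 0.
  apply: i2 => //; exists (lscale (-1) l1); first by rewrite supported_scale.
  by rewrite comb_scale scaleN1r opprK addrC.
have l10 j : coef l1 j = 0 by apply: i1 => //; rewrite (comb_coef0 b2 l20) addr0 in Ul.
by case=> j; rewrite ?c1 ?c2.
Qed.

Lemma spans_join (U : V -> Prop) (J1 J2 : eqType) (B1 : pred J1) (B2 : pred J2)
    (b1 : J1 -> V) (b2 : J2 -> V) v : subspace U ->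
  span_of (span_of U B1 b1) B2 b2 v -> span_of U (sumB B1 B2) (sumv b1 b2) v.
Proof.
move=> HU; have HS := span_of_subspace (sumB B1 B2) (sumv b1 b2) HU.
apply: (span_of_le HS) => [u|j Bj]; last first.
  exact: (span_of_gen (B := sumB B1 B2) (sumv b1 b2) (j := inr j)).
apply: (span_of_le HS) => [w|j Bj]; first exact: span_of_sub.
exact: (span_of_gen (B := sumB B1 B2) (sumv b1 b2) (j := inl j)).
Qed.

Lemma indep_over_left (U : V -> Prop) (J1 J2 : eqType) (B1 : pred J1)
    (b : J1 + J2 -> V) : subspace U -> indep U predT b ->
  indep (span_of U B1 (fun j => b (inl j))) predT (fun j => b (inr j)).
Proof.
move=> HU ind l _ [l1 _ h] j.
pose l' : seq (K * (J1 + J2)%type) :=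
  [seq (x.1, inr x.2) | x <- l] ++ lscale (-1) [seq (x.1, inl x.2) | x <- l1].
have := ind l' (introT allP (fun _ _ => isT)).
rewrite /l' comb_cat comb_scale scaleN1r {1 2}/comb !big_map => /(_ h (inr j)).
rewrite coef_cat coef_scale /coef !big_map /= [X in _ * X]big_pred0 ?mulr0 ?addr0 //.
Qed.

End Combinations.

Section LinearExtension.
Variables (K : fieldType) (V W : lmodType K) (U : V -> Prop).
Variables (J : eqType) (B : pred J) (b : J -> V) (s : J -> W) (f : V -> W).
Hypothesis HU : subspace U.
Hypothesis fL : forall a u v, U u -> U v -> f (a *: u + v) = a *: f u + f v.
Hypothesis ind : indep U B b.
Hypothesis gen : forall v, span_of U B b v.

(** The value at [v] is computed from a chosen representation modulo [U]. It does not depend on the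
    choice: the difference of two representations is a combination in [U], so all its coefficients
    vanish. *)
Lemma linear_extension : exists F : {linear V -> W},
  (forall u, U u -> F u = f u) /\ forall j, B j -> F (b j) = s j.
Proof.
have f0 : f 0 = 0.
  have := fL 1 (subspace0 HU) (subspace0 HU).
  by rewrite !scale1r addr0 => /esym/eqP; rewrite -subr_eq0 addrK => /eqP.
pose lr v := projT1 (cid2 (gen v)).
have lrB v : supported B (lr v) by rewrite /lr; case: cid2.
have lrU v : U (v - comb b (lr v)) by rewrite /lr; case: cid2.
pose F v := f (v - comb b (lr v)) + comb s (lr v).
have FE v l : supported B l -> U (v - comb b l) -> F v = f (v - comb b l) + comb s l.
  move=> Bl Ul; pose d := lr v ++ lscale (-1) l.
  have d0 : forall j, coef d j = 0.
    apply: ind; first by rewrite supported_cat lrB supported_scale.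
    rewrite comb_cat comb_scale scaleN1r -[comb b (lr v)](subKr v) addrAC.
    by apply: subspaceB.
  have := comb_coef0 b d0; have := comb_coef0 s d0.
  by rewrite !comb_cat !comb_scale !scaleN1r => /subr0_eq sE /subr0_eq bE; rewrite /F sE bE.
have Flin : linear F.
  move=> a u v; rewrite (FE _ (lscale a (lr u) ++ lr v)).
  - rewrite !comb_cat !comb_scale /F opprD addrACA -scalerBr fL // scalerDr.
    by rewrite addrACA.
  - by rewrite supported_cat supported_scale !lrB.
  - rewrite !comb_cat !comb_scale opprD addrACA -scalerBr.
    by apply: subspaceD => //; apply: subspaceZ.
pose FL := GRing.isLinear.Build K V W *:%R F Flin.
pose FF : {linear V -> W} := HB.pack F FL.
exists FF; split=> [u Uu|j Bj] /=.
  by rewrite (FE _ [::]) /comb ?big_nil ?subr0 ?addr0.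
rewrite (FE _ [:: (1, j)]) /comb ?big_seq1 ?scale1r ?subrr ?f0 ?add0r //.
- by rewrite /supported /= Bj.
- exact: subspace0.
Qed.

End LinearExtension.

(** * Well-ordered sets *)

Section WellOrder.
Variables (T : eqType) (R : rel T).
Hypothesis Rwo : well_order R.

Lemma wo_minP (P : T -> Prop) : (exists x, P x) ->
  exists2 m, P m & forall x, P x -> R m x.
Proof.
case=> x Px; have ne : nonempty [pred x | `[< P x >]] by exists x; apply/asboolP.
have [m [[/asboolP Pm lbm] _]] := Rwo ne.
by exists m => // y Py; apply: lbm; apply/asboolP.
Qed.

Lemma wo_refl x : R x x.
Proof. by have [|m -> h] := @wo_minP (fun y => y = x); [exists x|apply: h]. Qed.

Lemma wo_total x y : R x y || R y x.
Proof.
have [|m mxy h] := @wo_minP (fun z => z = x \/ z = y); first by exists x; left.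
by case: mxy h => -> h; [rewrite h//; right|rewrite (h x) ?orbT//; left].
Qed.

Lemma wo_anti x y : R x y -> R y x -> x = y.
Proof.
move=> xy yx; have ne : nonempty [pred z | (z == x) || (z == y)].
  by exists x; rewrite inE eqxx.
have [m [_ mu]] := Rwo ne.
have mx : m = x.
  by apply: mu; split=> [|z]; rewrite inE ?eqxx // => /orP[] /eqP -> //; apply: wo_refl.
have my : m = y.
  by apply: mu; split=> [|z]; rewrite inE ?eqxx ?orbT // => /orP[] /eqP -> //; apply: wo_refl.
by rewrite -mx -my.
Qed.

Lemma wo_trans x y z : R x y -> R y z -> R x z.
Proof.
move=> xy yz; have [|m mxyz h] := @wo_minP (fun w => [\/ w = x, w = y | w = z]).
  by exists x; constructor.
have hx : R m x by apply: h; constructor.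
have hy : R m y by apply: h; constructor 2.
have hz : R m z by apply: h; constructor 3.
case: mxyz hx hy hz => -> // hx hy _; first by rewrite -(wo_anti hx xy).
by rewrite (wo_anti yz hy) in xy.
Qed.

Definition wolt x y := R x y && (x != y).

Lemma wo_ind (P : T -> Prop) :
  (forall x, (forall y, wolt y x -> P y) -> P x) -> forall x, P x.
Proof.
move=> h x; apply: contrapT => nPx.
have [|m nPm hm] := @wo_minP (fun y => ~ P y); first by exists x.
apply/nPm/h => y /andP[ym nym]; apply: contrapT => /hm my.
by rewrite (wo_anti ym my) eqxx in nym.
Qed.

Lemma wo_max (s : seq T) x : x \in s -> exists2 m, m \in s & forall y, y \in s -> R y m.
Proof.
elim: s x => // a s IH x _; case: s IH => [|b s] IH.
  by exists a; rewrite ?mem_head // => y; rewrite inE => /eqP ->; apply: wo_refl.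
have [|m ms hm] := IH b; first exact: mem_head.
have /orP[am|ma] := wo_total a m.
  exists m; first by rewrite in_cons ms orbT.
  by move=> y; rewrite in_cons => /orP[/eqP ->|/hm].
exists a; rewrite ?mem_head // => y; rewrite in_cons => /orP[/eqP ->|/hm ym].
  exact: wo_refl.
exact: wo_trans ym ma.
Qed.

End WellOrder.

(** * Bases cut into infinite sequences *)

Section Complement.
Variables (K : fieldType) (V : lmodType K) (U : V -> Prop) (e : nat -> V).
Hypothesis HU : subspace U.
Hypothesis ind_e : indep U predT e.

(* The basis elements outside [U + <e>] are well ordered, and are put before
   those of [e]: the resulting order has no last element, so that every basis
   element is the [n]-th successor of a unique non-successor. *)
Lemma complement_basis : exists (J : eqType) (z : J * nat -> V),
  indep U predT z /\ forall v, span_of U predT z v.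
Proof.
have [R Rwo] := well_ordering_principle V.
pose lt := wolt R.
pose U2 := span_of U predT e.
have HU2 : subspace U2 by apply: span_of_subspace.
(* The greedy basis: the vectors not spanned by [U2] and their predecessors in the well-order. *)
pose isB v := `[< ~ span_of U2 (fun u => lt u v) id v >].
have spanB v : span_of U2 isB id v.
  elim/(wo_ind Rwo): v => v IH.
  have HS := span_of_subspace isB id HU2.
  have [Bv|/asboolPn/contrapT h] := boolP (isB v).
    exact: (span_of_gen (B := isB) id (j := v)).
  by apply: (span_of_le HS) h => // u; apply: span_of_sub.
have indB : indep U2 isB id.
  move=> l Bl Ul; apply: contrapT => /existsNP[j0 cj0].
  pose js := undup [seq x.2 | x <- l].
  have ujs : uniq js by apply: undup_uniq.
  have ljs x : x \in l -> x.2 \in js by move=> xl; rewrite mem_undup map_f.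
  have memjs j : coef l j != 0 -> j \in js by move=> /coef_mem[x /ljs + <-].
  (* The largest basis vector with a nonzero coefficient would be spanned by smaller ones modulo
     [U2]. *)
  have [|m] := @wo_max _ _ Rwo [seq j <- js | coef l j != 0] j0.
    by rewrite mem_filter memjs ?andbT; apply/eqP.
  rewrite mem_filter => /andP[cm mjs] hm.
  have : isB m.
    by have [x xl <-] := coef_mem cm; apply: (allP Bl).
  move=> /asboolP; apply.
  exists [seq (- ((coef l m)^-1 * coef l j), j) | j <- [seq j <- js | (coef l j != 0) && (j != m)]].
    rewrite /supported all_map; apply/allP => j; rewrite mem_filter => /andP[/andP[cj jm] jjs] /=.
    by rewrite /lt /wolt jm andbT; apply: hm; rewrite mem_filter cj.
  have -> : m - comb id [seq (- ((coef l m)^-1 * coef l j), j) |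
      j <- [seq j <- js | (coef l j != 0) && (j != m)]] = (coef l m)^-1 *: comb id l.
    rewrite (combE id ujs ljs) (bigD1_seq m) //= scalerDr scalerA mulVf // scale1r.
    congr (_ + _); rewrite /comb big_map big_filter scaler_sumr -sumrN.
    rewrite [LHS]big_mkcond [RHS]big_mkcond; apply: eq_bigr => j _.
    rewrite /= scaleNr opprK scalerA; case: eqP => //= ->.
    by rewrite mulr0 scale0r if_same.
  exact: subspaceZ.
pose J1 := (nat + V)%type.
pose B1 : pred J1 := sumB predT isB.
pose b1 : J1 -> V := sumv e id.
have ind1 : indep U B1 b1 by apply: indep_join.
have span1 v : span_of U B1 b1 v by apply: spans_join.
(* The next vector of the greedy basis, or the first term of [e] when there is none above [v]. *)
have /choice[nx nxP] : forall v, exists j : J1,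
    (exists w, [/\ j = inr w, isB w, lt v w & forall w', isB w' -> lt v w' -> R w w']) \/
    (j = inl 0%N /\ forall w, isB w -> ~ lt v w).
  move=> v; have [h|h] := pselect (exists w, isB w /\ lt v w).
    have [w [Bw vw] hw] := wo_minP Rwo h.
    by exists (inr w); left; exists w; split=> // w' Bw' vw'; apply: hw.
  by exists (inl 0%N); right; split=> // w Bw vw; apply: h; exists w.
pose s (j : J1) : J1 := match j with inl n => inl n.+1 | inr v => nx v end.
have sB j : B1 j -> B1 (s j).
  by case: j => //= v _; case: (nxP v) => [[w [-> ? _ _]]|[->]].
have ltNR u v : lt u v -> R v u -> False.
  by move=> /andP[uv nuv] vu; rewrite (wo_anti Rwo uv vu) eqxx in nuv.
have trich u v : u <> v -> lt u v \/ lt v u.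
  move=> /eqP uv; rewrite /lt /wolt uv eq_sym uv !andbT.
  by have /orP[] := wo_total Rwo u v; [left|right].
have snx u v : isB u -> isB v -> lt u v -> nx u <> nx v.
  move=> Bu Bv uv; case: (nxP u) => [[w [-> Bw uw hw]]|[-> /(_ v Bv)//]].
  case: (nxP v) => [[w' [-> Bw' vw' hw']]|[-> _]//] [ww'].
  by apply: (ltNR _ _ vw'); rewrite -ww'; apply: hw.
have sinj : {in B1 &, injective s}.
  move=> [n|u] [m|v] /= Bu Bv.
  - by move=> [->].
  - by case: (nxP v) => [[w [-> _ _ _]]|[-> _]].
  - by case: (nxP u) => [[w [-> _ _ _]]|[-> _]].
  - move=> h; congr inr; apply: contrapT => /trich[] /snx; first exact.
    by move=> h'; apply: h'.
(* The non-successors are the starting points of the sequences. *)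
pose isJ (j : J1) := B1 j && `[< forall i, B1 i -> s i <> j >].
pose J : eqType := {j : J1 | isJ j}.
have sBn n j : B1 j -> B1 (iter n s j) by move=> Bj; elim: n => //= n; apply: sB.
have JB (j : J) : B1 (val j) by have /andP[] := valP j.
have Js (j : J) i : B1 i -> s i <> val j.
  by have /andP[_ /asboolP] := valP j; apply.
exists J, (fun x => b1 (iter x.2 s (val x.1))); split.
  apply: (indep_map (phi := fun x : J * nat => iter x.2 s (val x.1))) ind1 => //.
  - move=> [a n] [b m] _ _ /=; elim: n m => [|n IH] [|m] /=.
    + by move=> /val_inj ->.
    + by move=> /esym h; case: (Js a _ (sBn m _ (JB b)) h).
    + by move=> h; case: (Js b _ (sBn n _ (JB a)) h).
    + by move=> /(sinj _ _ (sBn _ _ (JB a)) (sBn _ _ (JB b)))/IH[-> ->].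
  - by move=> [a n] _; apply: sBn.
have surj j : B1 j -> exists x : J * nat, iter x.2 s (val x.1) = j.
  (* It is enough to reach the predecessors, as an element without one is itself a start.
     Predecessors of a greedy vector are smaller greedy vectors, so the well-order ends the
     descent. *)
  have step k : B1 k -> (forall i, B1 i -> s i = k -> exists x : J * nat, iter x.2 s (val x.1) = i) ->
      exists x : J * nat, iter x.2 s (val x.1) = k.
    move=> Bk h; have [[i [Bi sik]]|nk] := pselect (exists i, B1 i /\ s i = k).
      by have [[a n] /= xi] := h i Bi sik; exists (a, n.+1); rewrite /= xi.
    have Jk : isJ k by rewrite /isJ Bk; apply/asboolP => i Bi sik; apply: nk; exists i.
    by exists (exist _ k Jk, 0%N).
  have surjr v : isB v -> exists x : J * nat, iter x.2 s (val x.1) = inr v.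
    elim/(wo_ind Rwo): v => v IH Bv; apply: step => // -[n|u] //= Bu.
    by case: (nxP u) => [[w [-> Bw uw _]]|[-> _]] // [wv]; apply: IH; rewrite -?wv.
  case: j => [n|v]; last exact: surjr.
  elim: n => [|n IH] _; apply: step => // -[m|u] Bm //= E; try exact: surjr.
  by case: E => ->; apply: IH.
move=> v; apply: (span_of_le (span_of_subspace _ _ HU)) (span1 v).
  by move=> u; apply: span_of_sub.
move=> j /surj[x <-].
exact: (span_of_gen (B := predT) (fun x : J * nat => b1 (iter x.2 s (val x.1)))).
Qed.

End Complement.

(** * Bases consisting of the vectors X^i x_k *)

Lemma big_fibers (V : nmodType) (X : Type) (I : eqType) (h : X -> I) (F : X -> V) l ks :
  uniq ks -> all (fun x => h x \in ks) l ->
  \sum_(x <- l) F x = \sum_(k <- ks) \sum_(x <- l | h x == k) F x.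
Proof.
move=> uks; elim: l => [|x l IH] /=.
  by rewrite big_nil big1 // => k _; rewrite big_nil.
move=> /andP[xk /IH lk]; rewrite big_cons lk (bigD1_seq (h x)) //=.
rewrite [RHS](bigD1_seq (h x)) //= addrA big_cons eqxx; congr (_ + _).
by apply: eq_bigr => k; rewrite big_cons eq_sym => /negbTE ->.
Qed.

Lemma big_sub_uniq (V : nmodType) (I : eqType) (ks js : seq I) (F : I -> V) :
  uniq ks -> uniq js -> {subset ks <= js} ->
  \sum_(k <- js) (if k \in ks then F k else 0) = \sum_(k <- ks) F k.
Proof.
move=> uks ujs sub; rewrite -big_mkcond -big_filter; apply: perm_big.
apply: uniq_perm => //; first exact: filter_uniq.
by move=> k; rewrite mem_filter; case ks_k: (k \in ks) => //=; apply: sub.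
Qed.

(** The pairs [(k, i)] index the basis X^i x_k of a direct sum of cyclic modules K[X]/(o_k): all [i]
    in a free summand, where [o k = 0], and [i] below the degree of [o k] otherwise. *)
Definition bnd (K : fieldType) (I : eqType) (o : I -> {poly K}) (z : I * nat) : bool :=
  (o z.1 == 0) || (z.2 < (size (o z.1)).-1)%N.

Section PolynomialBasis.
Variables (K : fieldType) (V : lmodType K) (th : {linear V -> V}) (U : V -> Prop).
Variables (I : eqType) (x : I -> V) (o : I -> {poly K}).
Local Notation act := (act th).
Hypothesis HU : submod th U.
Hypothesis ind : indep U (bnd o) (fun z : I * nat => iter z.2 th (x z.1)).

Definition reduced (r : I -> {poly K}) k := (o k == 0) || (size (r k) < size (o k))%N.

Definition coefpoly (l : seq (K * (I * nat))) (k : I) : {poly K} :=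
  \sum_(z <- l | z.2.1 == k) z.1 *: 'X^(z.2.2).

Lemma coefpolyE l k i : (coefpoly l k)`_i = coef l (k, i).
Proof.
rewrite /coefpoly coef_sum /coef [LHS]big_mkcond [RHS]big_mkcond.
apply: eq_bigr => -[a [k' i']] _ /=; rewrite coefZ coefXn xpair_eqE (eq_sym i).
by case: (k' == k); case: (i' == i); rewrite ?mulr1 ?mulr0.
Qed.

Lemma coefpoly_reduced l k : supported (bnd o) l -> reduced (coefpoly l) k.
Proof.
move=> Bl; rewrite /reduced; have [//|ok0 /=] := eqVneq (o k) 0.
rewrite -(prednK (n := size (o k))) ?size_poly_gt0 // ltnS.
rewrite /coefpoly big_seq_cond; elim/big_rec: _ => [|z p /andP[zl /eqP zk] IH].
  by rewrite size_poly0.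
rewrite (leq_trans (size_polyD _ _)) // geq_max IH andbT.
rewrite (leq_trans (size_scale_leq _ _)) // size_polyXn.
by have := allP Bl _ zl; rewrite /bnd zk (negbTE ok0).
Qed.

Lemma comb_coefpoly l ks : uniq ks -> all (fun z => z.2.1 \in ks) l ->
  comb (fun z : I * nat => iter z.2 th (x z.1)) l = \sum_(k <- ks) act (coefpoly l k) (x k).
Proof.
move=> uks lks; rewrite /comb (@big_fibers _ _ _ (fun z : K * (I * nat) => z.2.1) _ _ ks) //.
apply: eq_bigr => k _; rewrite act_sum; apply: eq_bigr => z /eqP zk.
by rewrite actZ actXn zk.
Qed.

Lemma polynomial_span v : span_of U (bnd o) (fun z : I * nat => iter z.2 th (x z.1)) v ->
  exists ks r, [/\ uniq ks, forall k, reduced r k & U (v - \sum_(k <- ks) act (r k) (x k))].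
Proof.
case=> l Bl Ul; exists (undup [seq z.2.1 | z <- l]), (coefpoly l).
split; first exact: undup_uniq.
  by move=> k; apply: coefpoly_reduced.
rewrite -comb_coefpoly ?undup_uniq //.
by apply/allP => z zl; rewrite mem_undup (map_f (fun z => z.2.1)).
Qed.

Lemma polynomial_indep ks r : uniq ks -> (forall k, reduced r k) ->
  U (\sum_(k <- ks) act (r k) (x k)) -> forall k, k \in ks -> r k = 0.
Proof.
move=> uks red Ur k kks.
pose l := [seq ((r k)`_i, (k, i)) | k <- ks, i <- iota 0 (size (r k))].
have Bl : supported (bnd o) l.
  apply/allP => z /allpairsPdep[j [i [jks + ->]]]; rewrite mem_iota => /andP[_ /= ij].
  rewrite /bnd /=; have := red j; rewrite /reduced; case: eqP => //= _ jo.
  by case: (size (o j)) jo => // n; rewrite ltnS; apply: leq_trans ij.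
have Ul : U (comb (fun z : I * nat => iter z.2 th (x z.1)) l).
  move: Ur; congr U; rewrite /comb big_allpairs_dep; apply: eq_bigr => j _.
  by rewrite act_iota.
apply/polyP => i; rewrite coef0.
have [szi|] := ltnP i (size (r k)); last by move=> szi; rewrite nth_default.
have := ind Bl Ul (k, i); rewrite /coef big_mkcond big_allpairs_dep /=.
rewrite (bigD1_seq k) //= [X in _ + X]big1 ?addr0 => [|j jk]; last first.
  by rewrite big1 // => i' _; rewrite xpair_eqE (negbTE jk).
rewrite (bigD1_seq i) ?iota_uniq ?mem_iota //= eqxx big1 ?addr0 // => i' ii'.
by rewrite xpair_eqE (negbTE ii') andbF.
Qed.

Variables (fl : seq I) (P : I -> I -> {poly K}).
Hypothesis ufl : uniq fl.
Hypothesis ofl : forall l, l \in fl -> o l = 0.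
Hypothesis rel : forall k, o k != 0 ->
  U (act (o k) (x k) - \sum_(l <- fl) act (P k l) (x l)).

(** Dividing [s k] by [o k] and rewriting o_k x_k through the free generators brings the relation
    into reduced form, where every coefficient vanishes. At nonzero order this coefficient is the
    remainder; at [l] in [fl] it is [s l] plus the sum of all [q k * P k l]. *)
Lemma polynomial_relation ks s : uniq ks -> U (\sum_(k <- ks) act (s k) (x k)) ->
  (forall k, k \in ks -> o k != 0 -> o k %| s k) /\
  ((forall k l, k \in ks -> o k != 0 -> P k l != 0 -> s k = 0) ->
   forall k, k \in ks -> o k = 0 -> s k = 0).
Proof.
move=> uks Us.
pose js := undup (ks ++ fl); pose q k := s k %/ o k.
pose r1 k := if k \in ks then s k %% o k else 0.
pose r2 l := if l \in fl then \sum_(k <- ks) q k * P k l else 0.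
pose r k := r1 k + r2 k.
have rE : \sum_(k <- js) act (r k) (x k) =
    \sum_(k <- ks) act (s k %% o k) (x k) +
    \sum_(l <- fl) act (\sum_(k <- ks) q k * P k l) (x l).
  rewrite -[X in _ = X + _](big_sub_uniq (js := js)) ?undup_uniq //; last first.
    by move=> k kks; rewrite mem_undup mem_cat kks.
  rewrite -[X in _ = _ + X](big_sub_uniq (js := js)) ?undup_uniq //; last first.
    by move=> k kks; rewrite mem_undup mem_cat kks orbT.
  rewrite -big_split; apply: eq_bigr => k _; rewrite actD /r1 /r2.
  by congr (_ + _); case: ifP => // _; rewrite act0.
have red k : reduced r k.
  rewrite /reduced; have [//|ok0 /=] := eqVneq (o k) 0.
  have -> : r k = r1 k.
    by rewrite /r /r2; case: ifP => [/ofl ok|_]; [rewrite ok eqxx in ok0|rewrite addr0].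
  by rewrite /r1; case: ifP => _; rewrite ?ltn_modp // size_poly0 size_poly_gt0.
have Ur : U (\sum_(k <- js) act (r k) (x k)).
  rewrite rE; under [X in _ + X]eq_bigr => l _ do rewrite act_sum.
  rewrite exchange_big -big_split /=.
  have -> : \sum_(k <- ks) (act (s k %% o k) (x k) +
        \sum_(l <- fl) act (q k * P k l) (x l)) =
      \sum_(k <- ks) act (s k) (x k) - \sum_(k <- ks)
        act (q k) (act (o k) (x k) - \sum_(l <- fl) act (P k l) (x l)).
    rewrite -sumrB; apply: eq_bigr => k _.
    rewrite {2}(divp_eq (s k) (o k)) actD actM linearB opprB /=.
    have -> : \sum_(l <- fl) act (q k * P k l) (x l) =
        act (q k) (\sum_(l <- fl) act (P k l) (x l)).
      by rewrite linear_sum; apply: eq_bigr => l _; rewrite actM.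
    by rewrite [X in _ = X + _]addrC -addrA [X in _ = _ + X]addrCA subrr addr0.
  apply: (submodB HU) => //; apply: (submod_sum HU) => k _.
  have [ok0|ok0] := eqVneq (o k) 0; last by apply: (submod_act HU); apply: rel.
  by rewrite /q ok0 divp0 !act0; apply: (submod0 HU).
have r0 := polynomial_indep (undup_uniq _) red Ur.
split=> [k kks ok0|hP k kks ok0].
  have : r k = 0 by apply: r0; rewrite mem_undup mem_cat kks.
  rewrite /r /r1 /r2 kks; case: ifP => [/ofl ok|_]; first by rewrite ok eqxx in ok0.
  by rewrite addr0 => /modp_eq0P.
have : r k = 0 by apply: r0; rewrite mem_undup mem_cat kks.
have r20 : r2 k = 0.
  rewrite /r2; case: ifP => // _; rewrite big1_seq // => j /andP[_ jks].
  have [oj0|oj0] := eqVneq (o j) 0; first by rewrite /q oj0 divp0 mul0r.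
  have [->|Pjk] := eqVneq (P j k) 0; first by rewrite mulr0.
  by rewrite /q (hP j k) // div0p mul0r.
by rewrite /r r20 addr0 /r1 kks ok0 modp0.
Qed.

End PolynomialBasis.

(** * Extending an endomorphism *)

Definition ord_poly (K : fieldType) (p : {poly K}) : Prop :=
  p = 0 \/ p \is monic /\ (1 < size p)%N.

Section ExtendEndomorphism.
Variables (K : fieldType) (V0 V : lmodType K) (iota : {linear V0 -> V}).
Variables (th0 : {linear V0 -> V0}).
Hypothesis iota_inj : injective iota.
Variables (I1 : eqType) (o1 : I1 -> {poly K}) (u1 : I1 -> V0).
Variables (fl : seq I1) (P : I1 -> I1 -> {poly K}) (o2 : {poly K}).
Variable y : (I1 * nat) + nat -> V.
Hypothesis o1P : forall k, ord_poly (o1 k).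
Hypothesis o2P : ord_poly o2.
Hypothesis ofl : forall l, l \in fl -> o1 l = 0.
Let U (v : V) : Prop := exists v0, v = iota v0.
Hypothesis ind_y : indep U predT y.

Let HU : subspace U.
Proof.
split; first by exists 0; rewrite linear0.
  by move=> u v [u0 ->] [v0 ->]; exists (u0 + v0); rewrite linearD.
by move=> a v [v0 ->]; exists (a *: v0); rewrite linearZ.
Qed.

Let ord (I2 : Type) (k : I1 + I2) := match k with inl k1 => o1 k1 | inr _ => o2 end.

(* For [o2 != 0] each of the free sequences of [complement_basis] is cut into
   blocks of length [deg o2]. *)
Lemma adapted_basis : exists (I2 : eqType) (b : (I1 + I2) * nat -> V),
  [/\ indep U (bnd (@ord I2)) b, forall v, span_of U (bnd (@ord I2)) b v &
      forall k i, bnd o1 (k, i) -> b (inl k, i) = y (inl (k, i))].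
Proof.
have ind1 : indep U (bnd o1) (fun z => y (inl z)).
  by apply: (indep_map (phi := inl)) ind_y => // z z' _ _ [].
have HU1 := span_of_subspace (bnd o1) (fun z => y (inl z)) HU.
have [J [z [ind_z span_z]]] := complement_basis HU1 (indep_over_left HU ind_y).
have ind2 := indep_join HU ind1 ind_z.
have span2 v : span_of U (sumB (bnd o1) predT) (sumv (fun z => y (inl z)) z) v.
  by apply: spans_join.
have transfer (I2 : eqType) (phi : (I1 + I2) * nat -> (I1 * nat) + (J * nat)) :
    {in bnd (@ord I2) &, injective phi} ->
    (forall x, bnd (@ord I2) x -> sumB (bnd o1) predT (phi x)) ->
    (forall x, sumB (bnd o1) predT x -> exists2 x', bnd (@ord I2) x' & phi x' = x) ->
    (forall k i, phi (inl k, i) = inl (k, i)) ->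
    exists (I2 : eqType) (b : (I1 + I2) * nat -> V),
    [/\ indep U (bnd (@ord I2)) b, forall v, span_of U (bnd (@ord I2)) b v &
      forall k i, bnd o1 (k, i) -> b (inl k, i) = y (inl (k, i))].
  move=> pinj pB psurj pl.
  exists I2, (fun x => sumv (fun z => y (inl z)) z (phi x)); split.
  - exact: indep_map pinj pB _ ind2.
  - move=> v; apply: (span_of_le (span_of_subspace _ _ HU)) (span2 v).
      by move=> u; apply: span_of_sub.
    move=> x /psurj[x' Bx' <-].
    exact: (span_of_gen (fun x => sumv (fun z => y (inl z)) z (phi x)) HU Bx').
  - by move=> k i _; rewrite pl.
have [o20|[o2m o2s]] := o2P.
  apply: (transfer J (fun x => match x.1 with inl k => inl (k, x.2) | inr j => inr (j, x.2) end)).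
  - by move=> [[k|j] n] [[k'|j'] n'] _ _ //= [-> ->].
  - by move=> [[k|j] n].
  - by move=> [[k i]|[j n]] Bx; [exists (inl k, i)|exists (inr j, n)]; rewrite // /bnd /= o20 eqxx.
  - by [].
pose d := (size o2).-1.
have d0 : (0 < d)%N by rewrite /d; case: (size o2) o2s => [|[]].
have o20 : o2 != 0 by apply: monic_neq0.
have bnd2 (j : J * nat) i : bnd (@ord (J * nat)%type) (inr j, i) = (i < d)%N.
  by rewrite /bnd /= (negbTE o20).
apply: (transfer (J * nat)%type (fun x => match x.1 with
  inl k => inl (k, x.2) | inr j => inr (j.1, j.2 * d + x.2)%N end)).
- move=> [[k|[j t]] n] [[k'|[j' t']] n'] B B' //=; first by move=> [-> ->].
  have nd : (n < d)%N by rewrite -(bnd2 (j, t)).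
  have nd' : (n' < d)%N by rewrite -(bnd2 (j', t')).
  move=> [-> h].
  have := congr1 (fun m => m %/ d)%N h; rewrite !divnMDl // !divn_small // !addn0 => <-.
  by have := congr1 (fun m => m %% d)%N h; rewrite !modnMDl !modn_small // => ->.
- by move=> [[k|j] n].
- move=> [[k i]|[j n]] Bx; first by exists (inl k, i).
  exists (inr (j, n %/ d)%N, (n %% d)%N); first by rewrite bnd2 ltn_mod.
  by rewrite /= -divn_eq.
- by [].
Qed.

(** On an infinite sequence theta is the shift; on a finite block it is a companion matrix corrected
    by the right-hand side of the relation. That side can be written down before theta exists,
    because the generators in [fl] are free and their orbits consist of basis vectors. *)
Lemma extend_endomorphism : exists (I2 : eqType) (x : I1 + I2 -> V) (th : {linear V -> V}),
  [/\ forall v, th (iota v) = iota (th0 v),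
      forall k i, bnd o1 (k, i) -> iter i th (x (inl k)) = y (inl (k, i)),
      indep U (bnd (@ord I2)) (fun z : (I1 + I2) * nat => iter z.2 th (x z.1)),
      forall v, span_of U (bnd (@ord I2)) (fun z : (I1 + I2) * nat => iter z.2 th (x z.1)) v &
      (forall k, o1 k != 0 ->
        act th (o1 k) (x (inl k)) =
          iota (u1 k) + \sum_(l <- fl) act th (P k l) (x (inl l))) /\
      forall k, act th o2 (x (inr k)) = 0].
Proof.
have [I2 [b [ind_b span_b b1]]] := adapted_basis.
pose d (k : I1 + I2) := (size (ord k)).-1.
pose rhs (k : I1 + I2) : V := match k with
  | inl k1 => iota (u1 k1) + \sum_(l <- fl) \sum_(i < size (P k1 l)) (P k1 l)`_i *: b (inl l, nat_of_ord i)
  | inr _ => 0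
  end.
pose nxt (z : (I1 + I2) * nat) : V :=
  if (ord z.1 == 0) || (z.2.+1 < d z.1)%N then b (z.1, z.2.+1)
  else rhs z.1 - \sum_(j < d z.1) (ord z.1)`_j *: b (z.1, nat_of_ord j).
have /choice[inv invP] : forall v, exists v0, U v -> v = iota v0.
  by move=> v; have [[v0 h]|h] := pselect (U v); [exists v0|exists 0].
have inv_iota v : inv (iota v) = v.
  by apply: iota_inj; rewrite -invP //; exists v.
pose f v := iota (th0 (inv v)).
have fL a u v : U u -> U v -> f (a *: u + v) = a *: f u + f v.
  move=> [u0 ->] [v0 ->]; rewrite /f -linearZ -linearD !inv_iota.
  by rewrite !linearD !linearZ.
have [th [thU thb]] := linear_extension nxt HU fL ind_b span_b.
have ordP (k : I1 + I2) : ord_poly (ord k) by case: k => // k; apply: o1P.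
have bnd0 k : bnd (@ord I2) (k, 0%N).
  rewrite /bnd /=; have [->|[_]] := ordP k; first by rewrite eqxx.
  by case: (size _) => [|[|n]] //; rewrite orbT.
have it k i : bnd (@ord I2) (k, i) -> iter i th (b (k, 0%N)) = b (k, i).
  elim: i => //= i IH Bi.
  have Bi' : bnd (@ord I2) (k, i).
    by move: Bi; rewrite /bnd /=; case: eqP => //= _; apply: ltn_trans.
  rewrite IH // thb // /nxt /= -/(d k); move: Bi; rewrite /bnd /= -/(d k) => ->.
  by [].
have actE (p : {poly K}) k : (forall i, (i < size p)%N -> bnd (@ord I2) (k, i)) ->
    act th p (b (k, 0%N)) = \sum_(i < size p) p`_i *: b (k, nat_of_ord i).
  by move=> Bp; apply: eq_bigr => i _; rewrite it // Bp.
have rel (k : I1 + I2) : ord k != 0 -> act th (ord k) (b (k, 0%N)) = rhs k.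
  move=> ok0; have [ok|[om os]] := ordP k; first by rewrite ok eqxx in ok0.
  have dE : size (ord k) = (d k).+1 by rewrite /d prednK // ltnW.
  have dgt : (0 < d k)%N by rewrite -ltnS -dE.
  rewrite (@act_widen _ _ _ (d k).+1) ?dE // big_ord_recr /=.
  have -> : (ord k)`_(d k) = 1 by move: om => /monicP; rewrite /lead_coef.
  have -> : iter (d k) th (b (k, 0%N)) = nxt (k, (d k).-1).
    rewrite -{1}(prednK dgt) iterS it ?thb //.
      by rewrite /bnd /= (negbTE ok0) -/(d k) ltn_predL.
    by rewrite /bnd /= (negbTE ok0) -/(d k) ltn_predL.
  rewrite /nxt /= (negbTE ok0) prednK // ltnn /= scale1r.
  rewrite [X in X + _](_ : _ = \sum_(j < d k) (ord k)`_j *: b (k, nat_of_ord j)).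
    by rewrite addrC subrK.
  apply: eq_bigr => j _; rewrite it // /bnd /= (negbTE ok0) -/(d k).
  exact: ltn_ord.
exists I2, (fun k => b (k, 0%N)), th; split.
- by move=> v; rewrite thU ?/f ?inv_iota //; exists v.
- move=> k i Bi; rewrite it ?b1 //.
- apply: (indep_map (phi := id)) ind_b => //.
  by move=> [k i] Bz /=; rewrite it.
- move=> v; apply: (span_of_le (span_of_subspace _ _ HU)) (span_b v).
    by move=> u; apply: span_of_sub.
  move=> [k i] Bz; rewrite -(it k i Bz).
  exact: (span_of_gen (fun z : (I1 + I2) * nat => iter z.2 th (b (z.1, 0%N))) HU Bz).
- split=> [k ok0|k].
    rewrite (rel (inl k)) //=; congr (_ + _); apply: eq_big_seq => l lfl.
    by rewrite actE // => i _; rewrite /bnd /= ofl ?eqxx.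
  have [->|o20] := eqVneq o2 0; first exact: act0.
  by rewrite -[RHS]/(rhs (inr k)) -rel.
Qed.

End ExtendEndomorphism.

(** * Kernel configurations *)

Section KernelReduce.
Variables (K : fieldType) (V : lmodType K) (th : {linear V -> V}) (U : V -> Prop).
Variables (I : eqType) (x : I -> V) (o : I -> {poly K}).
Local Notation act := (act th).
Hypothesis HU : submod th U.
Hypothesis ind : indep U (bnd o) (fun z : I * nat => iter z.2 th (x z.1)).
Hypothesis gen : forall v, span_of U (bnd o) (fun z : I * nat => iter z.2 th (x z.1)) v.
Variables (fl : seq I) (P : I -> I -> {poly K}).
Hypothesis ufl : uniq fl.
Hypothesis ofl : forall l, l \in fl -> o l = 0.
Hypothesis rel : forall k, o k != 0 ->
  U (act (o k) (x k) - \sum_(l <- fl) act (P k l) (x l)).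

(** [o k] divides [p * r k], so [r k = 0] if [o k] is prime to [p], as [r k] is reduced. The
    quotients that survive belong to generators whose relation contains no free generator, hence
    [p * r k = 0] at the free ones as well. *)
Lemma kernel_reduce p v : p != 0 ->
  (forall k, o k != 0 -> coprimep p (o k) \/ forall l, P k l = 0) ->
  U (act p v) ->
  exists ks r u, [/\ U u, uniq ks, forall k, reduced o r k,
    v = u + \sum_(k <- ks) act (r k) (x k) &
    forall k, k \in ks -> r k != 0 -> o k != 0 /\ ~~ coprimep p (o k)].
Proof.
move=> p0 cop Up; have [ks [r [uks red Ur]]] := polynomial_span (gen v).
exists ks, r, (v - \sum_(k <- ks) act (r k) (x k)); split=> //; first by rewrite subrK.
have Us : U (\sum_(k <- ks) act (p * r k) (x k)).
  have := submodB HU Up (submod_act HU p Ur).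
  rewrite linearB /= subKr; congr U.
  by rewrite linear_sum; apply: eq_bigr => k _; rewrite actM.
have [dv fr] := polynomial_relation HU ind ufl ofl rel uks Us.
have r_cop k : k \in ks -> o k != 0 -> coprimep p (o k) -> r k = 0.
  move=> kks ok0 cp; have := dv k kks ok0; rewrite Gauss_dvdpr; last by rewrite coprimep_sym.
  move=> okr; apply: contraTeq (red k) => r0; rewrite /reduced (negbTE ok0) /= -leqNgt.
  exact: dvdp_leq.
move=> k kks rk0; have [ok0|ok0] := eqVneq (o k) 0; last first.
  by split=> //; apply: contra_neqN rk0 => cp; apply: r_cop.
have /eqP : p * r k = 0.
  apply: fr => // j l jks oj0 Pjl.
  case: (cop j oj0) => [cp|/(_ l) Pl]; last by rewrite Pl eqxx in Pjl.
  by rewrite (r_cop j) ?mulr0.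
by rewrite mulf_eq0 (negbTE p0) (negbTE rk0).
Qed.

End KernelReduce.

Section KernelConfiguration.
Variables (K : fieldType) (C : kconf K).

(** Of the equality of kernels only the inclusion that can fail is kept. *)
Definition cendo_lin (V : lmodType K) (th : {linear V -> V}) : Prop :=
  match kd C with
  | Some _ =>
      forall s : seq {poly K}, uniq s -> (forall f, f \in s -> mirr f) ->
        (forall f, mirr f -> cnum C f <> 0%N -> f \in s) ->
        forall v, act th (\prod_(f <- s) f ^+ cnum C f) v = 0
  | None =>
      forall f q, mirr f -> kc C f = Some q ->
        forall v, act th (f ^+ q.+1) v = 0 -> act th (f ^+ q) v = 0
  end.

Hypothesis HC : is_kconf C.

(** The last clause rests on [d] being nonzero; it supplies the order of the generators that fill
    the complement in the algebraic case. *)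
Lemma mipo_support : kd C <> None -> exists s : seq {poly K},
  [/\ uniq s, (forall f, f \in s -> mirr f), (forall f, mirr f -> cnum C f <> 0%N -> f \in s),
      (forall f, mirr f -> kc C f <> None) &
      exists2 f, f \in s & cnum C f <> 0%N].
Proof.
case E: (kd C) => [d|] // _; have [d0 /(_ d E)[kn [s [us ms s0 dE]]]] := HC.
exists s; split=> //.
  move=> f mf cf; apply: contrapT => /negP fs; apply: cf.
  by rewrite /cnum s0.
apply: contrapT => h; apply: d0; rewrite E dE big1_seq // => f /andP[_ fs].
suff -> : cnum C f = 0%N by rewrite muln0.
by apply: contrapT => cf; apply: h; exists f.
Qed.

Lemma mirr_coprime_prod (f : {poly K}) (s : seq {poly K}) (P : pred {poly K}) (c : {poly K} -> nat) :
  mirr f -> (forall g, g \in s -> P g -> mirr g /\ g <> f) ->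
  coprimep f (\prod_(g <- s | P g) g ^+ c g).
Proof.
move=> mf h; rewrite big_seq_cond; elim/big_rec: _ => [|g p /andP[gs Pg] IH].
  exact: coprimep1.
rewrite coprimepMr IH andbT coprimep_expr //.
by have [mg gf] := h g gs Pg; apply: mirr_coprime => // fg; apply: gf.
Qed.

Section Endo.
Variables (V : lmodType K) (th : {linear V -> V}).
Hypothesis Hth : cendo_lin th.

Lemma trivial_submod : submod th (fun v => v = 0).
Proof.
split=> // [u v -> ->|a v ->|v ->]; by rewrite ?addr0 ?scaler0 ?linear0.
Qed.

(* In the algebraic case the minimal polynomial is [f ^+ C(f)] times a factor
   prime to [f]. *)
Lemma mipo_cofactor f c : kd C <> None -> mirr f -> kc C f = Some c ->
  exists2 g, coprimep f g & forall v, act th (f ^+ c * g) v = 0.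
Proof.
move=> alg mf fc; have [s [us ms cs _ _]] := mipo_support alg.
have cf : cnum C f = c by rewrite /cnum fc.
exists (\prod_(g <- s | g != f) g ^+ cnum C g).
  by apply: mirr_coprime_prod => // g gs /eqP gf; split=> //; apply: ms.
have [d kdE] : exists d, kd C = Some d by case: (kd C) alg => // d; exists d.
move=> v; move: Hth; rewrite /cendo_lin kdE => /(_ s us ms cs v).
have [fs|fs] := boolP (f \in s); first by rewrite (bigD1_seq f) //= cf.
have c0 : c = 0%N.
  by apply: contrapT => c0; move/negP: fs; apply; apply: cs => //; rewrite cf.
rewrite c0 expr0 mul1r => h; rewrite -[RHS]h; congr (act th _ v).
rewrite big_seq_cond [RHS]big_seq; apply: eq_bigl => g; case gs: (g \in s) => //=.
by apply: contraNneq fs => <-.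
Qed.

(** In the algebraic case [act th (f ^+ c) v] is killed both by [f] and by a polynomial prime to
    [f]. *)
Lemma kernel_stable f c : mirr f -> kc C f = Some c -> forall v,
  act th (f ^+ c.+1) v = 0 -> act th (f ^+ c) v = 0.
Proof.
move=> mf fc v hv; case E: (kd C) => [d|]; last by move: Hth; rewrite /cendo_lin E => /(_ f c mf fc); apply.
have [|g fg hg] := @mipo_cofactor f c _ mf fc; first by rewrite E.
apply: (act_coprime trivial_submod fg); first by rewrite -actM -exprS.
by rewrite -actM mulrC.
Qed.

Lemma kernel_stable_le f c n : mirr f -> kc C f = Some c -> forall v,
  act th (f ^+ (n + c)) v = 0 -> act th (f ^+ c) v = 0.
Proof.
move=> mf fc; elim: n => // n IH v; rewrite addSn exprSr actM => /IH.
by rewrite -actM -exprSr; apply: kernel_stable.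
Qed.

Definition image_complete_lin : Prop := forall f c, mirr f -> kc C f = Some c ->
  forall v, exists v', act th (f ^+ c) v = act th (f ^+ c.+1) v'.

(** With [a * f + b * g = 1] for the cofactor [g], the preimage is [act th a v], because
    [f ^+ c * g] acts as zero. *)
Lemma image_complete_algebraic : kd C <> None -> image_complete_lin.
Proof.
move=> alg f c mf fc v; have [g /Bezout_eq1_coprimepP[[a b] /= ab] hg] := mipo_cofactor alg mf fc.
exists (act th a v); rewrite -{1}[v](act1 th) -ab actD [f ^+ c.+1]exprS.
rewrite linearD /= -!actM -[RHS]addr0; congr (_ + _).
  by congr (act th _ v); rewrite mulrCA mulrC [f ^+ c * f]mulrC.
by rewrite mulrCA actM hg linear0.
Qed.

Lemma image_complete_le f c n : image_complete_lin -> mirr f -> kc C f = Some c ->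
  forall v, exists v', act th (f ^+ c) v = act th (f ^+ (n + c)) v'.
Proof.
move=> ic mf fc; elim: n => [|n IH] v; first by exists v.
have [v' vE] := IH v; have [v2 v2E] := ic f c mf fc v'.
by exists v2; rewrite vE exprD actM v2E -actM -exprD addnS.
Qed.

End Endo.

(* In a finite module every [th]-orbit is eventually periodic. *)
Lemma image_complete_finite (V : lmodType K) (th : {linear V -> V}) (l : seq V) :
  cendo_lin th -> (forall v, v \in l) -> image_complete_lin th.
Proof.
move=> Hth hl f c mf fc v.
pose g i := act th (f ^+ i) v.
have [i [j [ij gij]]] : exists i j, (i < j)%N /\ g i = g j.
  pose s := [seq g i | i <- iota 0 (size l).+1].
  have : ~~ uniq s.
    apply/negP => us; have := uniq_leq_size us (fun v _ => hl v).
    by rewrite size_map size_iota ltnn.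
  move=> /(uniqPn 0)[i [j [ij js]]]; rewrite /s size_map size_iota in js.
  rewrite !(nth_map 0%N) ?size_iota ?(ltn_trans ij) // !nth_iota ?(ltn_trans ij) // => gij.
  by exists i, j.
exists (act th (f ^+ (j - i).-1) v); rewrite -actM -exprD addSn -addnS prednK ?subn_gt0 //.
(* Kernel stability lowers the exponent [i + c] to [c], so f^c v equals f^(c+j-i) v. *)
have h : act th (f ^+ (i + c)) (v - act th (f ^+ (j - i)) v) = 0.
  rewrite linearB /= -actM -exprD addnAC subnKC ?(ltnW ij) //.
  by rewrite ![(_ + c)%N]addnC !exprD !actM -/(g i) gij subrr.
have := kernel_stable_le Hth mf fc h; rewrite linearB /= => /subr0_eq ->.
by rewrite -actM -exprD.
Qed.

End KernelConfiguration.

(** * Sequence systems *)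

Definition image_of (V0 V : Type) (iota : V0 -> V) (v : V) : Prop := exists v0, v = iota v0.

Section Extensions.
Variables (K : fieldType) (C : kconf K) (V0 V : lmodType K) (iota : {linear V0 -> V}).
Variables (th0 : {linear V0 -> V0}).
Hypothesis HC : is_kconf C.
Hypothesis iota_inj : injective iota.
Local Notation U := (image_of iota).

Section Equivariant.
Variable th : {linear V -> V}.
Hypothesis thE : forall v, th (iota v) = iota (th0 v).

Lemma act_image p v : act th p (iota v) = iota (act th0 p v).
Proof.
rewrite /act linear_sum; apply: eq_bigr => i _; rewrite linearZ; congr (_ *: _).
by elim: (nat_of_ord i) => //= n ->.
Qed.

Lemma image_submod : submod th U.
Proof.
split; first by exists 0; rewrite linear0.
- by move=> u v [u0 ->] [v0 ->]; exists (u0 + v0); rewrite linearD.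
- by move=> a v [v0 ->]; exists (a *: v0); rewrite linearZ.
- by move=> v [v0 ->]; exists (th0 v0).
Qed.

End Equivariant.

Section Seqsys.
Variables (m n r : nat) (xi : 'I_n -> {poly K}) (Pc : 'I_n -> 'I_m -> {poly K}).
Variables (uld : 'I_n -> V0) (fk : 'I_r -> {poly K}) (qk : 'I_r -> nat) (uke : 'I_r -> V0).

Definition seqsys_order (k : vidx m n r) : {poly K} :=
  match k with
  | inl (inl _) => 0
  | inl (inr k) => xi k
  | inr k => fk k ^+ qk k
  end.

Definition seqsys_lin (th : {linear V0 -> V0}) : Prop :=
  [/\ algebraic C -> m = 0%N /\ n = 0%N,
      (forall k, [/\ xi k \is monic, (0 < polydeg (xi k))%N &
                     forall g, mirr g -> g %| xi k -> kc C g = None])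
    & (forall k, exists e, [/\ mirr (fk k), kc C (fk k) = Some e, (0 < e)%N,
                    (0 < qk k <= e)%N
                  & act th (fk k ^+ (e - qk k)) (uke k) = 0])].

Definition sat_seqsys_lin (th : {linear V -> V}) (x : vidx m n r -> V) : Prop :=
  (forall k : 'I_n, act th (xi k) (x (ld _ _ k)) =
     \sum_(l <- enum 'I_m) act th (Pc k l) (x (li _ _ l)) + iota (uld k)) /\
  (forall k : 'I_r, act th (fk k ^+ qk k) (x (ke _ _ k)) = iota (uke k)).

Hypothesis HS : seqsys_lin th0.

Lemma size_polydeg (p : {poly K}) : (0 < polydeg p)%N = (1 < size p)%N.
Proof. by rewrite /polydeg; case: (size p) => [|[]]. Qed.

Lemma seqsys_orderP k : ord_poly (seqsys_order k).
Proof.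
have [_ hld hke] := HS; case: k => [[l|k]|k] /=; first by left.
  by right; have [mx dx _] := hld k; rewrite -size_polydeg.
right; have [e [mf _ _ /andP[q0 _] _]] := hke k.
split; first by apply: monic_exp; case: mf.
apply: leq_trans (mirr_size mf) _; apply: dvdp_leq; first by rewrite expf_neq0 ?mirr_neq0.
by rewrite -[X in X %| _]expr1 dvdp_exp2l.
Qed.

Let rhs (k l : vidx m n r) : {poly K} :=
  match k, l with inl (inr k), inl (inl l) => Pc k l | _, _ => 0 end.

Let free : seq (vidx m n r) := [seq li n r l | l <- enum 'I_m].

Let u1 (k : vidx m n r) : V0 :=
  match k with inl (inl _) => 0 | inl (inr k) => uld k | inr k => uke k end.

Let sum_free th k (x : vidx m n r -> V) :
  \sum_(l <- free) act th (rhs k l) (x l) =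
  match k with
  | inl (inr k) => \sum_(l <- enum 'I_m) act th (Pc k l) (x (li _ _ l))
  | _ => 0
  end.
Proof.
rewrite /free big_map; case: k => [[l|k]|k] //=;
  by rewrite big1 // => l' _; rewrite act0.
Qed.

(** In the algebraic case MiPo(C) kills every generator. In the transcendental case a vector killed
    by f^(C(f)+1) is, by [kernel_reduce], a base vector plus multiples of generators whose order is
    a power of [f]. Those are killed by f^C(f), and the base is a C-endomorphism already. *)
Lemma extend_seqsys (y : (vidx m n r * nat) + nat -> V) :
  cendo_lin C th0 -> indep U predT y ->
  exists (th : {linear V -> V}) (x : vidx m n r -> V),
  [/\ forall v, th (iota v) = iota (th0 v), cendo_lin C th,
      forall k i, bnd seqsys_order (k, i) -> iter i th (x k) = y (inl (k, i)) &
      sat_seqsys_lin th x].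
Proof.
move=> Hth0 ind_y; have [halg hld hke] := HS.
(* The order of the generators of the complement: 0 if C is transcendental, otherwise an irreducible
   factor of MiPo(C). *)
have [o2 [o2P o2E]] : exists o2 : {poly K}, ord_poly o2 /\
    (kd C = None -> o2 = 0) /\
    (kd C <> None -> mirr o2 /\ cnum C o2 <> 0%N).
  case E: (kd C) => [d|]; last by exists 0; split; [left|].
  have [|s [_ ms _ _ [f fs cf]]] := mipo_support HC; first by rewrite E.
  exists f; split; last by split=> // _; split=> //; apply: ms.
  by right; have mf := ms f fs; split; [case: mf|apply: mirr_size].
have ofl l : l \in free -> seqsys_order l = 0 by move=> /mapP[l' _ ->].
have [I2 [x [th [thE itE ind gen [relE x2E]]]]] :=
  extend_endomorphism th0 iota_inj u1 rhs seqsys_orderP o2P ofl ind_y.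
have HU := image_submod thE.
have relx k : seqsys_order k != 0 -> act th (seqsys_order k) (x (inl k)) =
    iota (u1 k) + match k with
      | inl (inr k) => \sum_(l <- enum 'I_m) act th (Pc k l) (x (inl (li _ _ l)))
      | _ => 0 end.
  by move=> ok; rewrite relE // (sum_free th k (fun k => x (inl k))).
have ke_eq (k : 'I_r) : act th (fk k ^+ qk k) (x (inl (ke _ _ k))) = iota (uke k).
  have [e [mf _ _ _ _]] := hke k.
  by rewrite (relx (ke m n k)) /= ?addr0 // expf_neq0 // mirr_neq0.
(* Split f^e as f^(e-q) f^q; the right-hand side of the equation lies in the kernel of f^(e-q). *)
have ke_kill (k : 'I_r) e : kc C (fk k) = Some e -> act th (fk k ^+ e) (x (inl (ke _ _ k))) = 0.
  move=> fe; have [e' [mf fe' _ /andP[_ qe] uk]] := hke k.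
  move: fe'; rewrite fe => -[ee']; rewrite -ee' in qe uk.
  by rewrite -(subnK qe) exprD actM ke_eq (act_image thE) uk linear0.
exists th, (fun k => x (inl k)); split=> //; last first.
  split=> // k; have [mx _ _] := hld k.
  by rewrite (relx (ld m r k)) /= ?monic_neq0 // addrC.
case kdE: (kd C) => [d|]; rewrite /cendo_lin kdE.
  have [|mo2 co2] := o2E.2; first by rewrite kdE.
  have [|m0 n0] := halg; first by rewrite /algebraic kdE.
  move=> s us ms cs v.
  have dvd_mipo f : f \in s -> f ^+ cnum C f %| \prod_(g <- s) g ^+ cnum C g.
    by move=> fs; rewrite (bigD1_seq f) //= dvdp_mulr.
  have [ks [rr [uks red [v0 v0E]]]] := polynomial_span (gen v).
  have -> : v = iota v0 + \sum_(k <- ks) act th (rr k) (x k) by rewrite -v0E subrK.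
  rewrite linearD /= (act_image thE).
  move: (Hth0); rewrite /cendo_lin kdE => ->//; rewrite linear0 add0r.
  rewrite linear_sum big1 // => k _ /=; rewrite act_mulC.
  suff -> : act th (\prod_(f <- s) f ^+ cnum C f) (x k) = 0 by rewrite linear0.
  case: k => [[[l|k]|k]|k].
  - by have m1 : (0 < m)%N := leq_ltn_trans (leq0n l) (ltn_ord l); rewrite m0 in m1.
  - by have n1 : (0 < n)%N := leq_ltn_trans (leq0n k) (ltn_ord k); rewrite n0 in n1.
  - have [e [mf fe e0 _ _]] := hke k.
    have ce : cnum C (fk k) = e by rewrite /cnum fe.
    apply: (act_eq0_dvd (p := fk k ^+ e)); last exact: ke_kill.
    by rewrite -ce; apply: dvd_mipo; apply: cs => //; rewrite ce; case: (e) e0.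
  - apply: (act_eq0_dvd (p := o2)) (x2E k).
    apply: dvdp_trans (dvd_mipo o2 (cs _ mo2 co2)).
    by rewrite -[X in X %| _]expr1 dvdp_exp2l // lt0n; apply/eqP.
have o20 := o2E.1 kdE.
move=> f c mf fc v hv.
pose P' (k l : vidx m n r + I2) : {poly K} :=
  match k, l with inl k, inl l => rhs k l | _, _ => 0 end.
pose fl' : seq (vidx m n r + I2) := [seq inl l | l <- free].
have ufl' : uniq fl'.
  rewrite map_inj_uniq; last by move=> a b [].
  by rewrite map_inj_uniq ?enum_uniq // => a b [].
pose o' (k : vidx m n r + I2) := match k with inl k1 => seqsys_order k1 | inr _ => o2 end.
have ofl' l : l \in fl' -> o' l = 0 by move=> /mapP[l' l'f ->]; apply: ofl.
have rel' k : o' k != 0 ->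
    U (act th (o' k) (x k) - \sum_(l <- fl') act th (P' k l) (x l)).
  case: k => [k|k] /= ok0; last by rewrite o20 eqxx in ok0.
  by rewrite /fl' big_map relE // addrK; exists (u1 k).
have fp0 : f ^+ c.+1 != 0 by rewrite expf_neq0 // mirr_neq0.
(* Only the equations for the [ld] variables involve free generators, and [f] does not divide their
   orders because C(f) is finite. *)
have cop k : o' k != 0 -> coprimep (f ^+ c.+1) (o' k) \/ forall l, P' k l = 0.
  case: k => [[[l|k]|k]|k] /= ok0; try by right => -[[[l'|l']|l']|l'].
  left; apply: coprimep_expl; case: (mirr_dvd_or_coprime (xi k) mf) => // fxi.
  by have [_ _ /(_ f mf fxi)] := hld k; rewrite fc.
have Uv : U (act th (f ^+ c.+1) v) by rewrite hv; exists 0; rewrite linear0.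
have [ks [rr [u [[v0 ->] uks red vE nz]]]] :=
  kernel_reduce HU ind gen ufl' ofl' rel' fp0 cop Uv.
have kill k : k \in ks -> act th (f ^+ c) (act th (rr k) (x k)) = 0.
  move=> kks; have [->|/(nz k kks)[ok0]] := eqVneq (rr k) 0; first by rewrite act0 linear0.
  case: k kks ok0 => [[[l|k]|k]|k] kks /= ok0; rewrite ?eqxx ?o20 ?eqxx // in ok0 *.
    case: (cop (inl (ld _ _ k)) ok0) => [->//|] _.
    by case: (mirr_dvd_or_coprime (xi k) mf) => [fxi|/(coprimep_expl c.+1) ->//];
      have [_ _ /(_ f mf fxi)] := hld k; rewrite fc.
  move=> ncop; have [e [mfk fke _ _ _]] := hke k.
  have ffk : f = fk k.
    apply: contrapT => nf; case/negP: ncop; apply: coprimep_expl; apply: coprimep_expr.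
    exact: mirr_coprime.
  rewrite act_mulC; move: (fc); rewrite ffk => /ke_kill ->; exact: linear0.
have sum_kill : act th (f ^+ c) (\sum_(k <- ks) act th (rr k) (x k)) = 0.
  by rewrite linear_sum big1_seq // => k /andP[_ kks]; apply: kill.
have sum_kill' : act th (f ^+ c.+1) (\sum_(k <- ks) act th (rr k) (x k)) = 0.
  by rewrite exprS actM sum_kill linear0.
move: hv; rewrite vE !linearD /= sum_kill sum_kill' !addr0 !(act_image thE).
by rewrite -(linear0 iota) => /iota_inj hv; rewrite (kernel_stable HC Hth0 mf fc hv).
Qed.

End Seqsys.

(** A vector killed by g^(d+1) has the form v0 + r[theta](x) with deg r < deg f, and r = 0 unless g
    = f. If r is nonzero, then f^c (f v0 + r z) = 0 in the base, and a f + b r = 1 turns this into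
    f^c z = f^(c+1) (a z - b v0), which the hypothesis on [z] excludes. *)
Lemma extend_image (f : {poly K}) c (z : V0) (y : (unit * nat) + nat -> V) :
  kd C = None -> mirr f -> kc C f = Some c ->
  (forall z', act th0 (f ^+ c) z <> act th0 (f ^+ c.+1) z') ->
  cendo_lin C th0 -> indep U predT y ->
  exists (th : {linear V -> V}) (x : V),
  [/\ forall v, th (iota v) = iota (th0 v), cendo_lin C th & act th f x = iota z].
Proof.
move=> kdN mf fc nz Hth0 ind_y.
have fP (k : unit) : ord_poly f by right; split; [case: mf|apply: mirr_size].
have zP : ord_poly (0 : {poly K}) by left.
have [I2 [x [th [thE itE ind gen [relE _]]]]] :=
  extend_endomorphism th0 iota_inj (fun _ : unit => z) (fl := [::]) (fun _ _ => 0) fP zP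
    (fun _ => ltac:(by [])) ind_y.
have HU := image_submod thE.
have fx : act th f (x (inl tt)) = iota z.
  by rewrite relE ?mirr_neq0 // big_nil addr0.
exists th, (x (inl tt)); split=> //.
rewrite /cendo_lin kdN => g d mg gd v hv.
pose o' (k : unit + I2) : {poly K} := match k with inl _ => f | inr _ => 0 end.
have rel' k : o' k != 0 -> U (act th (o' k) (x k) - \sum_(l <- [::]) act th 0 (x l)).
  by case: k => [[]|k] /= ok0; rewrite ?eqxx // in ok0 *; rewrite big_nil subr0 fx; exists z.
have gp0 : g ^+ d.+1 != 0 by rewrite expf_neq0 // mirr_neq0.
have cop' k : o' k != 0 -> coprimep (g ^+ d.+1) (o' k) \/ forall l : unit + I2, (0 : {poly K}) = 0.
  by right.
have Uv : U (act th (g ^+ d.+1) v) by rewrite hv; exists 0; rewrite linear0.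
have ofl' l : l \in [::] -> o' l = 0 by [].
have [ks [rr [u [[v0 ->] uks red vE nzr]]]] :=
  kernel_reduce HU ind gen (fl := [::]) (P := fun _ _ => 0) isT ofl' rel' gp0 cop' Uv.
have [r vr red_r] : exists2 r : {poly K}, v = iota v0 + act th r (x (inl tt)) &
    r = 0 \/ [/\ (size r < size f)%N, r != 0 & g = f].
  have rr2 k : inr k \in ks -> rr (inr k) = 0.
    move=> kks; apply: contrapT => /eqP /(nzr _ kks)[]; by rewrite /= eqxx.
  have [tks|tks] := boolP (inl tt \in ks).
    exists (rr (inl tt)).
      rewrite vE (bigD1_seq (inl tt)) //= big1_seq ?addr0 // => -[[]|k] /andP[// _ kks].
      by rewrite rr2 // act0.
    have [->|r0] := eqVneq (rr (inl tt)) 0; [by left|right].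
    have [_ ncop] := nzr _ tks r0; split=> //.
      by have := red (inl tt); rewrite /reduced /= (negbTE (mirr_neq0 mf)).
    apply: contrapT => gf; case/negP: ncop; apply: coprimep_expl.
    exact: mirr_coprime.
  exists 0; last by left.
  rewrite act0 vE big1_seq // => -[[]|k] /andP[_ kks]; first by rewrite kks in tks.
  by rewrite rr2 // act0.
case: red_r => [r0|[szr r0 gf]].
  move: hv; rewrite vr r0 act0 addr0 !(act_image thE) -(linear0 iota) => /iota_inj hv.
  by rewrite (kernel_stable HC Hth0 mg gd hv).
exfalso; move: gd hv; rewrite gf fc => -[<-] hv.
have cop : coprimep f r.
  case: (mirr_dvd_or_coprime r mf) => // /dvdp_leq - /(_ r0).
  by rewrite leqNgt szr.
have eq0 : act th0 (f ^+ c) (act th0 f v0 + act th0 r z) = 0.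
  apply: iota_inj; rewrite linear0 -(act_image thE) linearD /= -!(act_image thE) -fx.
  by rewrite [act th r _]act_mulC -linearD -actM -exprSr -vr.
have /Bezout_eq1_coprimepP [[a b] /= ab] := cop.
have := congr1 (act th0 b) eq0.
rewrite linear0 linearD /= linearD /= -!actM => eq1.
apply: (nz (act th0 a z - act th0 b v0)).
rewrite -[z in LHS](act1 th0) -ab actD linearD linearB /= -!actM.
have -> : act th0 (f ^+ c * (b * r)) z = - act th0 (f ^+ c.+1 * b) v0.
  apply/eqP; rewrite -addr_eq0 addrC -[eqbRHS]eq1; apply/eqP; congr (_ + _).
    by congr (act th0 _ _); rewrite exprSr mulrC mulrA.
  by congr (act th0 _ _); rewrite mulrCA mulrA.
congr (_ - _); congr (act th0 _ _).
by rewrite exprSr -mulrA [f * a]mulrC.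
Qed.

End Extensions.

(** * Sequence systems attached to finite tuples of an extension *)

Definition seqsys_rhs (V0 : nmodType) m n r (uld : 'I_n -> V0) (uke : 'I_r -> V0)
    (k : vidx m n r) : V0 :=
  match k with inl (inl _) => 0 | inl (inr k) => uld k | inr k => uke k end.

Section ExtractSystem.
Variables (K : fieldType) (C : kconf K) (V0 V : lmodType K) (iota : {linear V0 -> V}).
Variables (th0 : {linear V0 -> V0}) (th : {linear V -> V}).
Hypothesis HC : is_kconf C.
Hypothesis iota_inj : injective iota.
Hypothesis thE : forall v, th (iota v) = iota (th0 v).
Local Notation U := (image_of iota).

(** Division by the orders gives a combination of generators its normal form, at the cost of a
    vector of the base. *)
Lemma seqsys_reduce m n r (xi : 'I_n -> {poly K}) uld fk qk uke (x : vidx m n r -> V) p :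
  sat_seqsys_lin iota xi (fun _ _ => 0) uld fk qk uke th x ->
  \sum_k act th (p k) (x k) =
    iota (\sum_k act th0 (p k %/ seqsys_order xi fk qk k) (seqsys_rhs uld uke k)) +
    \sum_k act th (p k %% seqsys_order xi fk qk k) (x k).
Proof.
move=> [hld hke]; rewrite linear_sum -big_split; apply: eq_bigr => k _.
rewrite -(act_image thE) {1}(divp_eq (p k) (seqsys_order xi fk qk k)) actD actM.
congr (act th _ _ + _); case: k => [[l|k]|k] /=; first by rewrite act0 linear0.
  by have := hld k; rewrite big1 ?add0r // => l _; rewrite act0.
exact: hke.
Qed.

Hypothesis Hth : cendo_lin C th.
Hypothesis ic : image_complete_lin C th0.

(* Generators may be translated by the base module; the translate is chosen to
   be killed by [f ^+ C(f)], which is possible by image completeness. *)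
Lemma good_translate (x : V) f q c : mirr f -> kc C f = Some c ->
  U (act th (f ^+ q) x) -> exists v0, act th (f ^+ c) (x - iota v0) = 0.
Proof.
move=> mf fc [v vE]; have [v' v'E] := image_complete_le q ic mf fc v.
exists v'; apply: (kernel_stable_le HC Hth mf fc (n := q)).
rewrite linearB /= (act_image thE) -v'E addnC exprD actM vE (act_image thE).
exact: subrr.
Qed.

(** The orders of a cyclic decomposition sort the generators: order 0 gives [li], a power of f with
    C(f) infinite gives [ld], with C(f) finite [ke]. The coupling polynomials are 0 since the sum is
    direct modulo the base. Condition (iii) on the [ke] part is met by the translates of
    [good_translate]. *)
Lemma seqsys_of_tuple N (w : 'I_N -> V) :
  exists m n r (xi : 'I_n -> {poly K}) uld fk qk uke (x : vidx m n r -> V),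
  [/\ seqsys_lin C m xi fk qk uke th0,
      sat_seqsys_lin iota xi (fun _ _ => 0) uld fk qk uke th x,
      indep U (bnd (seqsys_order xi fk qk)) (fun z : vidx m n r * nat => iter z.2 th (x z.1)) &
      forall j, exists v0 p, w j = iota v0 + \sum_k act th (p k) (x k)].
Proof.
have HU := image_submod thE.
have [M [x0 [o [Uo0 dvd0 go sp]]]] := module_decomposition HU w.
have /choice[a aP] : forall i, exists a : V0, forall f q c, mirr f -> (0 < q)%N -> o i = f ^+ q ->
    kc C f = Some c -> act th (f ^+ c) (x0 i - iota a) = 0.
  move=> i; case: (pselect (exists f q c, [/\ mirr f, (0 < q)%N, o i = f ^+ q & kc C f = Some c])).
    move=> [f [q [c [mf q0 oE fc]]]]; have := Uo0 i; rewrite oE => /(good_translate mf fc)[a ha].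
    exists a => f' q' c' mf' q0' oE' fc'.
    have ff' : f = f'.
      apply: contrapT => nff; have : coprimep f (f ^+ q).
        by rewrite oE'; apply: coprimep_expr; apply: mirr_coprime.
      rewrite -(prednK q0) exprS coprimepMr => /andP[]; rewrite coprimepp => /eqP s1.
      by have := mirr_size mf; rewrite s1.
    by rewrite -ff' fc in fc'; case: fc' => <-; rewrite -ff'.
  by move=> h; exists 0 => f q c mf q0 oE fc; case: h; exists f, q, c.
pose x i := x0 i - iota (a i).
have xsum s : \sum_i act th (s i) (x i) = \sum_i act th (s i) (x0 i) -
    iota (\sum_i act th0 (s i) (a i)).
  rewrite linear_sum -sumrB; apply: eq_bigr => i _.
  by rewrite /x linearB /= (act_image thE).
have Ux (s : 'I_M -> {poly K}) : U (\sum_i act th (s i) (x0 i)) <-> U (\sum_i act th (s i) (x i)).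
  have Ui v : U (iota v) by exists v.
  by rewrite xsum; split=> h; [apply: (submodB HU)|apply: (submod_subr HU) h].
have Uo i : U (act th (o i) (x i)).
  by rewrite linearB /= (act_image thE); apply: (submodB HU) => //; eexists.
have dvd s : U (\sum_i act th (s i) (x i)) -> forall i, o i %| s i.
  by move=> /Ux; apply: dvd0.
have delta (z : 'I_M -> V) i p : \sum_j act th (if j == i then p else 0) (z j) = act th p (z i).
  rewrite (bigD1 i) //= eqxx big1 ?addr0 // => j /negbTE ->; exact: act0.
have spx j : exists v0 p, w j = iota v0 + \sum_i act th (p i) (x i).
  have [|p [v0 v0E]] := sp (w j).
    exists (fun i => if i == j then 1 else 0); rewrite (bigD1 j) //= eqxx act1 big1 ?addr0.
      by rewrite subrr; apply: (submod0 HU).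
    by move=> i /negbTE ->; rewrite act0.
  exists (v0 + \sum_i act th0 (p i) (a i)), p.
  by rewrite xsum linearD -v0E addrACA subrK subrr addr0.
(* MiPo(C) is nonzero and kills [x i], so [o i] divides a nonzero polynomial: no [li] and no [ld]
   generators in the algebraic case. *)
have alg_o i : kd C <> None -> o i != 0 /\ forall f, mirr f -> kc C f <> None.
  move=> alg; have [s [us ms cs kn _]] := mipo_support HC alg; split=> //.
  have [d kdE] : exists d, kd C = Some d by case: (kd C) alg => // d; exists d.
  have h : o i %| \prod_(f <- s) f ^+ cnum C f.
    have := dvd (fun j => if j == i then \prod_(f <- s) f ^+ cnum C f else 0).
    rewrite delta.
    move: (Hth); rewrite /cendo_lin kdE => /(_ s us ms cs (x i)) ->.
    by move=> /(_ (submod0 HU) i); rewrite eqxx.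
  apply: contraTneq h => ->; rewrite dvd0p prodf_seq_eq0 -all_predC.
  by apply/allP => f fs /=; rewrite expf_eq0 negb_and (mirr_neq0 (ms f fs)) orbT.
pose isld i := `[< exists f q, [/\ mirr f, (0 < q)%N, o i = f ^+ q & kc C f = None] >].
pose A0 := [set i | o i == 0]%SET.
pose A1 := [set i | (o i != 0) && isld i]%SET.
pose A2 := [set i | (o i != 0) && ~~ isld i]%SET.
pose phi (k : vidx #|A0| #|A1| #|A2|) : 'I_M :=
  match k with inl (inl l) => enum_val l | inl (inr l) => enum_val l | inr l => enum_val l end.
have inA0 (l : 'I_#|A0|) : o (enum_val l) == 0 by have := enum_valP l; rewrite inE.
have inA1 (l : 'I_#|A1|) : (o (enum_val l) != 0) && isld (enum_val l).
  by have := enum_valP l; rewrite inE.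
have inA2 (l : 'I_#|A2|) : (o (enum_val l) != 0) && ~~ isld (enum_val l).
  by have := enum_valP l; rewrite inE.
have phi_inj : injective phi.
  move=> [[l|l]|l] [[l'|l']|l'] /= h; try by rewrite (enum_val_inj h).
  - by have := inA0 l; rewrite h; case/andP: (inA1 l') => /negbTE ->.
  - by have := inA0 l; rewrite h; case/andP: (inA2 l') => /negbTE ->.
  - by have := inA0 l'; rewrite -h; case/andP: (inA1 l) => /negbTE ->.
  - by case/andP: (inA1 l); rewrite h; case/andP: (inA2 l') => _ /negbTE ->.
  - by have := inA0 l'; rewrite -h; case/andP: (inA2 l) => /negbTE ->.
  - by case/andP: (inA1 l'); rewrite -h; case/andP: (inA2 l) => _ /negbTE ->.
have phi_surj i : exists k, phi k = i.
  have [i0|i0] := boolP (i \in A0).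
    by exists (inl (inl (enum_rank_in i0 i))); rewrite /= enum_rankK_in.
  have [i1|i1] := boolP (i \in A1).
    by exists (inl (inr (enum_rank_in i1 i))); rewrite /= enum_rankK_in.
  have i2 : i \in A2.
    by move: i0 i1; rewrite !inE => i0; rewrite i0 /= => ->.
  by exists (inr (enum_rank_in i2 i)); rewrite /= enum_rankK_in.
have /choice[psi psiK] := phi_surj.
have phi_bij : bijective phi.
  by exists psi => // k; apply: phi_inj; rewrite psiK.
have reix (F : 'I_M -> V) : \sum_i F i = \sum_k F (phi k).
  by rewrite (reindex phi) //; apply: onW_bij.
have /choice[u uE] : forall i, exists u, act th (o i) (x i) = iota u by [].
have /choice[fq fqP] : forall i, exists fq : {poly K} * nat, o i != 0 ->
    [/\ mirr fq.1, (0 < fq.2)%N & o i = fq.1 ^+ fq.2].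
  move=> i; case: (go i) => [->|[f [q h]]]; last by exists (f, q).
  by exists (0, 0%N); rewrite eqxx.
pose fk (l : 'I_#|A2|) := (fq (enum_val l)).1.
pose qk (l : 'I_#|A2|) := (fq (enum_val l)).2.
pose xi (l : 'I_#|A1|) := o (enum_val l).
have fkP l : [/\ mirr (fk l), (0 < qk l)%N & o (enum_val l) = fk l ^+ qk l].
  by apply: fqP; case/andP: (inA2 l).
exists #|A0|, #|A1|, #|A2|, xi, (fun l => u (enum_val l)), fk, qk, (fun l => u (enum_val l)).
exists (fun k => x (phi k)).
have ordE k : seqsys_order xi fk qk k = o (phi k).
  by case: k => [[l|l]|l] //=; [apply/esym/eqP/inA0|have [_ _ ->] := fkP l].
split.
- split.
  + move=> alg; split.
      apply: eq_card0 => i; rewrite inE; apply/negbTE.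
      by have [] := alg_o i alg.
    apply: eq_card0 => i; rewrite inE; apply/negbTE/negP => /andP[_ /asboolP[f [q [mf _ _ fN]]]].
    by have [_ /(_ f mf)] := alg_o i alg.
  + move=> l; case/andP: (inA1 l) => _ /asboolP[f [q [mf q0 oE fN]]].
    rewrite /xi oE; split; first by apply: monic_exp; case: mf.
      rewrite size_polydeg; apply: leq_trans (mirr_size mf) _.
      apply: dvdp_leq; first by rewrite expf_neq0 ?mirr_neq0.
      by rewrite -[X in X %| _]expr1 dvdp_exp2l.
    move=> g mg gf; suff -> : g = f by [].
    apply: contrapT => ngf; have : coprimep g (f ^+ q) by apply: coprimep_expr; apply: mirr_coprime.
    move=> /(coprimep_dvdl gf); rewrite coprimepp => /eqP s1.
    by have := mirr_size mg; rewrite s1.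
  + move=> l; have [mf q0 oE] := fkP l; case/andP: (inA2 l) => o0 nld.
    case fE: (kc C (fk l)) => [e|]; last first.
      by case/asboolP: nld; exists (fk l), (qk l).
    exists e.
    have kill : act th (fk l ^+ e) (x (enum_val l)) = 0 by apply: aP mf q0 oE fE.
    (* The translated generator is killed by f^e, hence its order f^q divides f^e; this bounds q by
       e, and then f^(e-q) kills the right-hand side. *)
    have dv : fk l ^+ qk l %| fk l ^+ e.
      rewrite -oE; have := dvd (fun i => if i == enum_val l then fk l ^+ e else 0).
      by rewrite delta kill => /(_ (submod0 HU) (enum_val l)); rewrite eqxx.
    have qe : (qk l <= e)%N by move: dv; rewrite dvdp_Pexp2l // mirr_size.
    split=> //; first exact: leq_trans qe.
      by rewrite q0.
    apply: iota_inj; rewrite -(act_image thE) -uE oE -actM -exprD subnK // kill.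
    by rewrite linear0.
- split=> l; last by have [_ _ <-] := fkP l.
  by rewrite /= -uE big1 ?add0r // => l' _; rewrite act0.
- move=> l Bl; rewrite (@comb_coefpoly _ _ th _ (fun k => x (phi k)) l _ (index_enum_uniq _)); last first.
    by apply/allP => z _; apply: mem_index_enum.
  move=> Ul [k i]; rewrite -coefpolyE.
  suff -> : coefpoly l k = 0 by rewrite coef0.
  have := coefpoly_reduced k Bl; rewrite /reduced ordE.
  have : o (phi k) %| coefpoly l k.
    have := dvd (fun i => coefpoly l (psi i)); rewrite reix.
    under eq_bigr => k' _ do rewrite (phi_inj _ _ (psiK (phi k'))).
    by move=> /(_ Ul (phi k)); rewrite (phi_inj _ _ (psiK (phi k))).
  case: (eqVneq (o (phi k)) 0) => [->|o0]; first by rewrite dvd0p => /eqP.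
  move=> h /= sz; apply: contraTeq sz => r0; rewrite -leqNgt; exact: dvdp_leq.
- move=> j; have [v0 [p ->]] := spx j; exists v0, (fun k => p (phi k)).
  by rewrite reix.
Qed.

End ExtractSystem.

(** * Transfer between models *)

Section Avoidance.
Variables (K : fieldType) (V : lmodType K) (A : eqType).
Hypothesis Vinf : forall l : seq V, exists v, v \notin l.

Lemma comb_update (y : A -> V) a v l :
  comb (fun b => if b == a then v else y b) l =
  comb (fun b => if b == a then 0 else y b) l + coef l a *: v.
Proof.
rewrite /comb /coef scaler_suml [X in _ + X]big_mkcond -big_split; apply: eq_bigr => x _ /=.
by case: eqP => _; rewrite ?scaler0 ?add0r ?addr0.
Qed.

(** Values outside [S] are chosen one at a time. A dependency with a nonzero coefficient at the
    current index excludes a single value there, and infinitely many are available; dependencies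
    supported in [S] have to fail from the start. *)
Lemma avoid_dependencies (s : seq A) (cs : seq (seq (K * A) * V)) :
  forall (S : pred A) (y : A -> V),
  (forall c a, c \in cs -> coef c.1 a != 0 -> S a || (a \in s)) ->
  (forall c, c \in cs -> (forall a, coef c.1 a != 0 -> S a) -> comb y c.1 <> c.2) ->
  exists2 y' : A -> V, (forall a, S a -> y' a = y a) &
    forall c, c \in cs -> comb y' c.1 <> c.2.
Proof.
elim: s => [|a s IH] S y hs hy.
  exists y => // c ccs; apply: hy => // a ca.
  by have := hs c a ccs ca; rewrite orbF.
have [Sa|Sa] := boolP (S a).
  apply: IH hy => c b ccs cb; have := hs c b ccs cb; rewrite inE.
  by case/or3P=> [->//|/eqP->|->]; rewrite ?Sa ?orbT.
(* The one value at [a] for which [c] would hold, the others being given by [y]. *)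
pose bad c := (coef c.1 a)^-1 *: (c.2 - comb (fun b => if b == a then 0 else y b) c.1).
have [v vbad] := Vinf [seq bad c | c <- cs].
pose y1 b := if b == a then v else y b.
have yE : y = (fun b => if b == a then y a else y b).
  by apply/funext => b; case: eqP => // ->.
have [| |y' y'1 y'2] := IH (fun b => S b || (b == a)) y1.
- move=> c b ccs cb; have := hs c b ccs cb; rewrite inE.
  by case/or3P=> ->; rewrite ?orbT.
- move=> c ccs hc; have [ca0|ca0] := eqVneq (coef c.1 a) 0.
    have <- : comb y c.1 = comb y1 c.1.
      have E v' : comb (fun b => if b == a then v' else y b) c.1 =
          comb (fun b => if b == a then 0 else y b) c.1.
        by rewrite comb_update ca0 scale0r addr0.
      by rewrite /y1 E -(E (y a)) -yE.
    apply: hy => // b cb.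
    by have /orP[//|/eqP ba] := hc b cb; rewrite ba ca0 eqxx in cb.
  rewrite /y1 comb_update => h; case/negP: vbad; apply/mapP; exists c => //.
  by rewrite /bad -h addrC addKr scalerA mulVf // scale1r.
exists y' => // b Sb; rewrite y'1 ?Sb // /y1.
by case: eqP => // ba; rewrite ba (negbTE Sa) in Sb.
Qed.

End Avoidance.

Lemma realization_model (L : lang) (T : formula L void -> Prop) (M : structure L) (A Cond : Type)
    (val : seq Cond -> A -> M) :
  (forall p, T p -> closedf p) -> model T M ->
  exists (N : structure L) (h : M -> N) (g : A -> N) (U : set_system (seq Cond)),
  [/\ ProperFilter U, forall c, U [set s | List.In c s]%classic, model T N, emb h &
      forall (p : formula L (M + A)) e, closedf p ->
        sat (sumf h g) e p <-> U [set s | forall e', sat (sumf id (val s)) e' p]%classic].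
Proof.
move=> clT mM; have [N [h [g [U [PU cU satU]]]]] := realization val.
have triv (P : Prop) : U [set s | P]%classic <-> P.
  split=> [UP|hP]; first by have [s] := filter_ex UP.
  by apply: filterS (@filterT _ U _) => s.
(* A sentence whose truth does not vary with [s] keeps its truth value in [N]; this covers the
   axioms of [T] and the atomic diagram of [M]. *)
have cst (p : formula L (M + A)) (P : Prop) : closedf p ->
    (forall s e, sat (sumf id (val s)) e p <-> P) -> forall e, sat (sumf h g) e p <-> P.
  move=> cp pP e; rewrite satU // -[X in _ <-> X]triv.
  by split; apply: filterS => s /=; [move=> /(_ (fun=> sinh M)) /pP|move=> hP e'; apply/pP].
exists N, h, g, U; split=> //.
  move=> p Tp e; have cp := clT p Tp.
  pose p' : formula L (M + A) := frn 0 (fun v : void => match v with end) p.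
  have cp' : closedf p' by apply: ffv_frn cp.
  have : sat (sumf h g) e p'.
    apply/(cst p' True) => // s e'; split=> // _.
    by rewrite (sat_frn (par' := @noparam M)) //; apply: mM.
  by rewrite (sat_frn (par' := @noparam N)).
split.
- move=> a b hab.
  by apply/(cst (FEq (TPar L (inl a)) (TPar L (inl b))) (a = b) _ _ (fun=> sinh N)).
- move=> f args.
  apply/(cst (FEq (TPar L (inl (sfun args))) (TApp (fun i => TPar L (inl (args i))))) True _ _
    (fun=> sinh N)) => //.
  by apply/andP; split=> //; apply/forallP.
- move=> r args; rewrite (iff_sym (cst (FRel (fun i => TPar L (inl (args i)))) (srel args) _ _ (fun=> sinh N))) //.
  by apply/forallP.
Qed.

Section Embedding.
Variables (L : lang) (K : fieldType) (T : formula L void -> Prop) (D : vsdef L K).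
Hypotheses (mcT : model_complete T) (dT : defines_vs T D).
Variables (M N : structure L) (h : M -> N).
Hypotheses (mM : model T M) (mN : model T N) (eh : emb h).
Local Notation VM := (vtype (model_vspace dT mM)).
Local Notation VN := (vtype (model_vspace dT mN)).

Lemma emb_inV x : inV D x <-> inV D (h x).
Proof. exact: (definable_emb mcT (fun _ : unit => x) (definable_inV dT tt) mM mN eh). Qed.

Lemma emb_vzero : h (vzero D M) = vzero D N.
Proof.
apply/(is0E (model_vspace dT mN)).
apply/(definable_emb mcT (fun _ : unit => vzero D M) (definable_is0 dT tt) mM mN eh).
exact: (vzeroP (model_vspace dT mM)).
Qed.

(** The graph of a linear combination is definable, hence preserved by an embedding of models of a
    model-complete theory. *)
Lemma emb_linear : exists2 iota : {linear VM -> VN},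
  injective iota & forall v, vval (iota v) = h (vval v).
Proof.
pose f (v : VM) : VN := vlift (model_vspace dT mN) (iffLR (emb_inV _) (vvalV v)).
have fE v : vval (f v) = h (vval v) by [].
have f_linear : linear f.
  move=> a u v; apply/esym.
  have : lingraph D [seq (i.1, vval (i.2 : VM)) | i <- [:: (a, u); (1, v)]] (vval (a *: u + v)).
    by apply/lingraphE; rewrite !big_cons big_nil /= addr0 scale1r.
  rewrite -[[seq _ | _ <- _]]/([seq (x.1, vval x.2) | x <- [:: (a, u); (1, v)]]).
  pose par (i : option bool) := if i is Some b then (if b then vval u else vval v) else vval (a *: u + v).
  have e1 := definable_emb mcT par
    (definable_lingraph dT [:: (a, true); (1, false)] (fun b => Some b) None) mM mN eh.
  move=> /e1 /=; rewrite -!fE.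
  move=> /(@lingraphE _ _ _ _ (model_vspace dT mN) _ [:: (a, u); (1, v)] fst (fun x => f x.2) (f (a *: u + v))).
  by rewrite !big_cons big_nil /= addr0 scale1r.
pose FL := GRing.isLinear.Build K VM VN *:%R f f_linear.
pose F : {linear VM -> VN} := HB.pack f FL.
exists F => // u v /(congr1 (@vval _ _ _ _ _)) /= huv.
by case: eh => hinj _ _; apply/vval_inj/hinj.
Qed.

End Embedding.

Section Theta.
Variables (L : lang) (K : fieldType) (T : formula L void -> Prop) (D : vsdef L K) (C : kconf K).
Hypothesis dT : defines_vs T D.
Variables (M : structure L) (mM : model T M).
Local Notation V := (vtype (model_vspace dT mM)).

Lemma theta_linear (th : M -> M) : modelTC T D C th ->
  exists F : {linear V -> V}, forall v, vval (F v) = th (vval v).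
Proof.
case=> _ [thV thD] thZ _ _.
pose f (v : V) : V := vlift (model_vspace dT mM) (thV _ (vvalV v)).
have f_linear : linear f.
  have fE w : vval (f w) = th (vval w) by [].
  move=> a u v; apply: vval_inj; rewrite vvalD vvalZ !fE vvalD thD ?vvalZ ?thZ //;
    rewrite -?vvalZ; exact: vvalV.
pose FL := GRing.isLinear.Build K V V *:%R f f_linear.
pose F : {linear V -> V} := HB.pack f FL.
by exists F.
Qed.

Section Bridge.
Variables (th : M -> M) (F : {linear V -> V}).
Hypothesis FE : forall v, vval (F v) = th (vval v).

Lemma vval_iter i v : vval (iter i F v) = iter i th (vval v).
Proof. by elim: i => //= i <-; rewrite FE. Qed.

Lemma vval_act p v : vval (act F p v) = peval D p th (vval v).
Proof.
rewrite act_iota vval_sum /peval; congr vsum; apply: eq_map => i.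
by rewrite vvalZ vval_iter.
Qed.

Lemma vval_eq0 (v : V) : vval v = vzero D M <-> v = 0.
Proof. by rewrite -(vval0 (model_vspace dT mM)); split=> [/vval_inj|->]. Qed.

Lemma cendoE : cendo D C th <-> cendo_lin C F.
Proof.
rewrite /cendo /cendo_lin; case: (kd C) => [d|].
  split=> h s us ms cs v.
    by apply/vval_eq0; rewrite vval_act; apply: h => //; apply: vvalV.
  move=> Vv; rewrite -[v]/(vval (vlift (model_vspace dT mM) Vv)) -vval_act.
  by apply/vval_eq0; apply: h.
split=> h f q mf fq v.
  move=> /vval_eq0; rewrite vval_act => hv; apply/vval_eq0; rewrite vval_act.
  by apply: (iffRL (h f q mf fq (vval v)) _).2; split=> //; apply: vvalV.
split=> -[Vv]; rewrite -[v]/(vval (vlift (model_vspace dT mM) Vv)) => hv; split=> //.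
  move: hv; rewrite -!vval_act => /vval_eq0 hv; apply/vval_eq0.
  by rewrite exprS actM hv linear0.
by move: hv; rewrite -!vval_act => /vval_eq0 /(h f q mf fq) hv; apply/vval_eq0.
Qed.

Lemma image_completeE : image_complete D C th <-> image_complete_lin C F.
Proof.
split=> h f c mf fc.
  move=> v; have [|w [Vw wE]] := iffLR (h f c mf fc (vval (act F (f ^+ c) v))).
    by exists (vval v); rewrite vval_act; split=> //; apply: vvalV.
  exists (vlift (model_vspace dT mM) Vw); apply: vval_inj.
  by rewrite [RHS]vval_act.
move=> y; split=> -[x [Vx <-]].
  have [v' v'E] := h f c mf fc (vlift (model_vspace dT mM) Vx).
  by exists (vval v'); split; [apply: vvalV|rewrite -vval_act -v'E vval_act].
exists (vval (act F f (vlift (model_vspace dT mM) Vx))); split; first exact: vvalV.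
by rewrite -vval_act -actM -exprSr vval_act.
Qed.

End Bridge.

Lemma theta_of_linear (F : {linear V -> V}) : cendo_lin C F ->
  exists2 th : M -> M, modelTC T D C th & forall v, vval (F v) = th (vval v).
Proof.
move=> CF.
pose th (x : M) : M := if pselect (inV D x) is left Vx
  then vval (F (vlift (model_vspace dT mM) Vx)) else vzero D M.
have thE v : vval (F v) = th (vval v).
  rewrite /th; case: pselect => [Vv|/(_ (vvalV v))//].
  by congr (vval (F _)); apply: vval_inj.
exists th => //; split=> //.
- split=> [x Vx|x y Vx Vy].
    by rewrite -[x]/(vval (vlift (model_vspace dT mM) Vx)) -thE; apply: vvalV.
  rewrite -[x]/(vval (vlift (model_vspace dT mM) Vx)) -[y]/(vval (vlift (model_vspace dT mM) Vy)).
  by rewrite -vvalD -!thE linearD.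
- move=> a x Vx; rewrite -[x]/(vval (vlift (model_vspace dT mM) Vx)).
  by rewrite -vvalZ -!thE linearZ.
- by move=> x nVx; rewrite /th; case: pselect.
- exact/(cendoE thE).
Qed.

End Theta.

Lemma filter_all_seq (X : Type) (U : set_system X) (I : eqType) (l : seq I) (Q : I -> X -> Prop) :
  ProperFilter U -> (forall i, U (Q i)) -> U [set s | forall i, i \in l -> Q i s]%classic.
Proof.
move=> PU UQ; elim: l => [|i l IH]; first by apply: filterS (@filterT _ U _) => s.
apply: filterS2 (UQ i) IH => s qi ql j; rewrite inE => /orP[/eqP->//|]; exact: ql.
Qed.

Lemma realized_definable (L : lang) (T : formula L void -> Prop) (M N : structure L)
    (A X : Type) (val : X -> A -> M) (h : M -> N) (g : A -> N) (U : set_system X)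
    (P : forall N : structure L, (M + A -> N) -> Prop) :
  model T M -> model T N -> ProperFilter U ->
  (forall (p : formula L (M + A)) e, closedf p ->
     sat (sumf h g) e p <-> U [set s | forall e', sat (sumf id (val s)) e' p]%classic) ->
  definable T P -> P N (sumf h g) <-> U [set s | P M (sumf id (val s))]%classic.
Proof.
move=> mM mN PU satU [p cp hp]; rewrite -(hp N mN _ (fun=> sinh N)) satU //.
by split; apply: filterS => s /= h';
  [apply/(hp M mM _ (fun=> sinh M))|move=> e'; apply/(hp M mM)].
Qed.

Section FreeExtension.
Variables (L : lang) (K : fieldType) (T : formula L void -> Prop) (D : vsdef L K).
Hypotheses (clT : forall p, T p -> closedf p) (mcT : model_complete T) (dT : defines_vs T D).
Variables (M : structure L) (mM : model T M).
Local Notation VM := (vtype (model_vspace dT mM)).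

(** Compactness: the conditions are the negations of the nontrivial dependencies over [M]. Finitely
    many of them are compatible with [psi] by hypothesis, and the limit tuple satisfies all. *)
Lemma free_extension (A : eqType) (psi : formula L (M + A)) :
  closedf psi ->
  (forall cs : seq (seq (K * A) * VM),
     (forall c, c \in cs -> exists a, coef c.1 a != 0) ->
     exists2 y : A -> VM, (forall e, sat (sumf id (fun a => vval (y a))) e psi) &
       forall c, c \in cs -> comb y c.1 <> c.2) ->
  exists (N : structure L) (h : M -> N) (mN : model T N)
    (iota : {linear VM -> vtype (model_vspace dT mN)}) (y : A -> vtype (model_vspace dT mN)),
  [/\ emb h, injective iota, forall v, vval (iota v) = h (vval v),
      indep (image_of iota) predT y & forall e, sat (sumf h (fun a => vval (y a))) e psi].
Proof.
move=> cpsi Hfin.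
pose Cond := {c : seq (K * A) * VM | exists a, coef c.1 a != 0}.
have /choice[val valP] : forall s : seq Cond, exists y : A -> VM,
    (forall e, sat (sumf id (fun a => vval (y a))) e psi) /\
    forall c, List.In c s -> comb y (sval c).1 <> (sval c).2.
  move=> s; have [|y y1 y2] := Hfin [seq sval c | c <- s].
    elim: s => //= c' s IH c; rewrite inE => /orP[/eqP ->|/IH//]; exact: (svalP c').
  exists y; split=> // c cs; apply: y2.
  elim: s cs {y1} => //= c' s IH [->|/IH h]; first exact: mem_head.
  by rewrite inE h orbT.
have [N [h [g [U [PU cU mN eh satU]]]]] :=
  realization_model (fun s a => vval (val s a)) clT mM.
have dU (P : forall N : structure L, (M + A -> N) -> Prop) : definable T P ->
    P N (sumf h g) <-> U [set s | P M (sumf id (fun a => vval (val s a)))]%classic.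
  exact: realized_definable.
have Vg a : inV D (g a).
  apply/(dU _ (definable_inV dT (inr a))); apply: filterS (@filterT _ U _) => s _ /=.
  exact: vvalV.
have [iota iota_inj iotaE] := emb_linear mcT dT mM mN eh.
exists N, h, mN, iota, (fun a => vlift (model_vspace dT mN) (Vg a)); split=> //; last first.
  by move=> e; apply/satU => //; apply: filterS (@filterT _ U _) => s _; apply: (valP s).1.
move=> l _ [v lv] a; apply: contrapT => /eqP la.
(* A dependency true in [N] would hold at almost every [val s], in particular at some [s] that
   contains it. *)
pose c : Cond := exist _ (l, v) (ex_intro _ a la).
have gr : lingraph D [seq (x.1, sumf h g (inr x.2)) | x <- l] (sumf h g (inl (vval v))).
  rewrite /= -iotaE.
  exact: (iffRL (lingraphE l fst (fun x : K * A => vlift (model_vspace dT mN) (Vg x.2)) (iota v)) lv).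
have Ugr := iffLR (dU _ (definable_lingraph dT l inr (inl (vval v)))) gr.
have [s [/= cs sgr]] := filter_ex (filterI (cU c) Ugr).
apply: ((valP s).2 c cs) => /=.
exact: (iffLR (lingraphE l fst (fun x : K * A => val s x.2) v) sgr).
Qed.

End FreeExtension.

Section ExistentiallyClosed.
Variables (L : lang) (K : fieldType) (T : formula L void -> Prop) (D : vsdef L K) (C : kconf K).
Hypotheses (clT : forall p, T p -> closedf p) (mcT : model_complete T).
Variables (M : structure L) (th : M -> M).
Hypothesis ecM : ec_model T D C th.

(* [M'] embeds over [M] into an ultrapower of [M]; the embedding is elementary
   for [L] by model completeness, and commutes with [theta] pointwise. *)
Lemma ec_transfer (M' : structure L) (th' : M' -> M') (h : M -> M') :
  emb (M := expand th) (M' := expand th') h -> modelTC T D C th' ->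
  exists (X : Type) (U : set_system X) (val : X -> M' -> M),
  [/\ ProperFilter U, forall m, U [set s | val s (h m) = m]%classic,
      forall x, U [set s | val s (th' x) = th (val s x)]%classic &
      forall A (P : forall N : structure L, (A -> N) -> Prop), definable T P ->
        forall par, P M' par -> U [set s | P M (fun a => val s (par a))]%classic].
Proof.
move=> eh tc'; have [[mM _ _ _ _] ecP] := ecM; have [mM' _ _ _ _] := tc'.
(* The quantifier-free diagram of [M'] over [M], with theta. A finite part of it becomes an
   existential sentence once the elements of [M'] are quantified, and is thus realized in [M]. *)
pose Cond := {p : formula (Ltheta L) (M + M') |
  [/\ closedf p, qf p & forall e, sat (M := expand th') (sumf h id) e p]}.
pose conj (s : seq Cond) : formula (Ltheta L) (M + M') :=
  foldr (fun c q => FAnd (sval c) q) (FNot FFalse) s.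
have cconj s : closedf (conj s).
  by elim: s => //= c s IH; have [cc _ _] := svalP c; apply/andP.
have qconj s : qf (conj s).
  by elim: s => //= c s IH; have [_ qc _] := svalP c; apply/andP.
have sconj s e : sat (M := expand th') (sumf h id) e (conj s).
  by elim: s => [[]|c s IH] //; have [_ _ sc] := svalP c; split.
have conjE s g e c : sat (M := expand th) (sumf id g) e (conj s) -> List.In c s ->
    sat (M := expand th) (sumf id g) e (sval c).
  by elim: s => //= c' s IH [h1 h2] [<-//|]; apply: IH.
have /choice[val valP] : forall s : seq Cond, exists g : M' -> M,
    forall c e, List.In c s -> sat (M := expand th) (sumf id g) e (sval c).
  move=> s; have [q [cq eq sq _]] := exists_params (cconj s).
  have : sat (M := expand th') h (fun=> sinh M') q.
    by apply/(sq (expand th')); exists id; apply: sconj.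
  move=> /(ecP M' th' h eh tc' q cq (eq (qconj s))) /(sq (expand th)) [g gp]; exists g => c e.
  by apply: conjE; apply: (iffLR (sat_closed _ _ _ (cconj s))) gp.
(* The ultrapower is taken in L alone; what concerns theta survives as a property of almost all
   [val s]. *)
have [N [k [g [U [PU cU mN ek satU]]]]] := realization_model val clT mM.
have condU (p : formula (Ltheta L) (M + M')) : closedf p -> qf p ->
    (forall e, sat (M := expand th') (sumf h id) e p) ->
    U [set s | forall e, sat (M := expand th) (sumf id (val s)) e p]%classic.
  move=> cp qp sp; pose c : Cond := exist _ p (And3 cp qp sp).
  by apply: filterS (cU c) => s cs e; apply: (valP s c e cs).
have eg : emb g.
  split.
  - move=> a b gab; apply: contrapT => nab.
    have h1 := iffLR (satU (FEq (TPar L (inr a)) (TPar L (inr b))) (fun=> sinh N) isT) gab.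
    have h2 := condU (FNot (FEq (TPar _ (inr a)) (TPar _ (inr b)))) isT isT (fun _ => nab).
    have [s [/= s1 s2]] := filter_ex (filterI h1 h2).
    exact: (s2 (fun=> sinh M) (s1 (fun=> sinh M))).
  - move=> f args.
    apply: (iffRL (satU (FEq (TPar L (inr (sfun args)))
      (TApp (fun i => TPar L (inr (args i))))) (fun=> sinh N) _)).
      by apply/andP; split=> //; apply/forallP.
    have cl : closedf (FEq (TPar (Ltheta L) (inr (sfun args) : M + M'))
        (@TApp (Ltheta L) _ (Some f) (fun i => TPar _ (inr (args i))))).
      by apply/andP; split=> //; apply/forallP.
    by apply: filterS (condU _ cl isT (fun _ => erefl)) => s.
  - move=> r args.
    have cl : closedf (@FRel (Ltheta L) (M + M') r (fun i => TPar _ (inr (args i)))).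
      by apply/forallP.
    have cl' : closedf (@FRel L (M + M') r (fun i => TPar _ (inr (args i)))).
      by apply/forallP.
    have sE := satU _ (fun=> sinh N) cl'.
    split=> [hr|hr].
      by apply/sE; apply: filterS (condU _ cl isT (fun _ => hr)) => s.
    apply: contrapT => nr.
    have h2 := condU (FNot (@FRel (Ltheta L) (M + M') r (fun i => TPar _ (inr (args i)))))
      cl isT (fun _ => nr).
    have [s [/= s1 s2]] := filter_ex (filterI (iffLR sE hr) h2).
    exact: (s2 (fun=> sinh M) (s1 (fun=> sinh M))).
exists (seq Cond), U, val; split=> //.
- move=> m.
  apply: filterS (condU (FEq (TPar _ (inl m)) (TPar _ (inr (h m)))) isT isT (fun _ => erefl)) => s /=.
  by move=> /(_ (fun=> sinh M)).
- move=> x.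
  have cl : closedf (FEq (TPar (Ltheta L) (inr (th' x) : M + M'))
      (@TApp (Ltheta L) _ None (fun i => TPar _ (inr x)))).
    by apply/andP; split=> //; apply/forallP.
  apply: filterS (condU _ cl isT (fun _ => erefl)) => s /=.
  by move=> /(_ (fun=> sinh M)).
- move=> A P dP par /(definable_emb mcT par dP mM' mN eg) hP.
  have dP' := definable_reindex (fun a => inr (par a) : M + M') dP.
  exact: (iffLR (realized_definable mM mN PU satU dP') hP).
Qed.

End ExistentiallyClosed.

(** * Necessity *)

Definition poly_terms (K : fieldType) (I : Type) (p : {poly K}) (k : I) : seq (K * (I * nat)) :=
  [seq (p`_i, (k, i)) | i <- iota 0 (size p)].

Lemma comb_poly_terms (K : fieldType) (V : lmodType K) (th : {linear V -> V}) (I : eqType)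
    (x : I -> V) p k :
  comb (fun z : I * nat => iter z.2 th (x z.1)) (poly_terms p k) = act th p (x k).
Proof. by rewrite /comb big_map act_iota. Qed.

Section Necessity.
Variables (L : lang) (K : fieldType) (T : formula L void -> Prop) (D : vsdef L K) (C : kconf K).
Hypotheses (clT : forall p, T p -> closedf p) (mcT : model_complete T) (dT : defines_vs T D).
Hypothesis HC : is_kconf C.
Variables (M : structure L) (th : M -> M).
Hypothesis ecM : ec_model T D C th.
Variable (mM : model T M).
Local Notation VM := (vtype (model_vspace dT mM)).
Variable F : {linear VM -> VM}.
Hypothesis FE : forall v, vval (F v) = th (vval v).

(** Only finitely many facts descend at once: [psi], the equations, and membership of the unknowns
    in V, which is why [I] and [eqs] are finite. A single index [s] good for all of them gives the
    solution [val s]. *)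
Lemma ec_solution (N : structure L) (h : M -> N) (mN : model T N)
    (iota : {linear VM -> vtype (model_vspace dT mN)})
    (F' : {linear vtype (model_vspace dT mN) -> vtype (model_vspace dT mN)})
    (I : finType) (x : I -> vtype (model_vspace dT mN)) (psi : formula L (M + I * nat))
    (eqs : seq (seq (K * (I * nat)) * VM)) :
  emb h -> (forall v, vval (iota v) = h (vval v)) ->
  (forall v, F' (iota v) = iota (F v)) -> cendo_lin C F' -> closedf psi ->
  (forall e, sat (sumf h (fun z => vval (iter z.2 F' (x z.1)))) e psi) ->
  (forall q, q \in eqs -> comb (fun z : I * nat => iter z.2 F' (x z.1)) q.1 = iota q.2) ->
  exists x0 : I -> VM,
    (forall e, sat (sumf id (fun z => iter z.2 th (vval (x0 z.1)))) e psi) /\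
    forall q, q \in eqs -> comb (fun z : I * nat => iter z.2 F (x0 z.1)) q.1 = q.2.
Proof.
move=> eh iotaE F'iota CF' cpsi spsi heqs.
have [th' tc' F'E] := theta_of_linear CF'.
have [tcM _] := ecM.
have eh' : emb (M := expand th) (M' := expand th') h.
  have [hinj hf hr] := eh; split=> // -[f|] args /=; first exact: hf.
  (* Outside V both functions are zero, and [h] preserves V in both directions. *)
  have [Vx|nVx] := pselect (inV D (args ord0)).
    rewrite -[args ord0]/(vval (vlift (model_vspace dT mM) Vx)).
    by rewrite -FE -!iotaE -F'E F'iota.
  have [_ _ _ th0 _] := tcM; have [_ _ _ th'0 _] := tc'.
  rewrite th0 // th'0; first exact: (emb_vzero mcT dT mM mN eh).
  by move=> /(emb_inV mcT dT mM mN eh).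
have [X [U [val [PU valh valth valP]]]] := ec_transfer clT mcT ecM eh' tc'.
have iterU z : U [set s | val s (vval (iter z.2 F' (x z.1))) =
    iter z.2 th (val s (vval (x z.1)))]%classic.
  case: z => k i /=; elim: i => [|i IH] /=; first by apply: filterS (@filterT _ U _) => s.
  apply: filterS2 (valth (vval (iter i F' (x k)))) IH => s /=.
  by rewrite F'E => -> ->.
have [l lP] := fpar_occ_fin psi.
pose y (a : {classic (M + I * nat)}) : N :=
  sumf h (fun z => vval (iter z.2 F' (x z.1))) a.
pose y0 s (a : {classic (M + I * nat)}) : M :=
  sumf id (fun z : I * nat => iter z.2 th (val s (vval (x z.1)))) a.
have yU a : U [set s | val s (y a) = y0 s a]%classic.
  by case: a => [m|z]; [apply: valh|apply: iterU].
have U1 := filter_all_seq l PU yU.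
have U2 := valP _ _ (definable_form T (fun N _ => sinh N) cpsi) _ (spsi (fun=> sinh N)).
have U3 : U [set s | forall k : I, inV D (val s (vval (x k)))]%classic.
  apply: filter_forall => k.
  by apply: (valP _ _ (definable_inV dT tt) (fun _ => vval (x k))); apply: vvalV.
have eqU (q : seq (K * (I * nat)) * VM) : U [set s | q \in eqs -> lingraph D
    [seq (z.1, iter z.2.2 th (val s (vval (x z.2.1)))) | z <- q.1] (vval q.2)]%classic.
  have [qe|qe] := boolP (q \in eqs); last by apply: filterS (@filterT _ U _) => s.
  pose par (a : (I * nat) + unit) : N :=
    if a is inl z then vval (iter z.2 F' (x z.1)) else h (vval q.2).
  have gr : lingraph D [seq (z.1, par (inl z.2)) | z <- q.1] (par (inr tt)).
    rewrite /par -iotaE.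
    exact: (iffRL (lingraphE q.1 fst (fun z : K * (I * nat) => iter z.2.2 F' (x z.2.1))
      (iota q.2)) (heqs q qe)).
  have V1 := valP _ _ (definable_lingraph dT q.1 inl (inr tt)) par gr.
  have V2 := filter_all_seq [seq z.2 | z <- q.1] PU iterU.
  apply: filterS3 V1 V2 (valh (vval q.2)) => s /= + h2 h3 _.
  rewrite h3; congr (lingraph D _ _); apply/eq_in_map => z zq.
  by rewrite h2 // map_f.
have U4 := filter_all_seq eqs PU eqU.
have [s [[/= s1 s2] [/= s3 s4]]] := filter_ex (filterI (filterI U1 U2) (filterI U3 U4)).
exists (fun k => vlift (model_vspace dT mM) (s3 k)); split.
  move=> e; apply: (iffLR (sat_eq cpsi (fun _ _ => erefl) _)) (iffLR (sat_closed _ _ e cpsi) s2).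
  by move=> a /lP /s1.
move=> q qe; apply: (iffLR (lingraphE q.1 fst (fun z : K * (I * nat) =>
  iter z.2.2 F (vlift (model_vspace dT mM) (s3 z.2.1))) q.2)).
move: (s4 q qe qe); congr (lingraph D _ _); apply: eq_map => z.
by rewrite (vval_iter FE).
Qed.

(* In the transcendental case, if [f ^+ C(f)] applied to [z] is not in the image
   of [f ^+ C(f).+1], then adjoining a solution of [f x = z] does not enlarge
   the kernel of [f ^+ C(f)]. *)
Lemma ec_image_complete : image_complete D C th.
Proof.
apply/(image_completeE C FE).
have CF : cendo_lin C F by apply/(cendoE C FE); have [[_ _ _ _ ?] _] := ecM.
case kdE: (kd C) => [d|].
  by apply: (image_complete_algebraic HC CF); rewrite kdE.
(* Avoiding dependencies requires V to be infinite; over a finite V no extension is called for. *)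
have [[l hl]|Vinf] := pselect (exists l : seq VM, forall v, v \in l).
  exact: (image_complete_finite HC CF hl).
have {}Vinf : forall l : seq VM, exists v, v \notin l.
  move=> l; apply: contrapT => h; apply: Vinf; exists l => v.
  by apply: contrapT => /negP vl; apply: h; exists v.
move=> f c mf fc z; apply: contrapT => nz.
have {}nz z' : act F (f ^+ c) z <> act F (f ^+ c.+1) z' by move=> e; apply: nz; exists z'.
have [cs hcs|N [h [mN [iota [y [eh iinj iE indy _]]]]]] :=
    @free_extension L K T D clT mcT dT M mM ((unit * nat) + nat)%type (FNot FFalse) isT.
  have [||y _ hy] := @avoid_dependencies K VM _ Vinf
      (flatten [seq [seq x.2 | x <- c.1] | c <- cs]) cs pred0 (fun=> 0); last by exists y => // e [].
    move=> c' a c's /coef_mem[x xc <-]; apply/flatten_mapP; exists c' => //.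
    exact: map_f.
  by move=> c' c's; have [a ca] := hcs c' c's => /(_ a ca).
have [F' [x [F'i CF' fx]]] := extend_image HC iinj kdE mf fc nz CF indy.
have [|x0 [_ hx0]] := @ec_solution N h mN iota F' unit (fun=> x) (FNot FFalse)
    [:: (poly_terms f tt, z)] eh iE F'i CF' isT (fun _ => id).
  by move=> q; rewrite inE => /eqP ->; rewrite (comb_poly_terms F' (fun=> x)).
have := hx0 _ (mem_head _ _); rewrite (comb_poly_terms F x0) /= => fx0.
by apply: (nz (x0 tt)); rewrite exprSr actM fx0.
Qed.

End Necessity.

Lemma comb_support (K : fieldType) (V : lmodType K) (J : eqType) (g : J -> V) l js :
  uniq js -> (forall j, coef l j != 0 -> j \in js) ->
  comb g l = \sum_(j <- js) coef l j *: g j.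
Proof.
move=> ujs hjs; pose js' := undup (js ++ [seq x.2 | x <- l]).
rewrite (@combE _ _ _ g l js') ?undup_uniq //; last first.
  by move=> x xl; rewrite mem_undup mem_cat map_f ?orbT.
rewrite -[RHS](@big_sub_uniq _ _ js js') ?undup_uniq //; last first.
  by move=> j jjs; rewrite mem_undup mem_cat jjs.
apply: eq_bigr => j _; case: ifP => // /negbT; apply: contraNeq => h.
by apply: hjs; apply: contraNneq h => ->; rewrite scale0r.
Qed.

Lemma comb_flatten (K : fieldType) (V : lmodType K) (J : eqType) (I : Type) (g : J -> V)
    (l : I -> seq (K * J)) s :
  comb g (flatten [seq l i | i <- s]) = \sum_(i <- s) comb g (l i).
Proof. by rewrite /comb big_flatten big_map. Qed.

Lemma phparE (L : lang) (M : structure L) m n r (y : phvar m n r -> M) : phpar y = sumf id y.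
Proof. by apply/funext => -[]. Qed.

Definition lproj (K J1 J2 : Type) (l : seq (K * (J1 + J2))) : seq (K * J1) :=
  pmap (fun x => if x.2 is inl z then Some (x.1, z) else None) l.

Lemma comb_lproj (K : fieldType) (V : lmodType K) (J1 J2 : eqType) (y : J1 -> V)
    (l : seq (K * (J1 + J2)%type)) :
  comb (sumv y (fun=> 0)) l = comb y (lproj l).
Proof.
elim: l => [|[a [z|z]] l IH]; rewrite /comb /= ?big_nil ?big_cons //= -!/(comb _ _) IH //.
by rewrite scaler0 add0r.
Qed.

Lemma coef_lproj (K : fieldType) (J1 J2 : eqType) (l : seq (K * (J1 + J2)%type)) z :
  coef (lproj l) z = coef l (inl z).
Proof.
elim: l => [|[a [x|x]] l IH]; first by rewrite /coef !big_nil.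
  by rewrite [lproj _]/= !coef_cons_comb IH.
by rewrite [lproj _]/= coef_cons_comb add0r.
Qed.

Section SeqsysBridge.
Variables (L : lang) (K : fieldType) (T : formula L void -> Prop) (D : vsdef L K) (C : kconf K).
Hypothesis dT : defines_vs T D.
Variables (M : structure L) (mM : model T M) (th : M -> M).
Local Notation VM := (vtype (model_vspace dT mM)).
Variable F : {linear VM -> VM}.
Hypothesis FE : forall v, vval (F v) = th (vval v).
Variables (m n r : nat) (S : seqsys K M m n r).

Lemma is_seqsys_lin : is_seqsys D C th S ->
  exists uld' uke', [/\ forall k, vval (uld' k : VM) = uld S k,
    forall k, vval (uke' k : VM) = uke S k & seqsys_lin C m (xi S) (fk S) (qk S) uke' F].
Proof.
move=> [halg hld hke].
have /choice[uld' uldE] : forall k, exists u : VM, vval u = uld S k.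
  by move=> k; have [_ _ _ Vu] := hld k; exists (vlift _ Vu).
have /choice[uke' ukeE] : forall k, exists u : VM, vval u = uke S k.
  by move=> k; have [e [_ _ _ _ [Vu _]]] := hke k; exists (vlift _ Vu).
exists uld', uke'; split=> //; split=> //.
  by move=> k; have [] := hld k.
move=> k; have [e [mf fe e0 qe [_ he]]] := hke k; exists e; split=> //.
by apply/vval_eq0; rewrite (vval_act FE) ukeE.
Qed.

Lemma sat_seqsysE uld' uke' (x : vidx m n r -> VM) :
  (forall k, vval (uld' k : VM) = uld S k) -> (forall k, vval (uke' k : VM) = uke S k) ->
  sat_seqsys D th S (fun k => vval (x k)) <->
  sat_seqsys_lin idfun (xi S) (Pc S) uld' (fk S) (qk S) uke' F x.
Proof.
move=> uldE ukeE.
have ldE k : vval (\sum_(l <- enum 'I_m) act F (Pc S k l) (x (li n r l)) + uld' k) =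
    vadd D (vsum D [seq peval D (Pc S k l) th (vval (x (li n r l))) | l <- enum 'I_m]) (uld S k).
  rewrite vvalD vval_sum uldE; congr (vadd _ (vsum _ _) _).
  by apply: eq_map => l; rewrite (vval_act FE).
split=> -[hld hke]; split=> k.
- by apply: vval_inj; rewrite (vval_act FE) hld -ldE.
- by apply: vval_inj; rewrite (vval_act FE) hke -ukeE.
- by rewrite -(vval_act FE) hld -ldE.
- by rewrite -(vval_act FE) hke -ukeE.
Qed.

End SeqsysBridge.

Section NecessitySeqsys.
Variables (L : lang) (K : fieldType) (T : formula L void -> Prop) (D : vsdef L K) (C : kconf K).
Hypotheses (clT : forall p, T p -> closedf p) (mcT : model_complete T) (dT : defines_vs T D).
Hypothesis HC : is_kconf C.
Variables (M : structure L) (th : M -> M).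
Hypothesis ecM : ec_model T D C th.
Variable (mM : model T M).
Local Notation VM := (vtype (model_vspace dT mM)).

Lemma vval_comb (J : Type) (s : seq J) (a : J -> K) (y : J -> VM) :
  vsum D [seq vscale D (a j) (vval (y j)) | j <- s] = vval (\sum_(j <- s) a j *: y j).
Proof. by rewrite vval_sum. Qed.

Lemma no_lindep_avoid m n r (psi : formula L (M + phvar m n r)) :
  no_lindep D psi -> forall cs : seq (seq (K * phvar m n r) * VM),
  (forall c, c \in cs -> exists a, coef c.1 a != 0) ->
  exists2 y : phvar m n r -> VM,
    sat (phpar (fun z => vval (y z))) (fun=> sinh M) psi &
    forall c, c \in cs -> comb y c.1 <> c.2.
Proof.
move=> nl cs hcs; apply: contrapT => ny; apply: nl.
pose supp := undup (flatten [seq [seq x.2 | x <- c.1] | c <- cs]).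
have csupp c a : c \in cs -> coef c.1 a != 0 -> a \in supp.
  move=> ccs /coef_mem[x xc <-]; rewrite mem_undup; apply/flatten_mapP.
  by exists c => //; apply: map_f.
pose cj (j : 'I_(size cs)) := tnth (in_tuple cs) j.
have cjcs j : cj j \in cs by apply: mem_tnth.
exists (size cs), supp, (fun j => coef (cj j).1), (fun j => vval (cj j).2); split.
- exact: undup_uniq.
- by move=> j; apply: vvalV.
- by move=> j; apply: hcs.
- by move=> j z; apply: csupp.
- move=> y Vy sy; pose y' z := vlift (model_vspace dT mM) (Vy z) : VM.
  apply: contrapT => nj; apply: ny; exists y' => // c ccs cE; apply: nj.
  have /tnthP[j jE] : c \in in_tuple cs by [].
  exists j; rewrite (vval_comb supp (coef (cj j).1) y'); congr vval.
  rewrite -(comb_support y') ?undup_uniq // -?/supp; first by rewrite /cj -jE.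
  by move=> a; apply: csupp.
Qed.

(** If V were finite, the equations x = v with v in V would form a finite disjunction implied by
    every formula. *)
Lemma no_lindep_infinite m n r (psi : formula L (M + phvar m n r)) (k : vidx m n r) :
  no_lindep D psi -> forall l : seq VM, exists v, v \notin l.
Proof.
move=> nl l; apply: contrapT => nv.
have [|y _ hy] := @no_lindep_avoid m n r psi nl [seq ([:: (1, (k, 0%N))], v) | v <- l].
- move=> c /mapP[v _ ->] /=; exists (k, 0%N).
  by rewrite /coef big_cons big_nil eqxx addr0 oner_neq0.
- apply: nv; exists (y (k, 0%N)); apply/negP => yl.
  apply: (hy ([:: (1, (k, 0%N))], y (k, 0%N))); first by apply/mapP; exists (y (k, 0%N)).
  by rewrite /comb big_seq1 scale1r.
Qed.

Lemma ec_seqsys m n r (S : seqsys K M m n r) (psi : formula L (M + phvar m n r)) :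
  is_seqsys D C th S -> closedf psi -> bounded S psi -> no_lindep D psi ->
  exists x : vidx m n r -> M,
    (forall k, inV D (x k)) /\ sat_psi_theta th psi x /\ sat_seqsys D th S x.
Proof.
move=> iS cpsi bpsi nl; have [tcM _] := ecM.
have [F FE] := theta_linear dT mM tcM.
(* Without variables V may be finite; then [psi] holds because it does not imply the empty
   disjunction. *)
have [[k0 _]|nok] := pselect (exists k : vidx m n r, True); last first.
  have nok' : forall k : vidx m n r, False by move=> k; apply: nok; exists k.
  exists (fun k => match nok' k with end); split; first by move=> k; case: (nok' k).
  have [//|y sy _] := no_lindep_avoid nl (cs := [::]).
  split; last by split=> k; [case: (nok' (ld _ _ k))|case: (nok' (ke _ _ k))].
  rewrite /sat_psi_theta; congr (sat (phpar _) _ _): sy.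
  by apply/funext => z; case: (nok' z.1).
have Vinf := no_lindep_infinite k0 nl.
have [uld' [uke' [uldE ukeE HS]]] := is_seqsys_lin FE iS.
have CF : cendo_lin C F by apply/(cendoE C FE); have [] := tcM.
pose A := ((vidx m n r * nat) + nat)%type.
pose inA (a : M + phvar m n r) : (M + A) + nat :=
  inl (match a with inl c => inl c | inr z => inr (inl z) end).
pose psi' : formula L (M + A) := frn 0 inA psi.
have cpsi' : closedf psi' by apply: ffv_frn cpsi.
have satpsi' (N : structure L) (f : M -> N) (g : A -> N) e :
    sat (sumf f g) e psi' <-> sat (sumf f (fun z => g (inl z))) e psi.
  rewrite (sat_frn (par' := sumf f (fun z => g (inl z)))); first by rewrite (_ : (fun n => e (0 + n)%N) = e).
  by move=> [c|z].
pose isl (a : A) := if a is inl _ then true else false.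
have [cs hcs|N [h [mN [iota [y [eh iinj iE indy sy]]]]]] :=
    @free_extension L K T D clT mcT dT M mM A psi' cpsi'.
  (* Dependencies between placeholders alone are avoided by a realization of [psi]; those involving
     the spare sequence are avoided afterwards, through the choice of its values. *)
  pose cs1 := [seq c <- cs | `[< forall a, coef c.1 a != 0 -> isl a >]].
  have [|y0 sy0 hy0] := no_lindep_avoid nl (cs := [seq (lproj c.1, c.2) | c <- cs1]).
    move=> c' /mapP[c]; rewrite mem_filter => /andP[/asboolP cl ccs] -> /=.
    have [a ca] := hcs c ccs; have := cl a ca; case: a ca => // z cz _.
    by exists z; rewrite coef_lproj.
  have [||y hyl hyc] := @avoid_dependencies K VM A Vinf
      (flatten [seq [seq x.2 | x <- c.1] | c <- cs]) cs isl (sumv y0 (fun=> 0)).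
  - move=> c a ccs /coef_mem[x xc <-]; apply/orP; right; apply/flatten_mapP; exists c => //.
    exact: map_f.
  - move=> c ccs cl; rewrite comb_lproj; apply: (hy0 (lproj c.1, c.2)).
    by apply/mapP; exists c => //; rewrite mem_filter ccs andbT; apply/asboolP.
  exists y => // e; apply/satpsi'.
  rewrite (_ : (fun z => vval (y (inl z))) = (fun z => vval (y0 z))).
    by rewrite -phparE; apply: (iffLR (sat_closed _ _ _ cpsi)) sy0.
  by apply/funext => z; rewrite hyl.
have [F' [x [F'i CF' itE satS]]] := extend_seqsys HC iinj (Pc S) uld' HS CF indy.
pose ldeq k : seq (K * phvar m n r) * VM :=
  (poly_terms (xi S k) (ld m r k) ++
   lscale (-1) (flatten [seq poly_terms (Pc S k l) (li n r l) | l <- enum 'I_m]), uld' k).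
pose keeq k : seq (K * phvar m n r) * VM :=
  (poly_terms (fk S k ^+ qk S k) (ke m n k), uke' k).
have ldeqE (V : lmodType K) (G : {linear V -> V}) (x' : vidx m n r -> V) k :
    comb (fun z : phvar m n r => iter z.2 G (x' z.1)) (ldeq k).1 =
    act G (xi S k) (x' (ld m r k)) - \sum_(l <- enum 'I_m) act G (Pc S k l) (x' (li n r l)).
  rewrite comb_cat comb_scale scaleN1r comb_flatten comb_poly_terms; congr (_ - _).
  by apply: eq_bigr => l _; rewrite comb_poly_terms.
have [|q|x0 [hpsi heq]] := @ec_solution L K T D C clT mcT dT M th ecM mM F FE N h mN iota F'
    ('I_m + 'I_n + 'I_r)%type x psi
    ([seq ldeq k | k <- enum 'I_n] ++ [seq keeq k | k <- enum 'I_r]) eh iE F'i CF' cpsi.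
- move=> e; have := iffLR (satpsi' _ _ _ e) (sy e).
  apply: (iffLR (sat_eq cpsi (fun _ _ => erefl) _)) => -[c|[k i]] oc //=.
  (* Boundedness of [psi] enters here: each placeholder that occurs is one at which the iterate of
     theta was prescribed. *)
  congr vval; apply/esym/itE; rewrite /bnd /=.
  case: k oc => [[l|k]|k] oc /=; first by rewrite eqxx.
    by apply/orP; right; apply: (bpsi.1 k i oc).
  by apply/orP; right; apply: (bpsi.2 k i oc).
- rewrite mem_cat => /orP[] /mapP[k _ ->].
    by rewrite ldeqE satS.1 addrC addKr.
  by rewrite comb_poly_terms satS.2.
exists (fun k => vval (x0 k)); split; first by move=> k; apply: vvalV.
split; first by rewrite /sat_psi_theta phparE; apply: hpsi.
apply: (iffRL (sat_seqsysE FE x0 uldE ukeE)); split=> k.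
  have := heq (ldeq k); rewrite ldeqE mem_cat map_f ?mem_enum // => /(_ isT) hk.
  by rewrite /= -[uld' k]hk addrC subrK.
have := heq (keeq k); rewrite comb_poly_terms mem_cat map_f ?mem_enum ?orbT // => /(_ isT) hk.
exact: hk.
Qed.

End NecessitySeqsys.

(** * Sufficiency *)

(** The parameters outside [S] are quantified existentially, which is harmless as the relation does
    not depend on them. This turns semantic independence into the syntactic condition of
    boundedness. *)
Lemma definable_restrict (L : lang) (T : formula L void -> Prop) (A : Type) (S : A -> Prop)
    (P : forall N : structure L, (A -> N) -> Prop) :
  definable T P ->
  (forall N, model T N -> forall par par' : A -> N, (forall a, S a -> par a = par' a) ->
     P N par -> P N par') ->
  exists p : formula L A, [/\ closedf p, forall a, fpar_occ a p -> S a &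
    forall N, model T N -> forall par e, sat par e p <-> P N par].
Proof.
move=> [p cp hp] dep.
pose f (a : A) : (A + A) + nat := if pselect (S a) then inl (inl a) else inl (inr a).
have cp' : closedf (frn 0 f p).
  by apply: ffv_frn cp => // a j _; rewrite /f; case: pselect.
have [q [cq _ sq oq]] := exists_params cp'; exists q; split=> //.
  move=> a /oq oa; have [b _] := fpar_occ_frn oa.
  by rewrite /f; case: pselect => // Sb [<-].
move=> N mN par e; rewrite sq.
have H g : sat (sumf par g) e (frn 0 f p) <->
    P N (fun a => if pselect (S a) then par a else g a).
  rewrite -(hp N mN _ e).
  rewrite (sat_frn (par' := fun a => if pselect (S a) then par a else g a)) //.
  by move=> a _; rewrite /rnspec /f; case: pselect.
split=> [[g /H]|hP]; last exists par; last apply/H.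
  by apply: dep => // a Sa; case: pselect.
by apply: dep hP => // a Sa; case: pselect.
Qed.

Lemma lingraph_val (L : lang) (K : fieldType) (D : vsdef L K) (N : structure L)
    (HN : is_vspace D N) I (s : seq I) (c : I -> K) (F : I -> vtype HN) (t : N) :
  lingraph D [seq (c i, vval (F i)) | i <- s] t <-> t = vval (\sum_(i <- s) c i *: F i).
Proof.
split=> [h|->]; last exact/lingraphE.
have Vt : inV D t.
  case: s h => [|i s] /=; first by move=> /(is0E HN) ->; apply: (vzeroV HN).
  by move=> [u [v [_ _ /(isaddV HN)[]]]].
by have /lingraphE -> : lingraph D [seq (c i, vval (F i)) | i <- s] (vval (vlift HN Vt)) := h.
Qed.

Section Flattening.
Variables (L : lang) (M : structure L).
Local Notation tm := (term (Ltheta L) M).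

(* The terms of the expanded language become parameters, whose values are
   constrained separately. *)
Fixpoint flat (q : formula (Ltheta L) M) : formula L tm :=
  match q with
  | FFalse => FFalse
  | FEq t1 t2 => FEq (TPar L t1) (TPar L t2)
  | FRel r args => @FRel L tm r (fun i => TPar L (args i))
  | FNot q => FNot (flat q)
  | FAnd q1 q2 => FAnd (flat q1) (flat q2)
  | FOr q1 q2 => FOr (flat q1) (flat q2)
  | FImp q1 q2 => FImp (flat q1) (flat q2)
  | FEx _ _ | FAll _ _ => FFalse
  end.

Lemma closed_flat q : closedf (flat q).
Proof.
rewrite /closedf; elim: q => //= [r args|q1 h1 q2 h2|q1 h1 q2 h2|q1 h1 q2 h2];
  by [apply/forallP|apply/andP].
Qed.

Lemma sat_flat (N : structure L) (th : N -> N) (par : M -> N) e (val : tm -> N) e0 q : qf q ->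
  (forall t, fpar_occ t (flat q) -> val t = teval (M := expand th) par e t) ->
  sat val e0 (flat q) <-> sat (M := expand th) par e q.
Proof.
elim: q => //= [t1 t2|r args|q IH|q1 IH1 q2 IH2|q1 IH1 q2 IH2|q1 IH1 q2 IH2].
- by move=> _ h; rewrite !h; [|right|left].
- move=> _ h; rewrite (_ : (fun i => val (args i)) =
    (fun i => teval (M := expand th) par e (args i))) //.
  by apply/funext => i; apply: h; exists i.
- by move=> qq h; rewrite IH.
- by move=> /andP[q1q q2q] h; rewrite IH1 ?IH2 // => t ot; apply: h; [right|left].
- by move=> /andP[q1q q2q] h; rewrite IH1 ?IH2 // => t ot; apply: h; [right|left].
- by move=> /andP[q1q q2q] h; rewrite IH1 ?IH2 // => t ot; apply: h; [right|left].
Qed.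

Definition subterms (t : tm) : seq {classic tm} :=
  if t is TApp o args then [seq (args i : {classic tm}) | i <- enum 'I_(far o)] else [::].

(** Constraints on values of terms are local, relating a term to its arguments; on a set closed
    under subterms they can be used by induction on terms. *)
Lemma subterm_list (l : seq {classic tm}) : exists s : seq {classic tm},
  (forall t, t \in l -> t \in s) /\
  forall t u, t \in s -> u \in subterms t -> u \in s.
Proof.
have one (t : {classic tm}) : exists s : seq {classic tm}, t \in s /\
    forall t u, t \in s -> u \in subterms t -> u \in s.
  elim: t => [n|a|o args IH].
  - exists [:: (TVar (Ltheta L) M n : {classic tm})]; split; first exact: (@mem_head {classic tm}).
    by move=> t u; rewrite (@mem_seq1 {classic tm}) => /eqP ->.
  - exists [:: (TPar (Ltheta L) a : {classic tm})]; split; first exact: (@mem_head {classic tm}).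
    by move=> t u; rewrite (@mem_seq1 {classic tm}) => /eqP ->.
  - have /choice[s sP] := IH.
    pose v : seq {classic tm} := flatten [seq s i | i <- enum 'I_(far o)].
    exists ((TApp args : {classic tm}) :: v); split; first exact: (@mem_head {classic tm}).
    have inv i t : t \in s i -> t \in (TApp args : {classic tm}) :: v.
      move=> ti; rewrite (@in_cons {classic tm}); apply/orP; right.
      by apply/flatten_mapP; exists i; rewrite ?mem_enum.
    move=> t u; rewrite (@in_cons {classic tm}) => /orP[/eqP ->|/flatten_mapP[i _ h] ut].
      by move=> /mapP[i _ ->]; apply: inv (sP i).1.
    exact: inv ((sP i).2 t u h ut).
elim: l => [|t l [s [ls cs]]]; first by exists [::].
have [s' [ts' cs']] := one t; exists (s' ++ s); split.
  by move=> u; rewrite (@in_cons {classic tm}) mem_cat => /orP[/eqP->|/ls ->]; rewrite ?ts' ?orbT.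
by move=> t' u; rewrite !mem_cat => /orP[h /(cs' _ _ h) ->|h /(cs _ _ h) ->]; rewrite ?orbT.
Qed.

End Flattening.

Definition lin_terms (K : fieldType) (A : Type) (I : finType) (a : A) (p : I -> {poly K}) :
    seq (K * (A + I * nat)) :=
  (1, inl a) :: [seq (z.1, inr z.2) | z <- flatten [seq poly_terms (p k) k | k <- enum I]].

Lemma lin_termsE (L : lang) (K : fieldType) (D : vsdef L K) (N : structure L)
    (HN : is_vspace D N) (th : {linear vtype HN -> vtype HN}) (M : Type) (h : M -> N)
    (I : finType) (x : I -> vtype HN) (y : I * nat -> N) a (b : vtype HN) p t :
  (forall z, y z = vval (iter z.2 th (x z.1))) -> h a = vval b ->
  lingraph D [seq (c.1, sumf h y c.2) | c <- lin_terms a p] t <->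
  t = vval (b + \sum_k act th (p k) (x k)).
Proof.
move=> yE ha.
pose s : seq (option (K * (I * nat))) :=
  None :: map Some (flatten [seq poly_terms (p k) k | k <- enum I]).
pose c (i : option (K * (I * nat))) := if i is Some z then z.1 else 1.
pose G (i : option (K * (I * nat))) := if i is Some z then iter z.2.2 th (x z.2.1) else b.
have -> : [seq (c.1, sumf h y c.2) | c <- lin_terms a p] = [seq (c i, vval (G i)) | i <- s].
  rewrite /= ha -!map_comp; congr (_ :: _); apply: eq_map => z /=.
  by rewrite yE.
rewrite lingraph_val; have -> : \sum_(i <- s) c i *: G i = b + \sum_k act th (p k) (x k); last by [].
rewrite big_cons scale1r big_map; congr (_ + _).
rewrite -[LHS]/(comb (fun z : I * nat => iter z.2 th (x z.1)) _) comb_flatten big_enum /=.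
by apply: eq_bigr => k _; rewrite comb_poly_terms.
Qed.

Lemma existential_prenex (L : lang) (A : Type) (p : formula L A) : existential p ->
  exists xs q, p = foldr (@FEx L A) q xs /\ qf q.
Proof.
elim: p => [|t1 t2|R args|q IH|q1 IH1 q2 IH2|q1 IH1 q2 IH2|q1 IH1 q2 IH2|x q IH|x q IH] //= ep;
  try by [exists [::]; eexists; split; [reflexivity|]].
by have [xs [q' [-> qq]]] := IH ep; exists (x :: xs), q'.
Qed.

Lemma ffv_foldr_ex (L : lang) (A : Type) (q : formula L A) xs : forall s,
  ffv_in s (foldr (@FEx L A) q xs) -> ffv_in (rev xs ++ s) q.
Proof. by elim: xs => //= x xs IH s /IH; rewrite rev_cons cat_rcons. Qed.

Lemma comb_filter0 (K : fieldType) (V : lmodType K) (J : eqType) (g : J -> V) (l : seq (K * J)) (P : pred (K * J)) :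
  (forall x, x \in l -> ~~ P x -> x.1 = 0) -> comb g [seq x <- l | P x] = comb g l.
Proof.
move=> h; rewrite /comb big_filter big_mkcond; apply: eq_big_seq => x xl.
by case: ifP => // /negbT /(h x xl) ->; rewrite scale0r.
Qed.

Lemma coef_filter0 (K : fieldType) (J : eqType) (l : seq (K * J)) (P : pred (K * J)) :
  (forall x, x \in l -> ~~ P x -> x.1 = 0) -> forall j, coef [seq x <- l | P x] j = coef l j.
Proof.
move=> h j; rewrite /coef big_filter_cond big_mkcond [RHS]big_mkcond; apply: eq_big_seq => x xl.
by case: (boolP (P x)) => //= /(h x xl) ->; rewrite if_same.
Qed.

Section ThetaSpec.
Variables (L : lang) (K : fieldType) (T : formula L void -> Prop) (D : vsdef L K).
Hypothesis dT : defines_vs T D.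
Variables (M : structure L) (B : Type).
Local Notation tm := (term (Ltheta L) M).
Variables (kind : tm -> Prop) (l1 l2 : tm -> seq (K * (M + B))).

(* [val] evaluates terms; the terms of [kind] are the arguments of [theta] with
   value in [V], whose images under [theta] are prescribed linear combinations. *)
Definition theta_spec (N : structure L) (par : M + B -> N) (val : tm -> N) (t : tm) : Prop :=
  match t with
  | TVar _ => True
  | TPar a => val t = par (inl a)
  | TApp o args =>
    match o as o0 return ('I_(@far (Ltheta L) o0) -> tm) -> Prop with
    | Some f => fun args => val t = @sfun L N f (fun i => val (args i))
    | None => fun args =>
      (kind (args ord0) ->
         lingraph D [seq (c.1, par c.2) | c <- l1 (args ord0)] (val (args ord0)) /\
         lingraph D [seq (c.1, par c.2) | c <- l2 (args ord0)] (val t)) /\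
      (~ kind (args ord0) -> ~ inV D (val (args ord0)) /\ is0 D (val t))
    end args
  end.

Lemma definable_theta_spec t : definable T (fun N (par : (M + B) + tm -> N) =>
  theta_spec (fun a => par (inl a)) (fun u => par (inr u)) t).
Proof.
case: t => [n|a|[f|] args] /=.
- exact: definable_true.
- exact: definable_eq.
- exists (FEq (TPar L (inr (TApp args : tm)))
    (@TApp L ((M + B) + tm) f (fun i => TPar L (inr (args i))))) => //.
  by apply/andP; split=> //; apply/forallP.
- have [k|nk] := pselect (kind (args ord0)).
    have h := definable_and
      (definable_lingraph dT (l1 (args ord0)) (fun a => inl a : (M + B) + tm) (inr (args ord0)))
      (definable_lingraph dT (l2 (args ord0)) (fun a => inl a : (M + B) + tm)
        (inr (TApp args : tm))).
    apply: definable_ext h => N _ par; split=> [h|[h _]]; last exact: h.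
    by split=> // nk; case: (nk k).
  have h := definable_and
    (definable_not (definable_inV dT (inr (args ord0) : (M + B) + tm)))
    (definable_is0 dT (inr (TApp args : tm) : (M + B) + tm)).
  apply: definable_ext h => N _ par; split=> [h|[_ h]]; last exact: h.
  by split=> // k; case: nk.
Qed.

End ThetaSpec.

Section InExtension.
Variables (L : lang) (K : fieldType) (T : formula L void -> Prop) (D : vsdef L K).
Hypotheses (mcT : model_complete T) (dT : defines_vs T D).
Variables (M : structure L) (mM : model T M).
Local Notation VM := (vtype (model_vspace dT mM)).
Variables (N : structure L) (h : M -> N) (mN : model T N) (eh : emb h).
Local Notation VN := (vtype (model_vspace dT mN)).
Variable (iota : {linear VM -> VN}).
Hypothesis iE : forall v, vval (iota v) = h (vval v).

(** A vector outside the list [l] exists in [N], namely [v'], and this definable fact descends to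
    [M]. *)
Lemma extension_infinite (v' : VN) : ~ image_of iota v' ->
  forall l : seq VM, exists v, v \notin l.
Proof.
move=> nv' l.
have dP := definable_ex (definable_and (definable_inV dT (inr tt : M + unit))
  (definable_all (s := l) (fun v _ => definable_not
    (definable_eq T (inr tt : M + unit) (inl (vval v)))))).
have [|g [Vg gl]] := iffRL (definable_emb mcT id dP mM mN eh).
  exists (fun=> vval v'); split; first exact: vvalV.
  by move=> v _ /= e; apply: nv'; exists v; apply: vval_inj; rewrite e iE.
exists (vlift (model_vspace dT mM) Vg); apply/negP => /gl; exact.
Qed.

(** Dependencies supported on [bnd o] fail at [y], so by model completeness they fail at some
    realization of [psi] in [M]. The others are made to fail by moving placeholders outside [bnd o],
    none of which occurs in [psi]. *)
Lemma no_lindep_of_extension m n r (o : vidx m n r -> {poly K}) (psi : formula L (M + phvar m n r))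
    (y : phvar m n r -> VN) :
  closedf psi -> (forall z, fpar_occ (inr z) psi -> bnd o z) ->
  (forall k, bnd o (k, 0%N)) -> indep (image_of iota) (bnd o) y ->
  (forall e, sat (sumf h (fun z => vval (y z))) e psi) -> no_lindep D psi.
Proof.
move=> cpsi opsi o0 indy sy [J [supp [a [v [usupp Vv anz asupp dep]]]]].
have /choice[v0 v0E] : forall j, exists u : VM, vval u = v j.
  by move=> j; exists (vlift _ (Vv j)).
have Vinf : (exists j : 'I_J, True) -> forall l : seq VM, exists v, v \notin l.
  move=> [j _]; have [[k i] _] := anz j.
  apply: (extension_infinite (v' := y (k, 0%N))) => ay.
  have := indy [:: (1, (k, 0%N))]; rewrite /supported /= o0 => /(_ isT).
  rewrite /comb big_seq1 scale1r => /(_ ay (k, 0%N)).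
  by rewrite /coef big_cons big_nil eqxx addr0 => /eqP; rewrite oner_eq0.
pose lj (j : 'I_J) : seq (K * phvar m n r) := [seq (a j z, z) | z <- supp].
have coefj j z : coef (lj j) z = a j z.
  rewrite /coef big_map /=; have [zs|zs] := boolP (z \in supp).
    rewrite big_mkcond (bigD1_seq z) //= eqxx big1 ?addr0 // => z' /negbTE -> //.
  rewrite big1_seq; last by move=> z' /andP[/eqP zz z's]; rewrite -zz z's in zs.
  by apply/esym; apply: contraNeq zs; apply: asupp.
have combj (V : lmodType K) (g : phvar m n r -> V) j : comb g (lj j) = \sum_(z <- supp) a j z *: g z.
  by rewrite /comb big_map.
pose js := [seq j <- enum 'I_J | `[< forall z, a j z != 0 -> bnd o z >]].
have [occ occP] := fpar_occ_fin psi.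
(* Membership in V can be demanded by a formula for finitely many placeholders only: those in [psi]
   or in a dependency. *)
pose zs := supp ++ pmap (fun x : {classic (M + phvar m n r)} =>
  match x : M + phvar m n r with inl _ => None | inr z => Some z end) occ.
have occ_zs z : fpar_occ (inr z) psi -> z \in zs.
  move=> /occP oz; rewrite mem_cat; apply/orP; right.
  by rewrite mem_pmap; apply/mapP; exists (inr z : {classic (M + phvar m n r)}).
have supp_zs z : z \in supp -> z \in zs by move=> zsu; rewrite mem_cat zsu.
have dP := definable_ex (definable_and (definable_form T (fun N _ => sinh N) cpsi)
  (definable_and (definable_all (s := zs) (fun z _ => definable_inV dT (inr z : M + phvar m n r)))
    (definable_all (s := js) (fun j _ => definable_not
      (definable_lingraph dT (lj j) (fun z => inr z : M + phvar m n r) (inl (v j))))))).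
have [|y0 [sy0 [Vy0 ly0]]] := iffRL (definable_emb mcT id dP mM mN eh).
  exists (fun z => vval (y z)); split; first exact: sy.
  split=> [z _|j]; first exact: vvalV.
  rewrite mem_filter => /andP[/asboolP bj _] /=.
  rewrite -v0E -iE => /(lingraphE (lj j) fst (fun x : K * phvar m n r => y x.2)) e.
  have [z az] := anz j; move/eqP: az; apply; rewrite -coefj.
  have l0 x : x \in lj j -> ~~ bnd o x.2 -> x.1 = 0.
    by move=> /mapP[z' _ ->] /=; apply: contraNeq; apply: bj.
  rewrite -(coef_filter0 l0); apply: indy; first exact: filter_all.
  by rewrite comb_filter0 //; exists (v0 j).
have nd y1 : (forall z, z \in zs -> bnd o z -> vval (y1 z : VM) = y0 z) ->
    exists j, comb y1 (lj j) = v0 j.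
  move=> y10; have [|j jE] := dep (fun z => vval (y1 z)) (fun z => vvalV _).
    rewrite phparE; apply: (iffLR (sat_eq cpsi (fun _ _ => erefl) _)) (iffLR (sat_closed _ _ _ cpsi) sy0).
    by move=> [c|z] oz //=; rewrite y10 //; [apply: occ_zs|apply: opsi].
  by exists j; apply: vval_inj; rewrite combj v0E -jE vval_sum.
pose y00 z : VM := if pselect (inV D (y0 z)) is left Vz then vlift (model_vspace dT mM) Vz else 0.
have y00E z : z \in zs -> vval (y00 z) = y0 z.
  by move=> zz; rewrite /y00; case: pselect => // /(_ (Vy0 z zz)).
have [j0 _] := nd y00 (fun z zz _ => y00E z zz).
have [||y1 y1b y1d] := @avoid_dependencies K VM _ (Vinf (ex_intro _ j0 I)) supp
    [seq (lj j, v0 j) | j <- enum 'I_J] (bnd o) y00.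
- move=> c z /mapP[j _ ->] /=; rewrite coefj => /asupp ->; exact: orbT.
- move=> c /mapP[j _ ->] /= bj e.
  have jjs : j \in js.
    by rewrite mem_filter mem_enum andbT; apply/asboolP => z az; apply: bj; rewrite coefj.
  apply: (ly0 j jjs) => /=; rewrite -v0E.
  have -> : [seq (x.1, y0 x.2) | x <- lj j] = [seq (x.1, vval (y00 x.2)) | x <- lj j].
    apply/eq_in_map => x /mapP[z zsu ->] /=; by rewrite y00E // supp_zs.
  exact: (iffRL (lingraphE (lj j) fst (fun x : K * phvar m n r => y00 x.2) (v0 j)) e).
have [|j] := nd y1; first by move=> z zz bz; rewrite y1b // y00E.
by apply: (y1d (lj j, v0 j)); apply/mapP; exists j; rewrite ?mem_enum.
Qed.

End InExtension.

Lemma lin_terms_eq (K : fieldType) (A N : Type) (I : finType) (o : I -> {poly K})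
    (par par' : A + I * nat -> N) (a : A) (p : I -> {poly K}) :
  (forall k, reduced o p k) ->
  (forall b, (if b is inr z then bnd o z : Prop else True) -> par b = par' b) ->
  [seq (c.1, par c.2) | c <- lin_terms a p] = [seq (c.1, par' c.2) | c <- lin_terms a p].
Proof.
move=> red h; rewrite /= h //; congr (_ :: _); rewrite -!map_comp; apply/eq_in_map => z.
move=> /flatten_mapP[k _ /mapP[i]]; rewrite mem_iota => /andP[_ /= ip] -> /=.
rewrite h // /bnd /=; have := red k; rewrite /reduced; case: eqP => //= _ po.
by case: (size (o k)) po => // d; rewrite ltnS; apply: leq_trans ip.
Qed.

Section SufficiencyProof.
Variables (L : lang) (K : fieldType) (T : formula L void -> Prop) (D : vsdef L K) (C : kconf K).
Hypotheses (mcT : model_complete T) (dT : defines_vs T D).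
Hypothesis HC : is_kconf C.
Variables (M : structure L) (th : M -> M).
Hypothesis tcM : modelTC T D C th.
Hypothesis icM : image_complete D C th.
Hypothesis axM : forall (m n r : nat) (S : seqsys K M m n r) (psi : formula L (M + phvar m n r)),
  is_seqsys D C th S -> closedf psi -> bounded S psi -> no_lindep D psi ->
  exists x : vidx m n r -> M,
    (forall k, inV D (x k)) /\ sat_psi_theta th psi x /\ sat_seqsys D th S x.
Local Notation tm := (term (Ltheta L) M).

Lemma ec_of_axioms : ec_model T D C th.
Proof.
split=> // M' th' h eh tc' p cp ep sp.
have [mM _ _ _ _] := tcM; have [mM' _ _ th'0 _] := tc'.
have [F FE] := theta_linear dT mM tcM; have [F' FE'] := theta_linear dT mM' tc'.
have ehL : emb (M := M) (M' := M') h.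
  by have [hinj hf hr] := eh; split=> // f args; apply: (hf (Some f)).
have hth x : h (th x) = th' (h x) by have [_ hf _] := eh; apply: (hf None (fun=> x)).
have [iota iinj iE] := emb_linear mcT dT mM mM' ehL.
have F'i v : F' (iota v) = iota (F v).
  by apply: vval_inj; rewrite FE' iE -hth -FE iE.
have CF' : cendo_lin C F' by apply/(cendoE C FE'); have [] := tc'.
have icF : image_complete_lin C F by apply/(image_completeE C FE).
have [xs [q [pE qq]]] := existential_prenex ep.
have cq : ffv_in (rev xs) q.
  by have := @ffv_foldr_ex _ _ q xs [::]; rewrite cats0; apply; rewrite -pE.
move: sp; rewrite pE => /sat_exn[e' _ sq'].
pose val' (t : tm) : M' := teval (M := expand th') h e' t.
have [l lP] := fpar_occ_fin (flat q).
have [Sg [lSg cSg]] := subterm_list l.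
(* The values of subterms in V are the vectors to be decomposed; a value outside V is replaced by
   0. *)
pose w (i : 'I_(size Sg)) : vtype (model_vspace dT mM') :=
  if pselect (inV D (val' (tnth (in_tuple Sg) i))) is left Vt
  then vlift (model_vspace dT mM') Vt else 0.
have [m [n [r [xi [uld [fk [qk [uke [x [HS satx indx wE]]]]]]]]]] :=
  seqsys_of_tuple HC iinj F'i CF' icF w.
pose o := seqsys_order (m := m) xi fk qk.
pose rhs (k : vidx m n r) : vtype (model_vspace dT mM) := seqsys_rhs uld uke k.
have satE (V : lmodType K) (G : {linear V -> V}) (j : {linear vtype (model_vspace dT mM) -> V})
    (z : vidx m n r -> V) p' : (forall v, G (j v) = j (F v)) ->
    sat_seqsys_lin j xi (fun _ _ => 0) uld fk qk uke G z ->
    \sum_k act G (p' k) (z k) =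
      j (\sum_k act F (p' k %/ o k) (rhs k)) + \sum_k act G (p' k %% o k) (z k).
  by move=> Gj; apply: seqsys_reduce.
have /choice[ap apP] : forall t : {classic tm}, exists ap : vtype (model_vspace dT mM) * (vidx m n r -> {poly K}),
    t \in Sg -> inV D (val' t) ->
    val' t = vval (iota ap.1 + \sum_k act F' (ap.2 k %% o k) (x k)).
  move=> t; have [tS|tS] := boolP (t \in Sg); last by exists (0, fun=> 0).
  have /tnthP[i ti] : t \in in_tuple Sg by [].
  have [v0 [p' wi]] := wE i.
  exists (v0 + \sum_k act F (p' k %/ o k) (rhs k), p') => _ Vt.
  rewrite linearD -addrA -(satE _ _ _ _ p' F'i satx) -wi /w -ti.
  by case: pselect.
(* [a1] and [p1] are the normal form of the value of [t]; [a2] and [p2] are the normal form of its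
   image under theta, obtained by multiplying by X and dividing by the orders. *)
pose a1 (t : tm) := (ap t).1.
pose p1 (t : tm) k := (ap t).2 k %% o k.
pose a2 (t : tm) := F (a1 t) + \sum_k act F ((p1 t k * 'X) %/ o k) (rhs k).
pose p2 (t : tm) k := (p1 t k * 'X) %% o k.
have theta_step (V : lmodType K) (G : {linear V -> V})
    (j : {linear vtype (model_vspace dT mM) -> V}) (z : vidx m n r -> V) t :
    (forall v, G (j v) = j (F v)) ->
    sat_seqsys_lin j xi (fun _ _ => 0) uld fk qk uke G z ->
    G (j (a1 t) + \sum_k act G (p1 t k) (z k)) = j (a2 t) + \sum_k act G (p2 t k) (z k).
  move=> Gj sz; rewrite linearD Gj linearD -addrA -(satE _ _ _ _ _ Gj sz); congr (_ + _).
  by rewrite linear_sum; apply: eq_bigr => k _; rewrite actMX act_th.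
pose kind (t : tm) := inV D (val' t).
pose l1 (t : tm) := lin_terms (vval (a1 t)) (p1 t).
pose l2 (t : tm) := lin_terms (vval (a2 t)) (p2 t).
pose spec N := @theta_spec L K D M (phvar m n r) kind l1 l2 N.
(* An L-relation: values of the terms exist that satisfy [q], with theta replaced by the prescribed
   linear combinations of placeholders. *)
pose P (N : structure L) (par : M + phvar m n r -> N) : Prop := exists val : tm -> N,
  sat val (fun=> sinh N) (flat q) /\ forall t, t \in Sg -> spec N par val t.
have dP : definable T P.
  have d1 := definable_reindex (fun t : tm => inr t : (M + phvar m n r) + tm)
    (definable_form T (fun N _ => sinh N) (closed_flat q)).
  have d2 := definable_all (s := Sg) (fun t _ => definable_theta_spec dT kind l1 l2 t).
  exact: definable_ex (definable_and d1 d2).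
pose S (a : M + phvar m n r) := if a is inr z then bnd o z : Prop else True.
have modred (p' : vidx m n r -> {poly K}) k : reduced o (fun k => p' k %% o k) k.
  by rewrite /reduced; have [//|ok0 /=] := eqVneq (o k) 0; rewrite ltn_modp.
have red1 t k : reduced o (p1 t) k by apply: modred.
have red2 t k : reduced o (p2 t) k by apply: (modred (fun k => p1 t k * 'X)).
(* The polynomials are reduced, so no placeholder beyond the bounds is consulted. *)
have depP N' : model T N' -> forall par par' : M + phvar m n r -> N',
    (forall a, S a -> par a = par' a) -> P N' par -> P N' par'.
  move=> _ par par' eqpar [val [sv cv]]; exists val; split=> // t /cv {cv sv}.
  case: t => [|a|[f|] args] //; first by rewrite /spec /= eqpar.
  by rewrite /spec /theta_spec /l1 /l2 (lin_terms_eq _ (red1 (args ord0)) eqpar) (lin_terms_eq _ (red2 (args ord0)) eqpar).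
have [psi [cpsi opsi psiE]] := definable_restrict dP depP.
pose y (z : phvar m n r) := iter z.2 F' (x z.1).
have PM' : P M' (sumf h (fun z => vval (y z))).
  exists val'; split.
    by apply/(sat_flat (th := th') (par := h) (e := e')).
  case=> [k|a|[f|] args] tS //; split=> [kt|nkt].
    have t'S : (args ord0 : {classic tm}) \in Sg.
      by apply: cSg tS _; apply/mapP; exists ord0; rewrite ?mem_enum.
    have yE z : vval (y z) = vval (iter z.2 F' (x z.1)) by [].
    have v'E : val' (args ord0) = vval (iota (a1 (args ord0)) + \sum_k act F' (p1 (args ord0) k) (x k)).
      exact: apP.
    split; apply/(lin_termsE (th := F') (x := x) _ _ yE (esym (iE _))) => //.
    by rewrite -(theta_step _ _ _ _ _ F'i satx) FE' -v'E.
  by split=> //; rewrite /val' /= th'0 //; apply/(vzeroP (model_vspace dT mM')).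
pose SS := SeqSys xi (fun (_ : 'I_n) (_ : 'I_m) => 0) (fun k => vval (uld k)) fk qk
  (fun k => vval (uke k)).
have [halg hld hke] := HS.
have iS : is_seqsys D C th SS.
  split=> //= k; first by have [mx dx cx] := hld k; split=> //; apply: vvalV.
  have [e [mf fe e0 qe ue]] := hke k; exists e; split=> //; split; first exact: vvalV.
  by rewrite -(vval_act FE) ue.
have bS : bounded SS psi.
  split=> k i /opsi; rewrite /S /bnd /o /=.
    by have [/monic_neq0/negbTE -> _ _] := hld k.
  have [e [/mirr_neq0 f0 _ _ _ _]] := hke k.
  by rewrite expf_eq0 (negbTE f0) andbF.
have o0 k : bnd o (k, 0%N).
  case: (seqsys_orderP HS k) => [ok|[_ sk]]; rewrite /bnd /= /o; first by rewrite ok eqxx.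
  by case: (size _) sk => [|[|d]] //; rewrite orbT.
have nl : no_lindep D psi.
  apply: (no_lindep_of_extension mcT (mM := mM) ehL iE cpsi _ o0 indx).
    by move=> z /opsi.
  by move=> e; apply/(psiE M' mM').
have [xM [VxM [psiM satM]]] := axM iS cpsi bS nl.
pose x0 k : vtype (model_vspace dT mM) := vlift (model_vspace dT mM) (VxM k).
have sat0 := iffLR (sat_seqsysE FE (S := SS) (uld' := uld) (uke' := uke) x0
  (fun _ => erefl) (fun _ => erefl)) satM.
move: psiM; rewrite /sat_psi_theta phparE => /(psiE M mM)[val [sv cv]].
(* Only the quantified variables may change; the others keep the ambient value. *)
pose e k := if k \in rev xs then val (TVar _ _ k) else sinh M.
pose eT k := val (TVar _ _ k).
have x0E z : iter z.2 th (xM z.1) = vval (iter z.2 F (x0 z.1)) by rewrite (vval_iter FE).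
(* The prescribed values are the true ones: at theta, both normal forms are evaluated at a solution
   of the system, and [theta_step] carries one to the other. *)
have valE (t : tm) : (t : {classic tm}) \in Sg -> val t = teval (M := expand th) id eT t.
  elim: t => [k|a|[f|] args IH] tS //=; first exact: (cv _ tS).
    have := cv _ tS; rewrite /spec /= => ->; congr sfun; apply/funext => i.
    apply: IH; apply: cSg tS _; apply/mapP; by exists i; rewrite ?mem_enum.
  have t'S : (args ord0 : {classic tm}) \in Sg.
    by apply: cSg tS _; apply/mapP; exists ord0; rewrite ?mem_enum.
  rewrite -IH //; have [c1 c2] := cv _ tS.
  have [kt|nkt] := pselect (kind (args ord0)); last first.
    have [nV /(is0E (model_vspace dT mM)) h0] := c2 nkt; have [_ _ _ tz _] := tcM.
    by rewrite tz.
  have [g1 g2] := c1 kt.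
  have ->  := iffLR (lin_termsE (h := id) (b := a1 _) _ _ x0E erefl) g1.
  have -> := iffLR (lin_termsE (h := id) (b := a2 _) _ _ x0E erefl) g2.
  rewrite -FE; congr vval; apply/esym.
  exact: (theta_step _ F idfun x0 (args ord0) (fun _ => erefl) sat0).
have sqM : sat (M := expand th) id eT q.
  apply: (iffLR (sat_flat (val := val) (fun=> sinh M) qq _)) => // t /lP /lSg; exact: valE.
apply/sat_exn; exists e.
  by move=> k kxs; rewrite /e mem_rev (negbTE kxs).
apply: (iffLR (sat_eq cq _ _)) sqM => // k kxs.
by rewrite /e kxs.
Qed.

End SufficiencyProof.

Theorem theorem3p37 (L : lang) (K : fieldType) (T : formula L void -> Prop)
  (D : vsdef L K) (C : kconf K) (M : structure L) (th : M -> M) :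
  (forall p, T p -> closedf p) ->
  model_complete T ->
  defines_vs T D ->
  is_kconf C ->
  kd C <> Some 1%N ->
  modelTC T D C th ->
  (ec_model T D C th <->
   image_complete D C th /\
   forall (m n r : nat) (S : seqsys K M m n r) (psi : formula L (M + phvar m n r)),
     is_seqsys D C th S -> closedf psi -> bounded S psi -> no_lindep D psi ->
     exists x : vidx m n r -> M,
       (forall k, inV D (x k)) /\ sat_psi_theta th psi x /\ sat_seqsys D th S x).
Proof.
move=> clT mcT dT HC _ tcM; split=> [ecM|[icM axM]]; last exact: ec_of_axioms.
have [mM _ _ _ _] := tcM; split; last first.
  by move=> m n r S psi; apply: (ec_seqsys clT mcT dT HC ecM mM).
have [F FE] := theta_linear dT mM tcM.
exact: (ec_image_complete clT mcT HC ecM FE).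
Qed.
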